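(* Let $\pi\colon E\to M$ be a fiber bundle over an oriented $m$-dimensional manifold with fixed volume form $\eta$. Given a Lagrangian density $\mathcal{L}=L\eta\colon J^1\pi\to\Lambda^mM$, we have that: 1. A (local) section $\sigma$ of $\pi$ is a solution of the Euler-Lagrange equations for $\mathcal{L}$ if and only if $$d\mathcal{L}\circ j^1\sigma=A_\pi^\eta\circ j^1(\mathrm{Leg}_{\mathcal{L}}\circ j^1\sigma).$$ 2. The local equations defining $S_{\mathcal{L}}:=(A_\pi^\eta)^{-1}(d\mathcal{L}(J^1\pi))$ as an $(m+1)$-Lagrangian submanifold of the premultisymplectic manifold $(J^1(\pi\circ\nu),\widetilde\Omega)$ are just the Euler-Lagrange equations for $\mathcal{L}$.
   Context: **Setting.** All manifolds and maps are smooth. $\pi\colon E\to M$ is a fiber bundle, $\dim M=m$, $\dim E=m+n$; $M$ is oriented with a fixed volume form $\eta$ (its pullbacks are also denoted $\eta$). Adapted coordinates on $E$ are $(x^i,u^\alpha)$, with $(x^i)$ coordinates on $M$ such that $\eta=d^mx:=dx^1\wedge\dots\wedge dx^m$; $d^{m-1}x_i:=i_{\partial/\partial x^i}d^mx$. The summation convention is used. **Bundles.** $J^1\pi$ is the first jet manifold of $\pi$, with projection $\pi_1\colon J^1\pi\to M$ and coordinates $(x^i,u^\alpha,u^\alpha_i)$; $j^1\sigma$ denotes the first jet prolongation of a section $\sigma$. For a fibration $\rho\colon P\to M$, $\Lambda^k_rP$ is the bundle of $k$-forms on $P$ annihilated by contraction with any $r$ vectors that are $\rho$-vertical. $\mathcal{M}\pi:=\Lambda^m_2E$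 has projection $\nu\colon\mathcal{M}\pi\to E$ and coordinates $(x^i,u^\alpha,p,p^i_\alpha)$ representing $p\,d^mx+p^i_\alpha\,du^\alpha\wedge d^{m-1}x_i$. $J^1(\pi\circ\nu)$ is the first jet bundle of $\pi\circ\nu\colon\mathcal{M}\pi\to M$, with coordinates $(x^i,u^\alpha,p,p^i_\alpha,u^\alpha_j,p_j,p^i_{\alpha j})$, where $u^\alpha_j,p_j,p^i_{\alpha j}$ are the $x^j$-derivatives of $u^\alpha,p,p^i_\alpha$. **Tulczyjew's morphism.** $A_\pi^\eta\colon J^1(\pi\circ\nu)\to\Lambda^{m+1}_2J^1\pi$ is the (coordinate-independent) vector bundle morphism over $\mathrm{id}_{J^1\pi}$ given in coordinates compatible with $\eta$ by $$(x^i,u^\alpha,p,p^i_\alpha,u^\alpha_j,p_j,p^i_{\alpha j})\mapsto(p^i_{\alpha i}\,du^\alpha+p^i_\alpha\,du^\alpha_i)\wedge d^mx\ \text{ at }(x^i,u^\alpha,u^\alpha_i).$$ **Lagrangian formalism.** A Lagrangian density is a fibered map $\mathcal{L}\colon J^1\pi\to\Lambda^mM$ over $M$, $\mathcal{L}=L\eta$ with $L\in C^\infty(J^1\pi)$, viewed as an $m$-form on $J^1\pi$; $d\mathcal{L}=dL\wedge\eta$ is a section of $\Lambda^{m+1}_2J^1\pi\to J^1\pi$. The extended Legendre transform is the (coordinate-independent) bundle morphism $\mathrm{Leg}_{\mathcal{L}}\colon J^1\pi\to\mathcal{M}\pi$ over $E$ given by $$\mathrm{Leg}_{\mathcal{L}}(x^i,u^\alpha,u^\alpha_i)=\Bigl(x^i,u^\alpha,\,p=L-\frac{\partial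 L}{\partial u^\alpha_i}u^\alpha_i,\,p^i_\alpha=\frac{\partial L}{\partial u^\alpha_i}\Bigr).$$ The Euler-Lagrange equations for a local section $\phi$ of $\pi$ are $$\frac{\partial L}{\partial u^\alpha}\circ j^1\phi-\frac{\partial}{\partial x^i}\Bigl(\frac{\partial L}{\partial u^\alpha_i}\circ j^1\phi\Bigr)=0,\qquad 1\le\alpha\le n.$$ **Lagrangian submanifolds.** $\widetilde\Omega=-dp^i_{\alpha i}\wedge du^\alpha\wedge d^mx-dp^i_\alpha\wedge du^\alpha_i\wedge d^mx$ is the (globally defined) premultisymplectic (i.e. closed) $(m+2)$-form on $J^1(\pi\circ\nu)$ obtained by pulling back by $A_\pi^\eta$ the canonical multisymplectic form (minus the differential of the tautological form) of $\Lambda^{m+1}_2J^1\pi$. For a closed $(k+1)$-form $\Omega$ on $P$, put $\flat_\Omega(v)=i_v\Omega$. A submanifold $S$ of $P$ is $l$-Lagrangian ($1\le l\le k$) if, for all $x\in S$, the subspace $W=T_xS/(T_xS\cap\ker\flat_{\Omega(x)})$ of $T_xP/\ker\flat_{\Omega(x)}$ satisfies $W=W^{\perp,l}$, where $W^{\perp,l}$ is the set of $v$ with $i_{v\wedge w_1\wedge\dots\wedge w_l}\Omega=0$ for all $w_1,\dots,w_l\in W$, computed with the induced form. Here $k=l=m+1$. *)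

(* Defs.v *)
From mathcomp Require Import all_boot all_order all_algebra.
From mathcomp Require Import all_classical all_reals all_analysis.

Set Implicit Arguments.
Unset Strict Implicit.
Unset Printing Implicit Defensive.
Import Order.TTheory GRing.Theory Num.Theory.
Import numFieldNormedType.Exports.
Local Open Scope classical_set_scope.
Local Open Scope ring_scope.

(* U is meant to be open: 'D_v f is the derivative in the ambient space. *)
Fixpoint Ck {R : realType} {V W : normedModType R}
    (k : nat) (U : set V) (f : V -> W) : Prop :=
  if k is k'.+1 then
    (forall x, U x -> differentiable f x) /\ (forall v, Ck k' U ('D_v f))
  else forall x, U x -> {for x, continuous f}.

Definition Cinf {R : realType} {V W : normedModType R}
  (U : set V) (f : V -> W) : Prop := forall k, Ck k U f.

(* [chart_map] is meaningful on [chart_dom], [chart_inv] (its inverse) on the image. *)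
Record chart (R : realType) (T : Type) (d : nat) := Chart {
  chart_dom : set T;
  chart_map : T -> 'rV[R]_d;
  chart_inv : 'rV[R]_d -> T }.

Definition chart_image {R : realType} {T d} (c : chart R T d) : set 'rV[R]_d :=
  chart_map c @` chart_dom c.

(* The underlying set is the subset [carrier] of the ambient type [pt], so
   that maps defined on a part of a manifold are total functions on [pt]. No
   axiom is imposed here; see [is_manifold]. *)
Record mfd (R : realType) (d : nat) := Mfd {
  pt : Type;
  carrier : set pt;
  atlas : set (chart R pt d) }.
Arguments Mfd {R d pt}.

Section Manifolds.
Variable R : realType.

Definition is_chart d (X : mfd R d) (c : chart R (pt X) d) : Prop :=
  [/\ chart_dom c `<=` carrier (m := X), open (chart_image c)
    & forall x, chart_dom c x -> chart_inv c (chart_map c x) = x].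

Definition smooth_transition T d (c c' : chart R T d) : Prop :=
  let O := chart_map c @` (chart_dom c `&` chart_dom c') in
  open O /\ Cinf O (chart_map c' \o chart_inv c).

Definition mopen d (X : mfd R d) (U : set (pt X)) : Prop :=
  U `<=` carrier (m := X) /\
  forall c, atlas (m := X) c -> open (chart_map c @` (U `&` chart_dom c)).

(* Second countable Hausdorff manifolds with their maximal smooth atlas. *)
Record is_manifold d (X : mfd R d) : Prop := IsManifold {
  mfd_chart : forall c, atlas (m := X) c -> is_chart c;
  mfd_cover : forall x, carrier (m := X) x ->
    exists2 c, atlas (m := X) c & chart_dom c x;
  mfd_compatible : forall c c',
    atlas (m := X) c -> atlas (m := X) c' -> smooth_transition c c';
  mfd_maximal : forall c, is_chart c ->
    (forall c', atlas (m := X) c' ->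
       smooth_transition c c' /\ smooth_transition c' c) ->
    atlas (m := X) c;
  mfd_hausdorff : forall x y, carrier (m := X) x -> carrier (m := X) y ->
    x <> y -> exists U V : set (pt X),
      [/\ mopen U, mopen V, U x, V y & U `&` V = set0];
  mfd_second_countable : exists B : nat -> set (pt X),
    (forall i, mopen (B i)) /\
    (forall (U : set (pt X)) x, mopen U -> U x ->
       exists2 i, B i x & B i `<=` U) }.

Definition smooth_map d e (X : mfd R d) (Y : mfd R e) (U : set (pt X))
    (f : pt X -> pt Y) : Prop :=
  (forall x, U x -> carrier (m := Y) (f x)) /\
  forall cX cY, atlas (m := X) cX -> atlas (m := Y) cY ->
    let O := chart_map cX @` [set x | [/\ U x, chart_dom cX x & chart_dom cY (f x)]] in
    open O /\ Cinf O (chart_map cY \o f \o chart_inv cX).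

Definition smooth_function d (X : mfd R d) (f : pt X -> R) : Prop :=
  forall c, atlas (m := X) c -> Cinf (chart_image c) (f \o chart_inv c).

Definition prod_chart T T' d d' (c : chart R T d) (c' : chart R T' d') :
    chart R (T * T') (d + d') :=
  Chart (chart_dom c `*` chart_dom c')
    (fun z => row_mx (chart_map c z.1) (chart_map c' z.2))
    (fun y => (chart_inv c (lsubmx y), chart_inv c' (rsubmx y))).

Definition prod_mfd d d' (X : mfd R d) (X' : mfd R d') : mfd R (d + d') :=
  Mfd (carrier (m := X) `*` carrier (m := X'))
    [set z | exists c c', [/\ atlas (m := X) c, atlas (m := X') c'
                            & z = prod_chart c c']].

(* T_xX is identified with R^d (row vectors) through a chart around x chosen
   once and for all. The tangent map of f acts by v |-> v *m Tmap f x. *)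
Definition pref_chart d (X : mfd R d) (x : pt X) : chart R (pt X) d :=
  @xget {classic chart R (pt X) d} (Chart set0 (fun=> 0) (fun=> x))
    [set c : {classic chart R (pt X) d} | atlas (m := X) c /\ chart_dom c x].

Definition Tmap d e (X : mfd R d) (Y : mfd R e) (f : pt X -> pt Y) (x : pt X) :
    'M[R]_(d, e) :=
  'J (chart_map (pref_chart (f x)) \o f \o chart_inv (pref_chart x))
     (chart_map (pref_chart x) x).

(* v *m dchart c x lists the components of the tangent vector v in the chart
   c, hence the rows of its inverse are the coordinate vector fields at x. *)
Definition dchart d (X : mfd R d) (c : chart R (pt X) d) (x : pt X) : 'M[R]_d :=
  'J (chart_map c \o chart_inv (pref_chart x)) (chart_map (pref_chart x) x).

Definition coord_vec d (X : mfd R d) (c : chart R (pt X) d) (x : pt X)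
  (i : 'I_d) : 'rV[R]_d := row i (invmx (dchart c x)).

Definition dcoord d (X : mfd R d) (c : chart R (pt X) d) (x : pt X)
  (i : 'I_d) : 'rV[R]_d -> R := fun v => (v *m dchart c x) 0 i.

Definition pderiv d (X : mfd R d) (c : chart R (pt X) d) (i : 'I_d)
  (f : pt X -> R) (x : pt X) : R :=
  'D_(delta_mx 0 i) (f \o chart_inv c) (chart_map c x).

Definition dfun d (X : mfd R d) (f : pt X -> R) (x : pt X) : 'rV[R]_d -> R :=
  fun v => 'D_v (f \o chart_inv (pref_chart x)) (chart_map (pref_chart x) x).

(* The arguments of a k-form on R^d are the k rows of a matrix; being
   multilinear and alternating is the separate property [is_altform]. *)
Definition altform (k d : nat) := 'M[R]_(k, d) -> R.

Definition is_altform k d (w : altform k d) : Prop :=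
  (forall (i : 'I_k) (A B C : 'M[R]_(k, d)) (b c : R),
     (row i A = b *: row i B + c *: row i C) ->
     row' i B = row' i A -> row' i C = row' i A -> w A = b * w B + c * w C) /\
  (forall (i j : 'I_k) (A : 'M[R]_(k, d)),
     i != j -> row i A = row j A -> w A = 0).

(* a /\ w, with the convention dx /\ dy (v1, v2) = dx v1 dy v2 - dx v2 dy v1 *)
Definition wedge1 k d (a : 'rV[R]_d -> R) (w : altform k d) : altform k.+1 d :=
  fun V => \sum_(j < k.+1) (-1) ^+ j * a (row j V) * w (row' j V).

Definition contract k d (v : 'rV[R]_d) (w : altform k.+1 d) : altform k d :=
  fun V => w (col_mx v V : 'M[R]_(1 + k, d)).

Definition pullback k d e (X : mfd R d) (Y : mfd R e) (f : pt X -> pt Y)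
  (w : pt Y -> altform k e) (x : pt X) : altform k d :=
  fun V => w (f x) (V *m Tmap f x).

Definition coord_volume m d (X : mfd R d) (c : chart R (pt X) d)
  (idx : 'I_m -> 'I_d) (x : pt X) : altform m d :=
  fun V => \det (\matrix_(a, b) dcoord c x (idx b) (row a V)).

Definition vertical d m (X : mfd R d) (M : mfd R m) (rho : pt X -> pt M)
  (x : pt X) : set 'rV[R]_d := [set v | v *m Tmap rho x = 0].

(* The bundle of k-forms on X annihilated by any r vectors vertical for rho. *)
Definition Lambda k r d m (X : mfd R d) (M : mfd R m) (rho : pt X -> pt M) :
    set (pt X * altform k d) :=
  [set z | [/\ carrier (m := X) z.1, is_altform z.2
    & forall (A : 'M[R]_(k, d)) (S : {set 'I_k}), (r <= #|S|)%N ->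
        (forall i, i \in S -> vertical rho z.1 (row i A)) -> z.2 A = 0]].

Record is_volume_form m (M : mfd R m) (eta : pt M -> altform m m) : Prop :=
  IsVolumeForm {
  volume_form : forall x, carrier (m := M) x -> is_altform (eta x);
  volume_nonzero : forall x, carrier (m := M) x -> exists V, eta x V != 0;
  volume_smooth : forall c, atlas (m := M) c ->
    Cinf (chart_image c)
      (fun y => let x := chart_inv c y in
         eta x (\matrix_i coord_vec c x i)) }.

(* eta = dx^1 /\ ... /\ dx^m on the domain of c *)
Definition unimodular m (M : mfd R m) (eta : pt M -> altform m m)
  (c : chart R (pt M) m) : Prop :=
  forall x, chart_dom c x -> eta x = coord_volume c id x.

(* F = 0 is a regular system of equations of S on the open set O of the
   coordinate space of c. *)
Definition local_equations d r (P : mfd R d) (S : set (pt P))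
    (c : chart R (pt P) d) (O : set 'rV[R]_d) (F : 'rV[R]_d -> 'rV[R]_r) : Prop :=
  [/\ open O /\ O `<=` chart_image c,
      Cinf O F,
      forall y, O y -> (S (chart_inv c y) <-> F y = 0)
    & forall y, O y -> F y = 0 -> \rank ('J F y) = r].

Definition is_submanifold d (r : nat) (P : mfd R d) (S : set (pt P)) : Prop :=
  S `<=` carrier (m := P) /\
  forall x, S x -> exists c (O : set 'rV[R]_d) (F : 'rV[R]_d -> 'rV[R]_r),
    [/\ atlas (m := P) c, chart_dom c x, O (chart_map c x) & local_equations S c O F].

Definition euclidean (d : nat) : mfd R d :=
  Mfd setT [set Chart (@setT 'rV[R]_d) id id].

(* Velocities at x of the smooth curves drawn on S. *)
Definition tangent_set d (P : mfd R d) (S : set (pt P)) (x : pt P) :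
    set 'rV[R]_d :=
  [set v | exists (U : set 'rV[R]_1) (g : pt (euclidean 1) -> pt P),
     [/\ open U /\ U 0, smooth_map (X := euclidean 1) U g,
         forall t, U t -> S (g t), g 0 = x & v = Tmap g 0]].

Definition flat_kernel k d (w : altform k.+1 d) : set 'rV[R]_d :=
  [set v | contract v w = fun=> 0].

(* S is an l-Lagrangian submanifold of (P, w), w being a (k+1)-form. The
   equality W = W^{perp,l} of subspaces of T_xP / ker(flat) is expressed on
   representatives v : the left-hand side says that the class of v is in W,
   the right-hand side that it is in W^{perp,l}. *)
Definition is_lagrangian d r k (l : nat) (P : mfd R d)
    (w : pt P -> altform k.+1 d) (S : set (pt P)) : Prop :=
  [/\ (1 <= l <= k)%N, is_submanifold r S
    & forall x, S x -> forall v : 'rV[R]_d,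
        (exists2 t, tangent_set S x t & flat_kernel (w x) (v - t)) <->
        (forall V : 'M[R]_(k.+1, d), row ord0 V = v ->
           (forall i : 'I_k.+1, (1 <= i <= l)%N -> tangent_set S x (row i V)) ->
           w x V = 0)].

Definition is_fiber_bundle m n (M : mfd R m) (E : mfd R (m + n))
    (pi : pt E -> pt M) : Prop :=
  [/\ smooth_map (carrier (m := E)) pi,
      forall x, carrier (m := M) x -> exists2 e, carrier (m := E) e & pi e = x
    & exists F : mfd R n, is_manifold F /\
      forall x, carrier (m := M) x ->
      exists (U : set (pt M)) (t : pt E -> pt F)
             (s : pt (prod_mfd M F) -> pt E),
      [/\ mopen U /\ U x,
          smooth_map (carrier (m := E) `&` pi @^-1` U) t,
          smooth_map (X := prod_mfd M F) (U `*` carrier (m := F)) s,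
          forall e, carrier (m := E) e -> U (pi e) -> s (pi e, t e) = e
        & forall y f, U y -> carrier (m := F) f ->
            pi (s (y, f)) = y /\ t (s (y, f)) = f]].

Definition local_section m k (M : mfd R m) (P : mfd R (m + k))
    (rho : pt P -> pt M) (U : set (pt M)) (s : pt M -> pt P) : Prop :=
  [/\ mopen U, smooth_map U s & forall x, U x -> rho (s x) = x].

(* Adapted charts of rho lying over charts in which eta = d^m x. *)
Definition adapted m k (M : mfd R m) (eta : pt M -> altform m m)
    (P : mfd R (m + k)) (rho : pt P -> pt M)
    (cM : chart R (pt M) m) (cP : chart R (pt P) (m + k)) : Prop :=
  [/\ atlas (m := M) cM, atlas (m := P) cP, unimodular eta cM
    & forall p, chart_dom cP p ->
        chart_dom cM (rho p) /\ lsubmx (chart_map cP p) = chart_map cM (rho p)].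

(* The 1-jet at x of a section s is (s x, T_x s). *)
Definition j1 m k (M : mfd R m) (P : mfd R (m + k)) (s : pt M -> pt P)
  (x : pt M) : pt P * 'M[R]_(m, m + k) := (s x, Tmap s x).

Definition jet_set m k (M : mfd R m) (P : mfd R (m + k)) (rho : pt P -> pt M) :
    set (pt P * 'M[R]_(m, m + k)) :=
  [set z | carrier (m := P) z.1 /\ z.2 *m Tmap rho z.1 = 1%:M].

(* Coordinates (y^a, y^b_i): the matrix of z.2 in the coordinate bases of cM
   and cP is the block row (1 | y^b_i). *)
Definition jet_chart m k (M : mfd R m) (P : mfd R (m + k))
    (rho : pt P -> pt M) (cM : chart R (pt M) m) (cP : chart R (pt P) (m + k)) :
    chart R (pt P * 'M[R]_(m, m + k)) (m + k + m * k) :=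
  Chart [set z | jet_set rho z /\ chart_dom cP z.1]
    (fun z => row_mx (chart_map cP z.1)
       (mxvec (rsubmx (invmx (dchart cM (rho z.1)) *m z.2 *m dchart cP z.1))))
    (fun y => let p := chart_inv cP (lsubmx y) in
       (p, dchart cM (rho p) *m row_mx 1%:M (vec_mx (rsubmx y))
             *m invmx (dchart cP p))).

Definition jet_mfd m k (M : mfd R m) (eta : pt M -> altform m m)
    (P : mfd R (m + k)) (rho : pt P -> pt M) : mfd R (m + k + m * k) :=
  Mfd (jet_set rho)
    [set c | exists cM cP, adapted eta rho cM cP /\ c = jet_chart rho cM cP].

Definition jet_proj m k (M : mfd R m) (P : mfd R (m + k)) (rho : pt P -> pt M)
  (z : pt P * 'M[R]_(m, m + k)) : pt M := rho z.1.

(* Positions of the coordinate y^a and of the x^i-derivative of y^b. *)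
Definition jbase {m k} (a : 'I_(m + k)) : 'I_(m + k + m * k) := lshift _ a.
Definition jder {m k} (i : 'I_m) (b : 'I_k) : 'I_(m + k + m * k) :=
  rshift _ (mxvec_index i b).

(* dim M is m.+1: the forms d^{m-1}x_i only make sense for dim M >= 1. *)
Section FieldTheory.
Variables (m n : nat) (M : mfd R m.+1) (eta : pt M -> altform m.+1 m.+1).
Variables (E : mfd R (m.+1 + n)) (pi : pt E -> pt M).

Definition dimMf := (n + (1 + m.+1 * n))%N.

Definition fu (a : 'I_n) : 'I_dimMf := lshift _ a.
Definition fp : 'I_dimMf := rshift _ (lshift _ 0).
Definition fpi (i : 'I_m.+1) (a : 'I_n) : 'I_dimMf :=
  rshift _ (rshift _ (mxvec_index i a)).

(* p d^m x + p^i_a du^a /\ d^{m-1}x_i at e *)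
Definition multimomentum (cE : chart R (pt E) (m.+1 + n)) (e : pt E)
    (p : R) (q : 'M[R]_(m.+1, n)) : altform m.+1 (m.+1 + n) :=
  let dmx := coord_volume cE (@lshift m.+1 n) e in
  fun V => p * dmx V + \sum_i \sum_a q i a *
    wedge1 (dcoord cE e (rshift _ a))
           (contract (coord_vec cE e (lshift _ i)) dmx) V.

(* p is recovered by evaluating on (d/dx^1, ..., d/dx^m), and p^i_a by
   evaluating on the same vectors with d/du^a in place of d/dx^i. *)
Definition mm_chart (cE : chart R (pt E) (m.+1 + n)) :
    chart R (pt E * altform m.+1 (m.+1 + n)) (m.+1 + dimMf) :=
  Chart [set z | Lambda 2 pi z /\ chart_dom cE z.1]
    (fun z =>
       let dx i := coord_vec cE z.1 (lshift _ i) in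
       let du a := coord_vec cE z.1 (rshift _ a) in
       row_mx (lsubmx (chart_map cE z.1))
         (row_mx (rsubmx (chart_map cE z.1))
           (row_mx (z.2 (\matrix_j dx j))%:M
             (mxvec (\matrix_(i, a)
                z.2 (\matrix_j if j == i then du a else dx j))))))
    (fun y =>
       let e := chart_inv cE (row_mx (lsubmx y) (lsubmx (rsubmx y))) in
       (e, multimomentum cE e (y 0 (rshift _ fp))
             (vec_mx (rsubmx (rsubmx (rsubmx y)))))).

Definition Mpi : mfd R (m.+1 + dimMf) :=
  Mfd (@Lambda m.+1 2 _ _ E M pi)
    [set c | exists cM cE, adapted eta pi cM cE /\ c = mm_chart cE].

Definition nu (z : pt Mpi) : pt E := z.1.

Definition J1pi := jet_mfd eta pi.
Definition pi1 : pt J1pi -> pt M := @jet_proj _ _ M E pi.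

Definition pinu : pt Mpi -> pt M := pi \o nu.
Definition J1pinu := @jet_mfd _ _ M eta Mpi pinu.

Definition j1pinu (t : pt M -> pt Mpi) : pt M -> pt J1pinu :=
  j1 (M := M) (P := Mpi) t.

Definition chartE (cM : chart R (pt M) m.+1) (cE : chart R (pt E) (m.+1 + n)) :
  chart R (pt J1pi) _ := jet_chart pi cM cE.
Definition chartM (cM : chart R (pt M) m.+1) (cE : chart R (pt E) (m.+1 + n)) :
  chart R (pt J1pinu) _ := @jet_chart _ _ M Mpi pinu cM (mm_chart cE).

(* positions in J^1 pi of u^a and u^a_i *)
Definition iu (a : 'I_n) : 'I_(m.+1 + n + m.+1 * n) := jbase (rshift _ a).
Definition iui (i : 'I_m.+1) (a : 'I_n) : 'I_(m.+1 + n + m.+1 * n) := jder i a.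

(* positions in J^1 (pi o nu) of x^i, u^a, u^a_i, p^i_a and p^i_{a j} *)
Definition wx (i : 'I_m.+1) : 'I_(m.+1 + dimMf + m.+1 * dimMf) :=
  jbase (lshift _ i).
Definition wu (a : 'I_n) : 'I_(m.+1 + dimMf + m.+1 * dimMf) :=
  jbase (rshift _ (fu a)).
Definition wui (i : 'I_m.+1) (a : 'I_n) :
  'I_(m.+1 + dimMf + m.+1 * dimMf) := jder i (fu a).
Definition wp (i : 'I_m.+1) (a : 'I_n) :
  'I_(m.+1 + dimMf + m.+1 * dimMf) := jbase (rshift _ (fpi i a)).
Definition wpj (i : 'I_m.+1) (a : 'I_n) (j : 'I_m.+1) :
  'I_(m.+1 + dimMf + m.+1 * dimMf) := jder j (fpi i a).

(* (x^i, u^a, u^a_i) extracted from the coordinates of J^1 (pi o nu) *)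
Definition jet_part (y : 'rV[R]_(m.+1 + dimMf + m.+1 * dimMf)) :
    'rV[R]_(m.+1 + n + m.+1 * n) :=
  row_mx (row_mx (\row_i y 0 (wx i)) (\row_a y 0 (wu a)))
         (mxvec (\matrix_(i, a) y 0 (wui i a))).

(* Morphisms which are coordinate-independent but given by a coordinate formula
   (here A, below the Legendre transform and the form Omega) are characterized
   by that formula in every adapted chart, which determines them. *)
Definition is_tulczyjew
    (A : pt J1pinu -> pt J1pi * altform m.+2 (m.+1 + n + m.+1 * n)) : Prop :=
  forall cM cE, adapted eta pi cM cE ->
  forall w, chart_dom (chartM cM cE) w ->
    let y := chart_map (chartM cM cE) w in
    let z := chart_inv (chartE cM cE) (jet_part y) in
    let d := dcoord (chartE cM cE) z in
    A w = (z,
      wedge1 (fun v =>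
          \sum_a (\sum_i y 0 (wpj i a i)) * d (iu a) v
          + \sum_i \sum_a y 0 (wp i a) * d (iui i a) v)
        (coord_volume (chartE cM cE) (fun i => jbase (lshift _ i)) z)).

Definition is_premultisymplectic
    (Om : pt J1pinu -> altform m.+3 (m.+1 + dimMf + m.+1 * dimMf)) : Prop :=
  forall cM cE, adapted eta pi cM cE ->
  forall w, chart_dom (chartM cM cE) w ->
    let d := dcoord (chartM cM cE) w in
    let dmx := coord_volume (chartM cM cE) wx w in
    Om w = fun V =>
      - (\sum_a wedge1 (fun v => \sum_i d (wpj i a i) v)
                  (wedge1 (d (wu a)) dmx) V)
      - \sum_i \sum_a wedge1 (d (wp i a)) (wedge1 (d (wui i a)) dmx) V.

Variable L : pt J1pi -> R.

(* The section d(L eta) = dL /\ eta of Lambda^{m+1}_2 J^1 pi, eta standing for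
   its pullback along pi1. *)
Definition dLagrangian (z : pt J1pi) :
    pt J1pi * altform m.+2 (m.+1 + n + m.+1 * n) :=
  (z, wedge1 (dfun L z) (pullback pi1 eta z)).

Definition is_legendre (Leg : pt J1pi -> pt Mpi) : Prop :=
  forall cM cE, adapted eta pi cM cE ->
  forall z, chart_dom (chartE cM cE) z ->
    let c := chartE cM cE in
    let y := chart_map c z in
    let q := \matrix_(i, a) pderiv c (iui i a) L z in
    let p := L z - \sum_i \sum_a q i a * y 0 (iui i a) in
    chart_dom (mm_chart cE) (Leg z) /\
    chart_map (mm_chart cE) (Leg z) =
      row_mx (lsubmx (chart_map cE z.1))
        (row_mx (rsubmx (chart_map cE z.1)) (row_mx p%:M (mxvec q))).

Definition euler_lagrange (U : set (pt M)) (s : pt M -> pt E) : Prop :=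
  forall cM cE, adapted eta pi cM cE ->
  forall x, U x -> chart_dom cE (s x) -> forall a : 'I_n,
    let c := chartE cM cE in
    pderiv c (iu a) L (j1 s x)
    - \sum_i pderiv cM i (fun y => pderiv c (iui i a) L (j1 s y)) x = 0.

Definition SL (A : pt J1pinu -> pt J1pi * altform m.+2 (m.+1 + n + m.+1 * n)) :
    set (pt J1pinu) :=
  [set w | carrier (m := J1pinu) w /\
           exists2 z, carrier (m := J1pi) z & A w = dLagrangian z].

(* The left-hand sides of p^i_{a i} - dL/du^a = 0, p^i_a - dL/du^a_i = 0, in
   the chart of J^1 (pi o nu) induced by (cM, cE). *)
Definition SL_equations (cM : chart R (pt M) m.+1)
    (cE : chart R (pt E) (m.+1 + n))
    (y : 'rV[R]_(m.+1 + dimMf + m.+1 * dimMf)) : 'rV[R]_(n + m.+1 * n) :=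
  let z := chart_inv (chartE cM cE) (jet_part y) in
  row_mx (\row_a ((\sum_i y 0 (wpj i a i)) - pderiv (chartE cM cE) (iu a) L z))
    (mxvec (\matrix_(i, a)
       (y 0 (wp i a) - pderiv (chartE cM cE) (iui i a) L z))).

End FieldTheory.
End Manifolds.

Arguments j1pinu {R m n M} eta {E} pi t _.
Arguments pinu {R m n M} eta {E} pi _.
Arguments SL {R m n M eta E pi} L A _.
Arguments SL_equations {R m n M eta E pi} L cM cE y.

(* Main.v *)
Require Import Defs.
From HB Require Import structures.
From mathcomp Require Import all_boot all_order all_algebra all_fingroup.
From mathcomp Require Import ring lra.
From mathcomp Require Import all_classical all_reals all_analysis.

Set Implicit Arguments.
Unset Strict Implicit.
Unset Printing Implicit Defensive.
Import Order.TTheory GRing.Theory Num.Theory.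
Import numFieldNormedType.Exports.
Local Open Scope classical_set_scope.
Local Open Scope ring_scope.

(** Everything is read in adapted charts. Let z = (x^i, u^a, u^a_i) be the
    coordinates of J^1 pi, and let pi_A(y) denote the momentum conjugate to the
    coordinate z^A at a point y of J^1 (pi o nu): it is sum_i p^i_{a i} for
    u^a, p^i_a for u^a_i, and 0 for x^i. In these terms

     - A = (sum_A pi_A dz^A) /\ d^m x and dL /\ eta = (sum_A L_A dz^A) /\ d^m x.
       A wedge product with d^m x determines the coefficients of its other factor
       along u^a and u^a_i ([wedge_coeff]), so the inverse image of the section
       d(L eta) is given by the equations pi_A = L_A, A running over the
       coordinates u^a and u^a_i: p^i_{a i} = dL/du^a and p^i_a = dL/du^a_i
       ([SL_chart]). These equations are solved for the momenta, hence regular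
       ([local_equations_SL]).

     - Omega = - sum_A d pi_A /\ dz^A /\ d^m x ([Om_chart]). On vectors tangent
       to S_L, d pi_A = sum_B H_AB dz^B modulo the dx^i, with H the Hessian matrix
       of L. As H is symmetric, Omega vanishes on tangent vectors
       ([omega_isotropic]). Conversely let v be orthogonal to all tuples of
       tangent vectors. Some tangent vector has the same components along J^1 pi
       as v; subtracting it, one may suppose that v has no such components. The
       coordinate vectors of J^1 pi lift to tangent vectors of S_L, and
       evaluating Omega on v and the lifts of d/dz^A, d/dx^1, ..., d/dx^m shows
       that the momentum component of v conjugate to z^A vanishes
       ([omega_test]). Then v is in the kernel of Omega ([omega_kernel]), which
       proves that S_L is Lagrangian ([lagrangian_SL]).

     - On the 1-jet of a section t of pi o nu over a section s of pi, the
       coordinates p^i_{a j} are the derivatives of the functions p^i_a, and the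
       point of J^1 pi below the jet of t is the jet of s. The second family of
       equations says that the momenta of t are those given by the Legendre
       transform; as this holds along the whole section it may be
       differentiated, and the first family becomes the Euler-Lagrange equations
       for s ([SL_euler_lagrange]). With t the Legendre transform of the jet of
       s, the second family holds identically, which gives the first part of the
       theorem and the correspondence between solutions.

    Charts have to be supplied for this. Adapted charts require coordinates on M
    in which eta = d^m x. If eta = f d^m x, the coordinate y^0 is replaced by the
    primitive of f with respect to y^0 ([unimodular_chart]); that this is a change
    of coordinates rests on differentiation under the integral sign and on the
    smoothness of inverse maps, which are proved first. Maximality of the atlas of
    E and local triviality then give adapted charts of E ([adapted_chart]). The
    charts of the bundle of momenta and of both jet bundles are those induced by
    adapted charts; their transition maps are computed explicitly ([jet_wf],
    [Mpi_wf]). *)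

(** * Smooth maps between normed spaces *)

Section Calculus.
Variable R : realType.
Implicit Types V W : normedModType R.

(** The remainders below are bounded by explicit estimates, for which the
    epsilon form of differentiability is the convenient one. *)
Lemma is_diff_eps V W (f : V -> W) (df : {linear V -> W}) x :
  continuous df ->
  (forall e : R, 0 < e ->
     \forall h \near (0 : V), `|f (h + x) - f x - df h| <= e * `|h|) ->
  is_diff x f df.
Proof.
move=> dfc fdf.
have H : f \o shift x = cst (f x) + df +o_ 0 id.
  apply/eqaddoP => e e0; have := fdf _ e0; apply: filterS => h.
  by rewrite /= /GRing.add /= /GRing.opp /= opprD addrA.
have dE := diff_unique dfc H.
apply: DiffDef => //; apply/diff_locallyP; split; first by rewrite dE.
by rewrite dE.
Qed.

Lemma diff_eps V W (f : V -> W) x : differentiable f x ->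
  forall e : R, 0 < e ->
    \forall h \near (0 : V), `|f (h + x) - f x - 'd f x h| <= e * `|h|.
Proof.
move=> /diff_locally /eqaddoP df e e0; have := df _ e0.
apply: filterS => h.
by rewrite /= /GRing.add /= /GRing.opp /= opprD addrA.
Qed.

(** Coordinate expressions are total functions that are meaningful near a
    point only; their differentials have to be known to depend on the germ. *)
Lemma near_eq_is_diff V W (f g : V -> W) x :
  {near x, f =1 g} -> differentiable f x -> is_diff x g ('d f x).
Proof.
move=> fg df; apply: is_diff_eps; first exact: diff_continuous.
move=> e e0; have fgx := nbhs_singleton fg.
have fg0 : \forall h \near (0 : V), f (h + x) = g (h + x).
  have fg1 : \forall y \near x, f y = g y := fg.
  by move: fg1; rewrite (near_shift 0 x) subr0.
near=> h.
rewrite -fgx -(near fg0 h) //; near: h; exact: diff_eps.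
Unshelve. all: by end_near. Qed.

Lemma near_eq_differentiable V W (f g : V -> W) x :
  {near x, f =1 g} -> differentiable f x -> differentiable g x.
Proof. by move=> fg df; have [] := near_eq_is_diff fg df. Qed.

Lemma near_eq_continuous_at V W (f g : V -> W) x :
  {near x, f =1 g} -> {for x, continuous f} -> {for x, continuous g}.
Proof.
move=> fg cf; rewrite /prop_for /continuous_at -(nbhs_singleton fg).
by apply: cvg_trans cf; apply: near_eq_cvg.
Qed.

Lemma near_open V (U : set V) (P : V -> Prop) x :
  open U -> U x -> (forall y, U y -> P y) -> \forall y \near x, P y.
Proof.
by move=> oU Ux UP; apply: filterS UP _; apply: open_nbhs_nbhs.
Qed.

Lemma CkSP V W k (U : set V) (f : V -> W) :
  Ck k.+1 U f <->
  (forall x, U x -> differentiable f x) /\ (forall v, Ck k U ('D_v f)).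
Proof. by []. Qed.

Lemma Ck_ext V W k (U : set V) (f g : V -> W) : open U ->
  (forall x, U x -> f x = g x) -> Ck k U f -> Ck k U g.
Proof.
move=> oU; elim: k f g => [|k IH] f g fg /=.
  move=> cf x Ux; apply: (near_eq_continuous_at (f := f)); last exact: cf.
  exact: near_open oU Ux fg.
move=> [df Df]; split=> [x Ux|v].
  apply: (near_eq_differentiable (f := f)); last exact: df.
  exact: near_open oU Ux fg.
apply: IH (Df v) => x Ux; apply: near_eq_derive; exact: near_open oU Ux fg.
Qed.

Lemma Ck_sub V W k (U U' : set V) (f : V -> W) :
  U' `<=` U -> Ck k U f -> Ck k U' f.
Proof.
move=> UU'; elim: k f => [|k IH] f /=; first by move=> cf x /UU'; exact: cf.
by move=> [df Df]; split=> [x /UU'|v]; [exact: df|exact: IH].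
Qed.

Lemma Ck_local V W k (U : set V) (f : V -> W) :
  (forall x, U x -> exists O, [/\ open O, O x & Ck k O f]) -> Ck k U f.
Proof.
elim: k f => [|k IH] f /= H.
  by move=> x /H [D [_ Dx cf]]; exact: cf.
split=> [x /H[D [_ Ox [df _]]]|v]; first exact: df.
by apply: IH => x /H[D [oO Ox [_ Df]]]; exists D; split.
Qed.

Lemma CkS V W k (U : set V) (f : V -> W) : Ck k.+1 U f -> Ck k U f.
Proof.
elim: k f => [|k IH] f.
  by move=> [df _] x Ux; apply: differentiable_continuous; exact: df.
by move=> [df Df]; split=> // v; apply: IH.
Qed.

Lemma Ck_cst V W k (U : set V) (a : W) : Ck k U (fun _ : V => a).
Proof.
elim: k a => [|k IH] a /=; first by move=> x _; exact: cst_continuous.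
split=> [x _|v]; first exact: differentiable_cst.
rewrite (_ : 'D_v _ = fun=> 0) //.
by apply/funext => x; exact: derive_cst.
Qed.

Lemma Ck_lin V W k (U : set V) (f : {linear V -> W}) :
  continuous f -> Ck k U f.
Proof.
move=> cf; case: k => [|k] /=; first by move=> x _; exact: cf.
have df x : differentiable f x by exact: linear_differentiable.
split=> [x _|v]; first exact: df.
rewrite (_ : 'D_v _ = fun=> f v); first exact: Ck_cst.
by apply/funext => x; rewrite deriveE // diff_lin.
Qed.

Lemma Ck_id V k (U : set V) : Ck k U (@id V).
Proof. exact: (@Ck_lin V V k U idfun (fun x => cvg_id)). Qed.

Section Closure.
Variables (V : normedModType R) (U : set V).
Hypothesis oU : open U.

Lemma CkD W k (f g : V -> W) :
  Ck k U f -> Ck k U g -> Ck k U (fun x => f x + g x).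
Proof.
elim: k f g => [|k IH] f g /=.
  by move=> cf cg x Ux; apply: continuousD; [exact: cf|exact: cg].
move=> [df Df] [dg Dg]; split=> [x Ux|v].
  by apply: differentiableD; [exact: df|exact: dg].
apply: Ck_ext (IH _ _ (Df v) (Dg v)) => // x Ux.
by rewrite -deriveD //; apply: diff_derivable; [exact: df|exact: dg].
Qed.

Lemma CkM k (f g : V -> R) :
  Ck k U f -> Ck k U g -> Ck k U (fun x => f x * g x).
Proof.
elim: k f g => [|k IH] f g.
  by move=> cf cg x Ux; apply: continuousM; [exact: cf|exact: cg].
move=> cf cg; have /CkSP[df Df] := cf; have /CkSP[dg Dg] := cg.
split=> [x Ux|v]; first by apply: differentiableM; [exact: df|exact: dg].
apply: (@Ck_ext _ _ _ _ (fun x => f x * 'D_v g x + g x * 'D_v f x)) => //.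
  move=> x Ux; rewrite -(deriveM (f := f) (g := g)) //;
    apply: diff_derivable; [exact: df|exact: dg].
by apply: CkD; apply: IH => //; exact: CkS.
Qed.

Lemma CkN k (f : V -> R) : Ck k U f -> Ck k U (fun x => - f x).
Proof.
move=> cf; apply: (@Ck_ext _ _ _ _ (fun x => (-1) * f x)) => //.
  by move=> x _; rewrite mulN1r.
by apply: CkM => //; exact: Ck_cst.
Qed.

Lemma CkB k (f g : V -> R) :
  Ck k U f -> Ck k U g -> Ck k U (fun x => f x - g x).
Proof. by move=> cf cg; apply: CkD => //; exact: CkN. Qed.

Lemma Ck_sum W k (I : Type) (r : seq I) (P : pred I) (f : I -> V -> W) :
  (forall i, P i -> Ck k U (f i)) -> Ck k U (fun x => \sum_(i <- r | P i) f i x).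
Proof.
move=> cf; elim: r => [|i r IH].
  apply: Ck_ext oU _ (Ck_cst k U (0 : W)) => x _; by rewrite big_nil.
have [Pi|Pi] := boolP (P i).
  apply: Ck_ext oU _ (CkD (cf _ Pi) IH) => x _; by rewrite big_cons Pi.
by apply: Ck_ext oU _ IH => x _; rewrite big_cons (negbTE Pi).
Qed.

Lemma Ck_prod k (I : Type) (r : seq I) (P : pred I) (f : I -> V -> R) :
  (forall i, P i -> Ck k U (f i)) -> Ck k U (fun x => \prod_(i <- r | P i) f i x).
Proof.
move=> cf; elim: r => [|i r IH].
  apply: Ck_ext oU _ (Ck_cst k U (1 : R)) => x _; by rewrite big_nil.
have [Pi|Pi] := boolP (P i).
  apply: Ck_ext oU _ (CkM (cf _ Pi) IH) => x _; by rewrite big_cons Pi.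
by apply: Ck_ext oU _ IH => x _; rewrite big_cons (negbTE Pi).
Qed.

Lemma Ck_det k d (F : V -> 'M[R]_d) :
  (forall i j, Ck k U (fun x => F x i j)) -> Ck k U (fun x => \det (F x)).
Proof.
move=> cF; apply: Ck_sum => s _; apply: CkM; first exact: Ck_cst.
by apply: Ck_prod.
Qed.

Lemma Ck_inv k (f : V -> R) : (forall x, U x -> f x != 0) ->
  Ck k U f -> Ck k U (fun x => (f x)^-1).
Proof.
move=> f0; elim: k => [|k IH].
  by move=> cf x Ux; apply: continuousV; [exact: f0|exact: cf].
move=> cf; have /CkSP[df Df] := cf; split=> [x Ux|v].
  by apply: differentiableV; [exact: df|exact: f0].
apply: (@Ck_ext _ _ _ _ (fun x => - ((f x)^-1 * (f x)^-1 * 'D_v f x))) => //.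
  move=> x Ux; rewrite (deriveV (f := f)); [|exact: f0|]; last first.
    by apply: diff_derivable; exact: df.
  by rewrite scaleNr expr2 invfM.
have Ci := IH (CkS cf).
by apply: CkN; apply: CkM => //; apply: CkM.
Qed.

Lemma differentiable_mx p q (F : V -> 'M[R]_(p, q)) x :
  (forall i j, differentiable (fun x => F x i j) x) -> differentiable F x.
Proof.
move=> dF.
have -> : F = \sum_i \sum_j (fun x => F x i j *: delta_mx i j).
  apply/funext => y; rewrite {1}[F y]matrix_sum_delta fct_sumE.
  by apply: eq_bigr => i _; rewrite fct_sumE.
apply: differentiable_sum => i; apply: differentiable_sum => j.
exact: differentiableZl.
Qed.

Lemma continuous_at_mx p q (F : V -> 'M[R]_(p, q)) x :
  (forall i j, {for x, continuous (fun x => F x i j)}) -> {for x, continuous F}.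
Proof.
move=> cF; apply/cvgrPdist_le => /= e e0; near=> y.
rewrite /Num.Def.normr /= mx_normrE (bigmax_le _ (ltW e0)) //= => i _.
rewrite !mxE /=; move: i; near: y; apply: filter_forall => -[i j].
exact: ((cvgrPdist_le _ _).1 (cF i j)).
Unshelve. all: by end_near. Qed.

Lemma Ck_mx k p q (F : V -> 'M[R]_(p, q)) :
  (forall i j, Ck k U (fun x => F x i j)) -> Ck k U F.
Proof.
elim: k F => [|k IH] F cF.
  by move=> x Ux; apply: continuous_at_mx => i j; exact: cF.
have dF x : U x -> differentiable F x.
  by move=> Ux; apply: differentiable_mx => i j; have [+ _] := cF i j; apply.
split=> // v; apply: IH => i j.
apply: Ck_ext oU _ ((cF i j).2 v) => x Ux.
by rewrite derive_mx ?mxE //; apply: diff_derivable; exact: dF.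
Qed.

Lemma Ck_entry k p q (F : V -> 'M[R]_(p, q)) i j :
  Ck k U F -> Ck k U (fun x => F x i j).
Proof.
elim: k F => [|k IH] F.
  move=> cF x Ux.
  have /= := @continuous_comp _ _ _ F (fun N : 'M[R]_(p, q) => N i j) x (cF x Ux).
  by apply; apply: differentiable_continuous; exact: differentiable_coord.
move=> [dF DF].
have dFx x : U x -> differentiable (fun x => F x i j) x.
  move=> Ux; apply: (differentiable_comp (g := fun N : 'M[R]_(p, q) => N i j)).
    exact: dF.
  exact: differentiable_coord.
split=> // v; apply: Ck_ext oU _ (IH _ (DF v)) => x Ux.
by rewrite derive_mx ?mxE //; apply: diff_derivable; exact: dF.
Qed.

End Closure.

Lemma derive_comp_rV V d W (f : V -> 'rV[R]_d) (g : 'rV[R]_d -> W) x v :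
  differentiable f x -> differentiable g (f x) ->
  'D_v (g \o f) x = \sum_j 'D_v (fun y => f y 0 j) x *: 'D_(delta_mx 0 j) g (f x).
Proof.
move=> df dg; rewrite deriveE; last exact: differentiable_comp.
have E : 'd f x v = \sum_j 'D_v (fun y => f y 0 j) x *: delta_mx 0 j.
  rewrite -deriveE // (derive_mx (M := f)); last exact: diff_derivable.
  by rewrite [LHS]row_sum_delta; apply: eq_bigr => j _; rewrite mxE.
rewrite diff_comp //= E linear_sum.
by apply: eq_bigr => j _; rewrite linearZ /= -deriveE.
Qed.

(** By induction on k through the chain rule: the derivative of the composite
    is a sum of products of a derivative of f and of a partial derivative of g
    composed with f, both of class one less. *)
Lemma Ck_comp V k d (U : set V) (U' : set 'rV[R]_d) (f : V -> 'rV[R]_d)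
    (g : 'rV[R]_d -> R) : open U -> open U' ->
  (forall x, U x -> U' (f x)) ->
  Ck k U f -> Ck k U' g -> Ck k U (g \o f).
Proof.
move=> oU oU' UU'; elim: k g => [|k IH] g.
  move=> cf cg x Ux; apply: continuous_comp; first exact: cf.
  by apply: cg; exact: UU'.
move=> cf cg; have /CkSP[df Df] := cf; have /CkSP[dg Dg] := cg; split=> [x Ux|v].
  by apply: differentiable_comp; [exact: df|apply/dg/UU'].
apply: (@Ck_ext _ _ _ _ (fun x => \sum_j 'D_v (fun y => f y 0 j) x *
     ('D_(delta_mx 0 j) g \o f) x)) => //.
  by move=> x Ux; rewrite derive_comp_rV //; [exact: df|apply/dg/UU'].
apply: Ck_sum => // j _; apply: CkM => //.
  by have [_] := Ck_entry oU 0 j cf; apply.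
by apply: IH; [exact: CkS|exact: Dg].
Qed.

Lemma Cinf_ext V W (U : set V) (f g : V -> W) : open U ->
  (forall x, U x -> f x = g x) -> Cinf U f -> Cinf U g.
Proof. by move=> oU fg cf k; apply: Ck_ext (cf k). Qed.

Lemma Cinf_sub V W (U U' : set V) (f : V -> W) :
  U' `<=` U -> Cinf U f -> Cinf U' f.
Proof. by move=> UU' cf k; apply: Ck_sub (cf k). Qed.

Lemma Cinf_local V W (U : set V) (f : V -> W) :
  (forall x, U x -> exists O, [/\ open O, O x & Cinf O f]) -> Cinf U f.
Proof.
move=> H k; apply: Ck_local => x /H [D [oD Dx cO]]; exists D; split=> //.
Qed.

Lemma Cinf_diff V W (U : set V) (f : V -> W) x :
  Cinf U f -> U x -> differentiable f x.
Proof. by move=> cf; have /CkSP[+ _] := cf 1%N; apply. Qed.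

Lemma Cinf_continuous V W (U : set V) (f : V -> W) x :
  Cinf U f -> U x -> {for x, continuous f}.
Proof. by move=> cf; have := cf 0%N; apply. Qed.

Lemma Cinf_deriv V W (U : set V) (f : V -> W) v :
  Cinf U f -> Cinf U ('D_v f).
Proof. by move=> cf k; have /CkSP[_] := cf k.+1; apply. Qed.

Lemma Cinf_cst V W (U : set V) (a : W) : Cinf U (fun _ : V => a).
Proof. by move=> k; exact: Ck_cst. Qed.

Lemma Cinf_id V (U : set V) : Cinf U (@id V).
Proof. by move=> k; exact: Ck_id. Qed.

Lemma CinfD V W (U : set V) (f g : V -> W) : open U ->
  Cinf U f -> Cinf U g -> Cinf U (fun x => f x + g x).
Proof. by move=> oU cf cg k; apply: CkD. Qed.

Lemma CinfM V (U : set V) (f g : V -> R) : open U ->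
  Cinf U f -> Cinf U g -> Cinf U (fun x => f x * g x).
Proof. by move=> oU cf cg k; apply: CkM. Qed.

Lemma CinfB V (U : set V) (f g : V -> R) : open U ->
  Cinf U f -> Cinf U g -> Cinf U (fun x => f x - g x).
Proof. by move=> oU cf cg k; apply: CkB. Qed.

Lemma Cinf_sum V W (U : set V) (I : Type) (r : seq I) (P : pred I)
    (f : I -> V -> W) : open U ->
  (forall i, P i -> Cinf U (f i)) -> Cinf U (fun x => \sum_(i <- r | P i) f i x).
Proof. by move=> oU cf k; apply: Ck_sum => // i Pi; exact: cf. Qed.

Lemma Cinf_det V (U : set V) d (F : V -> 'M[R]_d) : open U ->
  (forall i j, Cinf U (fun x => F x i j)) -> Cinf U (fun x => \det (F x)).
Proof. by move=> oU cF k; apply: Ck_det => // i j; exact: cF. Qed.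

Lemma Cinf_inv V (U : set V) (f : V -> R) : open U ->
  (forall x, U x -> f x != 0) -> Cinf U f -> Cinf U (fun x => (f x)^-1).
Proof. by move=> oU f0 cf k; apply: Ck_inv. Qed.

Lemma Cinf_mx V (U : set V) p q (F : V -> 'M[R]_(p, q)) : open U ->
  (forall i j, Cinf U (fun x => F x i j)) -> Cinf U F.
Proof. by move=> oU cF k; apply: Ck_mx => // i j; exact: cF. Qed.

Lemma Cinf_entry V (U : set V) p q (F : V -> 'M[R]_(p, q)) i j : open U ->
  Cinf U F -> Cinf U (fun x => F x i j).
Proof. by move=> oU cF k; apply: Ck_entry. Qed.

Lemma Cinf_comp V d (U : set V) (U' : set 'rV[R]_d) (f : V -> 'rV[R]_d)
    (g : 'rV[R]_d -> R) : open U -> open U' ->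
  (forall x, U x -> U' (f x)) -> Cinf U f -> Cinf U' g -> Cinf U (g \o f).
Proof. by move=> oU oU' UU' cf cg k; apply: Ck_comp (cf k) (cg k). Qed.

Lemma Cinf_comp_mx V d p q (U : set V) (U' : set 'rV[R]_d) (f : V -> 'rV[R]_d)
    (g : 'rV[R]_d -> 'M[R]_(p, q)) : open U -> open U' ->
  (forall x, U x -> U' (f x)) -> Cinf U f -> Cinf U' g -> Cinf U (g \o f).
Proof.
move=> oU oU' UU' cf cg; apply: Cinf_mx => // i j.
apply: (Cinf_comp (U' := U') (g := fun y => g y i j)) => //.
exact: Cinf_entry.
Qed.

Lemma Cinf_mulmx V (U : set V) p q r (F : V -> 'M[R]_(p, q))
    (G : V -> 'M[R]_(q, r)) : open U ->
  Cinf U F -> Cinf U G -> Cinf U (fun x => F x *m G x).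
Proof.
move=> oU cF cG; apply: Cinf_mx => // i j.
apply: (@Cinf_ext _ _ _ (fun x => \sum_k F x i k * G x k j)) => //.
  by move=> x _; rewrite mxE.
by apply: Cinf_sum => // k _; apply: CinfM => //; exact: Cinf_entry.
Qed.

Lemma jacobianE d e (f : 'rV[R]_d -> 'rV[R]_e) x v :
  'd f x v = v *m 'J f x.
Proof. by rewrite /jacobian mul_rV_lin1. Qed.

Lemma jacobian_entry d e (f : 'rV[R]_d -> 'rV[R]_e) x i j :
  differentiable f x -> 'J f x i j = 'D_(delta_mx 0 i) (fun y => f y 0 j) x.
Proof.
move=> df; have := deriveEjacobian (delta_mx 0 i) df.
rewrite -rowE (derive_mx (M := f)); last exact: diff_derivable.
by move=> /matrixP/(_ 0 j); rewrite !mxE.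
Qed.

Lemma jacobian_comp d e r (f : 'rV[R]_d -> 'rV[R]_e) (g : 'rV[R]_e -> 'rV[R]_r) x :
  differentiable f x -> differentiable g (f x) ->
  'J (g \o f) x = 'J f x *m 'J g (f x).
Proof.
move=> df dg; apply/row_matrixP => i.
rewrite !rowE mulmxA -!jacobianE.
by rewrite diff_comp //= jacobianE.
Qed.

Lemma near_eq_jacobian d e (f g : 'rV[R]_d -> 'rV[R]_e) (x : 'rV[R]_d) :
  {near x, f =1 g} -> differentiable f x -> 'J f x = 'J g x.
Proof.
move=> fg df; have [_ E] := near_eq_is_diff fg df.
apply/matrixP => i j; rewrite [LHS]mxE [RHS]mxE.
exact: (esym (congr1 (fun h : _ -> 'rV[R]_e => h (delta_mx 0 i) 0 j) E)).
Qed.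

Lemma jacobian_id d (x : 'rV[R]_d) : 'J (@id 'rV[R]_d) x = 1%:M.
Proof.
apply/row_matrixP => i; rewrite rowE -jacobianE.
have := @diff_lin R _ _ (idfun : {linear 'rV[R]_d -> 'rV[R]_d}) x (fun x => cvg_id).
by rewrite row1 => ->.
Qed.

Lemma Cinf_jacobian d e (U : set 'rV[R]_d) (f : 'rV[R]_d -> 'rV[R]_e) : open U ->
  Cinf U f -> Cinf U (fun x => 'J f x).
Proof.
move=> oU cf; apply: Cinf_mx => // i j.
have cD := Cinf_deriv (delta_mx 0 i) (Cinf_entry 0 j oU cf).
apply: Cinf_ext oU _ cD => x Ux; rewrite jacobian_entry //.
exact: Cinf_diff cf Ux.
Qed.

End Calculus.

(** * Linear maps and their Jacobians *)

Section LinearForm.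
Variable R : realType.

(** The differential of a parametric integral is known through its partial
    derivatives; this is the linear form with these coefficients. *)
Definition lform d (c : 'I_d -> R) (h : 'rV[R]_d) : R := \sum_i h 0 i * c i.

Lemma lform_is_linear d (c : 'I_d -> R) : linear (lform c : 'rV[R]_d -> R^o).
Proof.
move=> a u v; rewrite /lform scaler_sumr -big_split /=.
by apply: eq_bigr => i _; rewrite !mxE mulrDl -mulrA.
Qed.

HB.instance Definition _ d (c : 'I_d -> R) :=
  GRing.isLinear.Build R 'rV[R]_d R^o _ (lform c) (lform_is_linear c).

Lemma entry_norm p q (M : 'M[R]_(p, q)) i j : `|M i j| <= `|M|.
Proof.
rewrite [leRHS]/Num.Def.normr /= mx_normrE.
exact: (le_bigmax _ (fun ij : 'I_p * 'I_q => `|M ij.1 ij.2|) (i, j)).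
Qed.

Lemma near0_rV d (r : R) : 0 < r -> \forall h \near (0 : 'rV[R]_d), `|h| < r.
Proof.
move=> r0; apply/nbhs_ballP; exists r => // h.
by rewrite -ball_normE /ball_ /= sub0r normrN.
Qed.

Lemma Cinf_lform d (c : 'I_d -> R) U : open U -> Cinf U (lform c).
Proof.
move=> oU; apply: Cinf_sum => // i _; apply: CinfM => //; last exact: Cinf_cst.
exact: (Cinf_entry 0 i oU (Cinf_id U)).
Qed.

Lemma continuous_lform d (c : 'I_d -> R) : continuous (lform c : _ -> R^o).
Proof. by move=> x; apply: (Cinf_continuous (Cinf_lform c openT)). Qed.

Lemma Cinf_linmx d e (A : 'M[R]_(d, e)) U : open U -> Cinf U (fun y : 'rV[R]_d => y *m A).
Proof. by move=> oU; apply: Cinf_mulmx => //; [exact: Cinf_id|exact: Cinf_cst]. Qed.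

Lemma is_diff_linmx d e (A : 'M[R]_(d, e)) (x : 'rV[R]_d) :
  is_diff x (mulmxr A : 'rV[R]_d -> 'rV[R]_e) (mulmxr A : 'rV[R]_d -> 'rV[R]_e).
Proof.
have cA : continuous (mulmxr A : 'rV[R]_d -> 'rV[R]_e).
  by move=> y; exact: (Cinf_continuous (Cinf_linmx A openT)).
by apply: DiffDef; [exact: linear_differentiable|exact: diff_lin].
Qed.

Lemma jacobian_linmx d e (A : 'M[R]_(d, e)) (x : 'rV[R]_d) :
  'J (fun y : 'rV[R]_d => y *m A) x = A.
Proof.
have [_ E] := is_diff_linmx A x.
apply/matrixP => i j; rewrite [LHS]mxE.
have -> : 'd (fun y : 'rV[R]_d => y *m A) x (delta_mx 0 i) = mulmxr A (delta_mx 0 i) by rewrite -E.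
by rewrite /= -rowE mxE.
Qed.

End LinearForm.

Section JacobianSums.
Variables (R : realType) (d e : nat).
Implicit Types f g : 'rV[R]_d -> 'rV[R]_e.

Lemma jacobian_cst (c : 'rV[R]_e) x : 'J (fun _ : 'rV[R]_d => c) x = 0.
Proof.
apply/row_matrixP => i; rewrite rowE -jacobianE row0.
by have -> := diff_cst c x.
Qed.

Lemma jacobianD f g x : differentiable f x -> differentiable g x ->
  'J (fun x => f x + g x) x = 'J f x + 'J g x.
Proof.
move=> df dg; apply/row_matrixP => i; rewrite rowE -jacobianE.
have -> := diffD df dg.
have e1 := jacobianE f x (delta_mx 0 i); have e2 := jacobianE g x (delta_mx 0 i).
rewrite [row i _]rowE mulmxDr.
by apply: etrans (f_equal2 _ e1 e2).
Qed.

End JacobianSums.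

(** * Symmetry of second derivatives *)

Section Line.
Variables (R : realType) (V W : normedModType R).

Lemma is_derive_line (f : V -> W) y v s : differentiable f (y + s *: v) ->
  is_derive s (1 : R) (fun s => f (y + s *: v)) ('D_v f (y + s *: v)).
Proof.
move=> df; have dv : derivable f (y + s *: v) v by exact: diff_derivable.
have E : (fun h : R => h^-1 *: (f (y + (h *: (1 : R) + s) *: v) - f (y + s *: v))) =
    (fun h : R => h^-1 *: (f (h *: v + (y + s *: v)) - f (y + s *: v))).
  apply/funext => h; congr (_ *: (f _ - _)).
  by rewrite [h *: 1]mulr1 scalerDl addrCA addrA.
by apply: DeriveDef; [rewrite /derivable E|rewrite /derive E].
Qed.

Lemma derive_translate (f : V -> W) a x w :
  'D_w (fun y => f (y + a)) x = 'D_w f (x + a).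
Proof.
rewrite /derive (_ : (fun h => _) =
  (fun h : R => h^-1 *: ((f \o shift (x + a)) (h *: w) - f (x + a)))) //.
by apply/funext => h /=; rewrite addrA.
Qed.

End Line.

Section Schwarz.
Variable R : realType.

Lemma line_MVT (V : normedModType R) (f : V -> R) y v (t : R) : 0 < t ->
  (forall s, 0 <= s <= t -> differentiable f (y + s *: v)) ->
  exists2 c, 0 < c < t & f (y + t *: v) - f y = t * 'D_v f (y + c *: v).
Proof.
move=> t0 df; pose g s := f (y + s *: v).
have dg s : 0 <= s <= t -> is_derive s 1 g ('D_v f (y + s *: v)).
  by move=> /df; exact: is_derive_line.
have [||c] := @MVT R g (fun s => 'D_v f (y + s *: v)) 0 t t0.
- by move=> s; rewrite in_itv /= => /andP[s0 st]; apply: dg; rewrite !ltW.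
- apply: continuous_in_subspaceT => s; rewrite inE /= in_itv /= => st.
  have [dgs _] := dg _ st.
  by apply: differentiable_continuous; apply/derivable1_diffP.
- rewrite in_itv /= => ct E; exists c => //.
  by move: E; rewrite /g scale0r addr0 subr0 mulrC.
Qed.

(** The double difference over the parallelogram with sides t v and t w is t^2
    D_v D_w f + o(t^2). The mean value theorem along w reduces it to an
    increment of D_w f, and this increment is controlled by the
    differentiability of D_w f at the single point x. *)
Lemma double_difference (V : normedModType R) (U : set V) (f : V -> R) x v w :
  open U -> U x -> (forall y, U y -> differentiable f y) ->
  differentiable ('D_w f) x ->
  forall e : R, 0 < e -> exists2 d : R, 0 < d & forall t, 0 < t < d ->
  `|f (x + t *: v + t *: w) - f (x + t *: v) - f (x + t *: w) + f x
    - t ^+ 2 * 'D_v ('D_w f) x| <= e * t ^+ 2.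
Proof.
move=> oU Ux df dk e e0.
(* t C bounds the increments a v + b w with a, b in [0, t], and t (|v| + 2 |w|) *)
pose C := `|v| + `|w| + `|w| + 1.
have C0 : 0 < C by rewrite ltr_wpDl // !addr_ge0.
have eC : 0 < e / C by rewrite divr_gt0.
have [d1 /= d10 Hd1] := (nbhs_ballP _ _).1 (diff_eps dk eC).
have [d2 /= d20 Hd2] := (nbhs_ballP _ _).1 (open_nbhs_nbhs (conj oU Ux)).
exists (Num.min d1 d2 / C); first by rewrite divr_gt0 // lt_min d10.
move=> t /andP[t0 td].
have small a b : 0 <= a <= t -> 0 <= b <= t ->
    `|a *: v + b *: w| < Num.min d1 d2.
  move=> /andP[a0 at_] /andP[b0 bt].
  rewrite (le_lt_trans (ler_normD _ _)) // !normrZ !ger0_norm //.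
  apply: (@le_lt_trans _ _ (t * C)); last by rewrite -ltr_pdivlMr.
  rewrite /C !mulrDr -!addrA lerD ?ler_wpM2r // ler_wpDr ?ler_wpM2r //.
  by rewrite addr_ge0 // mulr_ge0 // (ltW t0).
have inU a b : 0 <= a <= t -> 0 <= b <= t -> U (x + (a *: v + b *: w)).
  move=> ha hb; apply: Hd2; rewrite -ball_normE /ball_ /= opprD addNKr normrN.
  by have := small _ _ ha hb; rewrite lt_min => /andP[].
have rem a b : 0 <= a <= t -> 0 <= b <= t ->
  `|'D_w f (x + (a *: v + b *: w)) - 'D_w f x - 'd ('D_w f) x (a *: v + b *: w)|
    <= e / C * `|a *: v + b *: w|.
  move=> ha hb; have := Hd1 (a *: v + b *: w); rewrite [x + _]addrC; apply.
  rewrite -ball_normE /ball_ /= sub0r normrN.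
  by have := small _ _ ha hb; rewrite lt_min => /andP[].
have tt : 0 <= t <= t by rewrite lexx ltW.
have t00 : 0 <= (0 : R) <= t by rewrite lexx ltW.
pose g y := f (y + t *: v) - f y.
have dg s : 0 <= s <= t -> differentiable g (x + s *: w).
  move=> hs; apply: differentiableB; last first.
    by apply: df; have := inU 0 s t00 hs; rewrite scale0r add0r.
  apply: (differentiable_comp (f := fun y => y + t *: v) (g := f)) => //.
  by apply: df; rewrite -addrA [s *: w + _]addrC; exact: inU.
have [c /andP[c0 ct]] := line_MVT t0 dg.
have hc : 0 <= c <= t by rewrite !ltW.
have dshift : 'D_w (fun y => f (y + t *: v)) (x + c *: w) = 'D_w f (x + (t *: v + c *: w)).
  by rewrite derive_translate -addrA [c *: w + _]addrC.
rewrite deriveB; last 2 first.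
- apply: diff_derivable; apply: (differentiable_comp (f := fun y => y + t *: v) (g := f)) => //.
  by apply: df; rewrite -addrA [c *: w + _]addrC; exact: inU.
- apply: diff_derivable; apply: df.
  by have := inU 0 c t00 hc; rewrite scale0r add0r.
rewrite dshift /g => E.
have -> : f (x + t *: v + t *: w) - f (x + t *: v) - f (x + t *: w) + f x =
   t * ('D_w f (x + (t *: v + c *: w)) - 'D_w f (x + c *: w)).
  by rewrite -E [x + t *: w + _]addrAC; ring.
have r1 := rem t c tt hc; have := rem 0 c t00 hc.
rewrite scale0r add0r => r2.
rewrite expr2 -mulrA -mulrBr normrM gtr0_norm // mulrCA ler_pM2l //.
have lin : 'd ('D_w f) x (t *: v + c *: w) - 'd ('D_w f) x (c *: w) =
   t * 'D_v ('D_w f) x.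
  by rewrite -linearB addrK linearZ deriveE.
rewrite -lin.
set A := 'D_w f (_ + (_ + _)) in r1 *; set B := 'D_w f (_ + _) in r2 *.
set a := 'd _ _ _ in r1 *; set b := 'd _ _ _ in r2 *.
have -> : A - B - (a - b) = (A - 'D_w f x - a) - (B - 'D_w f x - b).
  by rewrite !opprB !addrA; ring.
rewrite (le_trans (ler_normB _ _)) // (le_trans (lerD r1 r2)) //.
rewrite -mulrDr -mulrA ler_pM2l // mulrC ler_pdivrMr //.
rewrite (le_trans (lerD (ler_normD _ _) (lexx _))) // !normrZ !gtr0_norm //.
have cw : c * `|w| <= t * `|w| by rewrite ler_wpM2r // ltW.
rewrite /C !mulrDr mulr1; move: cw; set cw := c * _; set tw := t * _.
set tv := t * _ => cw_tw; lra.
Qed.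

(** The double difference is symmetric in v and w, and both iterated
    derivatives are the limit of its quotient by t^2. *)
Lemma derive_swap (V : normedModType R) (U : set V) (f : V -> R) x v w :
  open U -> U x -> Ck 2 U f -> 'D_v ('D_w f) x = 'D_w ('D_v f) x.
Proof.
move=> oU Ux cf.
have /CkSP[df Df] := cf.
have dD u : differentiable ('D_u f) x by have /CkSP[+ _] := Df u; apply.
apply/eqP; rewrite -subr_eq0 -normr_le0; apply/ler_addgt0Pl => e e0.
rewrite addr0; have e2 : 0 < e / 2 by rewrite divr_gt0.
have [d1 d10 H1] := double_difference v oU Ux df (dD w) e2.
have [d2 d20 H2] := double_difference w oU Ux df (dD v) e2.
pose t := Num.min d1 d2 / 2.
have m0 : 0 < Num.min d1 d2 by rewrite lt_min d10.
have t0 : 0 < t by rewrite divr_gt0.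
have tm : t < Num.min d1 d2 by rewrite /t ltr_pdivrMr // mulr_natr mulr2n ltrDl.
have {H1} := H1 t; have {H2} := H2 t.
move: tm; rewrite lt_min => /andP[-> ->]; rewrite t0 => /(_ isT) + /(_ isT).
rewrite [x + t *: w + t *: v]addrAC.
set D := f _; set A := f _; set B := f _; set C := f _.
set a := 'D_v _ _; set b := 'D_w _ _ => H2 H1.
rewrite -(ler_pM2l (exprn_gt0 2 t0)).
rewrite -{1}[t ^+ 2]gtr0_norm ?exprn_gt0 // -normrM.
have -> : t ^+ 2 * (a - b) = (D - A - B + C - t ^+ 2 * b) - (D - B - A + C - t ^+ 2 * a).
  by ring.
rewrite (le_trans (ler_normB _ _)) // (le_trans (lerD H2 H1)) //.
by rewrite -mulrDl -splitr mulrC.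
Qed.

End Schwarz.

(** * Integrals depending on a parameter *)

Section UnitInterval.
Variable R : realType.
Implicit Types f g : R -> R.
Let I : set R := `[0, 1]%classic.

(** The interval is fixed: integrals with a moving bound are rescaled to
    [0, 1], so that differentiation under the integral sign covers them
    too. *)
Definition itg f : R := \int[lebesgue_measure]_(s in I) f s.

Definition cont_I f := forall s, I s -> {for s, continuous f}.

Lemma cont_I_integrable f :
  cont_I f -> lebesgue_measure.-integrable I (EFin \o f).
Proof.
move=> cf; apply: continuous_compact_integrable; first exact: segment_compact.
by apply: continuous_in_subspaceT => s; rewrite inE; exact: cf.
Qed.

Lemma cont_ID f g : cont_I f -> cont_I g -> cont_I (fun s => f s + g s).
Proof. by move=> cf cg s Is; apply: continuousD; [exact: cf|exact: cg]. Qed.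

Lemma cont_IZ (r : R) f : cont_I f -> cont_I (fun s => r * f s).
Proof. by move=> cf s Is; apply: continuousM; [exact: cst_continuous|exact: cf]. Qed.

Let mI : measurable I. Proof. exact: measurable_itv. Qed.

Lemma itgD f g : cont_I f -> cont_I g ->
  itg (fun s => f s + g s) = itg f + itg g.
Proof.
move=> cf cg; have If := cont_I_integrable cf; have Ig := cont_I_integrable cg.
by apply: RintegralD.
Qed.

Lemma itgZ (r : R) f : cont_I f -> itg (fun s => r * f s) = r * itg f.
Proof.
by move=> cf; have If := cont_I_integrable cf; apply: RintegralZl.
Qed.

Lemma itgB f g : cont_I f -> cont_I g ->
  itg (fun s => f s - g s) = itg f - itg g.
Proof.
move=> cf cg; have If := cont_I_integrable cf; have Ig := cont_I_integrable cg.
by apply: RintegralB.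
Qed.

Lemma cont_IB f g : cont_I f -> cont_I g -> cont_I (fun s => f s - g s).
Proof. by move=> cf cg s Is; apply: continuousB; [exact: cf|exact: cg]. Qed.

Lemma cont_I_sum n (F : 'I_n -> R -> R) :
  (forall i, cont_I (F i)) -> cont_I (fun s => \sum_i F i s).
Proof.
move=> cF s Is; rewrite (_ : (fun s => _) = \sum_i F i); last first.
  by apply/funext => x; rewrite fct_sumE.
elim/big_ind : _ => [|f g|i _]; first exact: cst_continuous.
  by move=> cf cg; apply: continuousD.
exact: cF.
Qed.

Lemma itg_sum n (F : 'I_n -> R -> R) : (forall i, cont_I (F i)) ->
  itg (fun s => \sum_i F i s) = \sum_i itg (F i).
Proof.
elim: n F => [|n IH] F cF.
  rewrite big_ord0 /itg /Rintegral integral0_eq // => s _.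
  by rewrite big_ord0.
rewrite big_ord_recl -IH // -itgD //; last exact: cont_I_sum.
by congr itg; apply/funext => s; rewrite big_ord_recl.
Qed.

Lemma itg_bound f (e : R) : cont_I f -> (forall s, I s -> `|f s| <= e) ->
  `|itg f| <= e.
Proof.
move=> cf fe.
have If := cont_I_integrable cf.
apply: (@le_trans _ _ (itg (fun s => `|f s|))).
  by apply: le_normr_Rintegral.
have c1 : cont_I (fun=> e) by move=> s _; exact: cst_continuous.
have ce : itg (fun=> e) = e.
  rewrite /itg Rintegral_cst; last exact: measurable_itv.
  have mE := lebesgue_measure_itv (`[0, 1] : interval R).
  rewrite /= lte_fin ltr01 oppr0 adde0 in mE.
  by apply: (etrans (congr1 (fun z => e * fine z) mE)); rewrite /= mulr1.
have c2 : cont_I (fun s => `|f s|).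
  move=> s Is; apply: (@continuous_comp _ _ _ f (fun z : R => `|z|)).
    exact: cf.
  exact: norm_continuous.
have I1 := cont_I_integrable c1; have I2 := cont_I_integrable c2.
by rewrite -[leRHS]ce; apply: le_Rintegral.
Qed.

Lemma itg_FTC f g : cont_I f ->
  (forall s, I s -> is_derive s 1 g (f s)) -> itg f = g 1 - g 0.
Proof.
move=> cf dg.
have cg s : I s -> {for s, continuous g}.
  move=> /dg[dgs _]; apply: differentiable_continuous.
  exact/derivable1_diffP.
have := @continuous_FTC2 R f g 0 1 ltr01.
have wf : {within `[0, 1], continuous f}.
  by apply: continuous_in_subspaceT => s; rewrite inE; exact: cf.
have I0 : I 0 by rewrite /I /= in_itv /= lexx ler01.
have I1 : I 1 by rewrite /I /= in_itv /= lexx ler01.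
move=> /(_ wf) H; rewrite /itg /Rintegral H //.
  split.
  - by move=> s; rewrite in_itv /= => /andP[s0 s1]; have [|] := dg s;
      rewrite // /I /= in_itv /= !ltW.
  - by apply: cvg_at_right_filter; exact: cg.
  - by apply: cvg_at_left_filter; exact: cg.
move=> s; rewrite in_itv /= => /andP[s0 s1]; rewrite derive1E.
by have [|_ ->] := dg s; rewrite // /I /= in_itv /= !ltW.
Qed.

End UnitInterval.

Section ParametricIntegral.
Variables (R : realType) (d : nat).
Let I : set R := `[0, 1]%classic.

(** The pair (s, y) as one vector of R^(1 + d), so that smoothness of an
    integrand jointly in s and y is smoothness on an open set of this
    space. *)
Definition jt (s : R) (y : 'rV[R]_d) : 'rV[R]_(1 + d) := row_mx (const_mx s) y.

Lemma jt_continuous (sy : R * 'rV[R]_d) :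
  {for sy, continuous (fun sy : R * 'rV[R]_d => jt sy.1 sy.2)}.
Proof.
apply: continuous_at_mx => i j.
have [k|k] := split_ordP j => ->.
  rewrite (_ : (fun _ => _) = fst); last by apply/funext => z; rewrite row_mxEl mxE.
  exact: cvg_fst.
rewrite (_ : (fun _ => _) = (fun N : 'rV[R]_d => N i k) \o snd); last first.
  by apply/funext => z; rewrite row_mxEr.
apply: continuous_comp; first exact: cvg_snd.
by apply: differentiable_continuous; exact: differentiable_coord.
Qed.

Variables (N : set 'rV[R]_(1 + d)) (U : set 'rV[R]_d).
Hypotheses (oN : open N) (oU : open U).
Hypothesis UN : forall s y, I s -> U y -> N (jt s y).

Lemma jt_cont_I (g : _ -> R) y : Ck 0 N g -> U y -> cont_I (fun s => g (jt s y)).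
Proof.
move=> cg Uy s Is.
apply: (@continuous_comp _ _ _ (fun s => jt s y) g); last by apply: cg; exact: UN.
apply: (@continuous_comp _ _ _ (fun s : R => (s, y)) (fun sy => jt sy.1 sy.2)).
  apply: (@cvg_pair _ _ _ (nbhs s) (nbhs s) (nbhs y) _ _ _ id (fun=> y)).
    exact: cvg_id.
  exact: cvg_cst.
exact: jt_continuous.
Qed.

(** Continuity in y is uniform in s because [0, 1] is compact. *)
Lemma jt_tube (g : _ -> R) y (e : R) : Ck 0 N g -> U y -> 0 < e ->
  \forall y' \near y, forall s, I s -> `|g (jt s y') - g (jt s y)| < e.
Proof.
move=> cg Uy e0.
have /compact_near_coveringP := @segment_compact R 0 1.
move=> /(_ _ (nbhs y) (fun y' s => `|g (jt s y') - g (jt s y)| < e) _).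
apply => s Is.
have cgs : {for (s, y), continuous (fun sy : R * 'rV[R]_d => g (jt sy.1 sy.2))}.
  apply: continuous_comp; first exact: jt_continuous.
  by apply: cg; exact: UN.
have e2 : 0 < e / 2 by rewrite divr_gt0.
have : \forall z \near (s, y), `|g (jt s y) - g (jt z.1 z.2)| < e / 2.
  exact: ((cvgrPdist_lt _ _).1 cgs _ e2).
move=> H.
have H2 : \forall s' \near s, `|g (jt s y) - g (jt s' y)| < e / 2.
  have cs : {for s, continuous (fun s => g (jt s y))} by exact: jt_cont_I.
  exact: ((cvgrPdist_lt _ _).1 cs _ e2).
have H3 : \forall z \near (s, y), `|g (jt s y) - g (jt z.1 y)| < e / 2.
  exact: (@cvg_fst _ _ (nbhs s) (nbhs y) _ _ H2).
apply: filterS2 H H3 => -[s' y'] /= h h3.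
rewrite -(subrKA (g (jt s y))) (le_lt_trans (ler_normD _ _)) // (splitr e).
by rewrite ltrD // distrC.
Qed.

Lemma itg_jt_continuous (g : _ -> R) :
  Ck 0 N g -> Ck 0 U (fun y => itg (fun s => g (jt s y))).
Proof.
move=> cg y Uy; apply/(@cvgrPdist_le _ _ _ (nbhs y) _) => /= e e0.
have Uy' : \forall y' \near y, U y' by apply: open_nbhs_nbhs.
near=> y'.
have Uy1 : U y' by near: y'.
rewrite -itgB; [|exact: jt_cont_I|exact: jt_cont_I].
apply: itg_bound; first by apply: cont_IB; exact: jt_cont_I.
move=> s Is; rewrite distrC ltW //; move: s Is; near: y'; exact: jt_tube.
Unshelve. all: by end_near. Qed.

Lemma row_mx_jt (h : 'rV[R]_d) (t : R) s y :
  jt s y + t *: jt 0 h = jt s (y + t *: h).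
Proof.
rewrite /jt scale_row_mx add_row_mx; congr row_mx.
by apply/matrixP => i j; rewrite !mxE mulr0 addr0.
Qed.

Lemma jt_delta (h : 'rV[R]_d) :
  jt 0 h = \sum_i h 0 i *: delta_mx 0 (rshift 1 i).
Proof.
rewrite [LHS]row_sum_delta big_split_ord /= big_ord1 row_mxEl mxE scale0r add0r.
by apply: eq_bigr => i _; rewrite row_mxEr.
Qed.

Let dg_ (g : 'rV[R]_(1 + d) -> R) i := 'D_(delta_mx 0 (rshift 1 i)) g.

Lemma derive_jt (g : 'rV[R]_(1 + d) -> R) h z : differentiable g z ->
  'D_(jt 0 h) g z = \sum_i h 0 i * dg_ g i z.
Proof.
move=> dg; rewrite deriveE // jt_delta linear_sum; apply: eq_bigr => i _.
by rewrite linearZ -deriveE.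
Qed.

(** Differentiation under the integral sign. By the mean value theorem the
    remainder is an integral of increments of the partial derivatives, which
    are small uniformly in s. *)
Lemma is_diff_itg_jt (g : _ -> R) y : Ck 1 N g -> U y ->
  is_diff y (fun y => itg (fun s => g (jt s y)))
    (lform (fun i => itg (fun s => dg_ g i (jt s y)))).
Proof.
move=> cg Uy; have c0 := CkS cg; have /CkSP[dg Dg] := cg.
apply: (@is_diff_eps R _ R^o _ (lform (fun i => itg (fun s => dg_ g i (jt s y))))).
  exact: continuous_lform.
move=> e e0.
have [r /= r0 Ur] := (nbhs_ballP _ _).1 (open_nbhs_nbhs (conj oU Uy)).
have ed : 0 < e / d.+1%:R by rewrite divr_gt0.
have tub i : \forall y' \near y, forall s, I s ->
    `|dg_ g i (jt s y') - dg_ g i (jt s y)| < e / d.+1%:R.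
  by apply: jt_tube => //; exact: Dg.
have tub' := filter_forall (nbhs_filter y) tub.
have [q /= q0 Hq] := (nbhs_ballP _ _).1 tub'.
near=> h.
have hr : `|h| < r by near: h; exact: near0_rV.
have hq : `|h| < q by near: h; exact: near0_rV.
have Uyh (t : R) : 0 <= t <= 1 -> U (y + t *: h).
  move=> /andP[t0 t1]; apply: Ur; rewrite -ball_normE /ball_ /= opprD addNKr normrN.
  by rewrite normrZ (le_lt_trans _ hr) // ler_piMl // ger0_norm.
have Uh : U (h + y) by have := Uyh 1; rewrite scale1r addrC; apply; rewrite ler01 lexx.
have cD i : cont_I (fun s => h 0 i * dg_ g i (jt s y)).
  by apply: cont_IZ; apply: jt_cont_I => //; exact: Dg.
have cs := cont_I_sum cD.
have -> : lform (fun i => itg (fun s => dg_ g i (jt s y))) h =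
    itg (fun s => \sum_i h 0 i * dg_ g i (jt s y)).
  rewrite itg_sum //; apply: eq_bigr => i _; rewrite itgZ //.
  by apply: jt_cont_I => //; exact: Dg.
have c1 := jt_cont_I c0 Uh; have c2 := jt_cont_I c0 Uy.
rewrite -itgB // -itgB //; last exact: cont_IB.
apply: itg_bound; first by apply: cont_IB => //; exact: cont_IB.
move=> s Is.
have dl t : 0 <= t <= 1 -> differentiable g (jt s y + t *: jt 0 h).
  by move=> ht; rewrite row_mx_jt; apply: dg; apply: UN => //; exact: Uyh.
have [c /andP[c0' c1']] := line_MVT ltr01 dl.
have hc : 0 <= c <= 1 by rewrite !ltW.
rewrite !row_mx_jt !scale1r mul1r [y + h]addrC => ->.
rewrite derive_jt; last by apply: dg; apply: UN => //; exact: Uyh.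
rewrite -sumrB (le_trans (ler_norm_sum _ _ _)) //.
apply: (@le_trans _ _ (\sum_(i < d) `|h| * (e / d.+1%:R))).
  apply: ler_sum => i _; rewrite -mulrBr normrM ler_pM //; first exact: entry_norm.
  apply: ltW; apply: Hq => //; rewrite -ball_normE /ball_ /= opprD addNKr normrN.
  by rewrite normrZ (le_lt_trans _ hq) // ler_piMl // ger0_norm // ltW.
rewrite sumr_const card_ord -mulrnAr mulrC ler_wpM2r // -mulr_natr mulrAC.
rewrite ler_pdivrMr // ler_wpM2l //; first exact: ltW.
by rewrite ler_nat.
Unshelve. all: by end_near. Qed.

Lemma Ck_itg_jt k (g : _ -> R) :
  Ck k N g -> Ck k U (fun y => itg (fun s => g (jt s y))).
Proof.
elim: k g => [|k IH] g; first exact: itg_jt_continuous.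
move=> cg; have /CkSP[dg Dg] := cg.
have c1 : Ck 1 N g by apply/CkSP; split=> // v; elim: (k) (Dg v) => // j IHj /CkS.
split=> [y Uy|v]; first by have [] := is_diff_itg_jt c1 Uy.
apply: (@Ck_ext _ _ _ _ _ (fun y => \sum_i v 0 i * itg (fun s => dg_ g i (jt s y)))) => //.
  move=> y Uy; have [df E] := is_diff_itg_jt c1 Uy.
  by rewrite deriveE // E.
apply: Ck_sum => // i _; apply: CkM => //; first exact: Ck_cst.
by apply: IH; exact: Dg.
Qed.

End ParametricIntegral.

(** * Smoothness of inverse maps *)

Section Inverse.
Variables (R : realType) (d : nat).
Variables (phi psi : 'rV[R]_d -> 'rV[R]_d) (B D : set 'rV[R]_d).
Hypotheses (oB : open B) (oD : open D).
Hypothesis sphi : Cinf B phi.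
Hypothesis Jphi : forall y, B y -> 'J phi y \in unitmx.
Hypothesis psiB : forall z, D z -> B (psi z).
Hypothesis psiK : forall z, D z -> phi (psi z) = z.
Hypothesis cpsi : forall z, D z -> {for z, continuous psi}.

(** Let k be the increment of psi for an increment h of its argument, so that
    h = k *m 'J phi + o(k). As k tends to 0 with h by continuity, and 'J phi
    is invertible, k = O(h); hence the error o(k) is o(h). *)
Lemma is_diff_inverse z : D z ->
  is_diff z psi (mulmxr (invmx ('J phi (psi z))) : 'rV[R]_d -> 'rV[R]_d).
Proof.
move=> Dz; set A := invmx _; set y := psi z.
have [_ dA] := is_diff_linmx A z.
have cA : continuous (mulmxr A : 'rV[R]_d -> 'rV[R]_d).
  by move=> x; exact: (Cinf_continuous (Cinf_linmx A openT)).
have [C C0 HC] := linear_lipschitz cA.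
have dphi : differentiable phi y by apply: (Cinf_diff sphi); exact: psiB.
apply: (is_diff_eps cA) => e e0.
(* the first bound gives |k| <= 2 C |h|, the second one then bounds the error by e |h| *)
pose eps := Num.min ((2 * C)^-1) (e / (2 * C ^+ 2)).
have C2 : 0 < 2 * C ^+ 2 by rewrite mulr_gt0 // exprn_gt0.
have eps0 : 0 < eps by rewrite lt_min invr_gt0 mulr_gt0 //= divr_gt0.
have /nbhs_ballP[r /= r0 Hr] := diff_eps dphi eps0.
have Dh : \forall h \near (0 : 'rV[R]_d), D (h + z).
  have : \forall z' \near z, D z' by apply: open_nbhs_nbhs.
  by rewrite (near_shift 0 z) subr0.
have Kh : \forall h \near (0 : 'rV[R]_d), `|psi z - psi (h + z)| < r.
  have : \forall z' \near z, `|psi z - psi z'| < r.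
    exact: ((cvgrPdist_lt _ _).1 (cpsi Dz) _ r0).
  by rewrite (near_shift 0 z) subr0.
near=> h.
have Dhz : D (h + z) by near: h.
have kr : `|psi z - psi (h + z)| < r by near: h.
set k := psi (h + z) - y.
have {}kr : `|k| < r by rewrite distrC.
have hE : phi (k + y) - phi y = h by rewrite /k subrK !psiK // addrK.
have := Hr k; rewrite -ball_normE /ball_ /= sub0r normrN => /(_ kr).
rewrite hE jacobianE; set q := h - _ => qk.
have kE : k - h *m A = - (q *m A).
  have -> : h = q + k *m 'J phi y by rewrite /q subrK.
  rewrite mulmxDl -mulmxA mulmxV ?mulmx1; last by apply: Jphi; exact: psiB.
  by rewrite opprD addrCA subrr addr0.
have qA : `|q *m A| <= C * eps * `|k|.
  by rewrite (le_trans (HC _)) // -mulrA ler_pM2l.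
have Ceps1 : C * eps <= 2^-1.
  rewrite mulrC -ler_pdivlMr // -invfM mulrC.
  by rewrite /eps ge_min [X in _ <= X^-1]mulrC lexx.
have kh : `|k| <= 2 * C * `|h|.
  have : `|k| <= `|h *m A| + 2^-1 * `|k|.
    rewrite -{1}(subrK (h *m A) k) kE (le_trans (ler_normD _ _)) // addrC lerD //.
    by rewrite normrN (le_trans qA) // ler_wpM2r.
  have := HC h; rewrite /= => h1 h2.
  have : `|k| <= C * `|h| + 2^-1 * `|k| by rewrite (le_trans h2) // lerD2r.
  by rewrite -mulrA; move: (`|k|) (C * `|h|) => a b; lra.
rewrite /= kE normrN (le_trans qA) //.
apply: (@le_trans _ _ (C * eps * (2 * C * `|h|))).
  by rewrite ler_wpM2l // mulr_ge0 // ltW.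
rewrite mulrA ler_wpM2r //.
have -> : C * eps * (2 * C) = eps * (2 * C ^+ 2) by ring.
by rewrite -ler_pdivlMr // /eps ge_min lexx orbT.
Unshelve. all: by end_near. Qed.

Lemma Cinf_invmx (V : normedModType R) (U : set V) p (F : V -> 'M[R]_p) : open U ->
  (forall x, U x -> F x \in unitmx) -> Cinf U F -> Cinf U (fun x => invmx (F x)).
Proof.
move=> oU uF cF; apply: Cinf_mx => // i j.
apply: (@Cinf_ext _ _ _ _ (fun x => (\det (F x))^-1 * cofactor (F x) j i)) => //.
  by move=> x /uF ux; rewrite /invmx ux !mxE.
have cE a b : Cinf U (fun x => F x a b) by exact: Cinf_entry.
apply: CinfM => //.
  apply: Cinf_inv => //; last exact: Cinf_det.
  by move=> x /uF; rewrite unitmxE unitfE.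
apply: CinfM => //; first exact: Cinf_cst.
apply: Cinf_det => // a b.
by apply: Cinf_ext oU _ (cE (lift j a) (lift i b)) => x _; rewrite !mxE.
Qed.

(** The derivative of psi is the inverse of 'J phi composed with psi, so the
    regularity of psi improves by one at each step, starting from
    continuity. *)
Lemma Cinf_inverse : Cinf D psi.
Proof.
have cJ := Cinf_invmx oB Jphi (Cinf_jacobian oB sphi).
elim=> [|k IH]; first exact: cpsi.
have dpsi z : D z -> differentiable psi z by case/is_diff_inverse.
split=> // v.
apply: (@Ck_ext _ _ _ _ _ (fun z => v *m invmx ('J phi (psi z)))) => //.
  move=> z Dz; rewrite deriveE; last exact: dpsi.
  have [_ E] := is_diff_inverse Dz.
  exact: (esym (congr1 (fun h : _ -> 'rV[R]_d => h v) E)).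
apply: Ck_mx => // i j.
apply: (@Ck_ext _ _ _ _ _ (fun z => \sum_l v i l * invmx ('J phi (psi z)) l j)) => //.
  by move=> z _; rewrite mxE.
apply: Ck_sum => // l _; apply: CkM => //; first exact: Ck_cst.
apply: (Ck_comp (U' := B) (g := fun y => invmx ('J phi y) l j)) => //.
exact: (Cinf_entry l j oB cJ).
Qed.

End Inverse.

(** * Charts and germs of smooth maps *)

Section OpenSets.
Variable R : realType.

Lemma open_preimage_on (V W : normedModType R) (f : V -> W) U Q :
  open U -> open Q -> (forall y, U y -> {for y, continuous f}) ->
  open (U `&` f @^-1` Q).
Proof.
move=> oU oO cf; rewrite openE => y [Uy Oy]; apply: filterI.
  exact: open_nbhs_nbhs.
by apply: (cf y Uy); apply: open_nbhs_nbhs.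
Qed.

Lemma open_of_nbhs (V : normedModType R) (Q : set V) :
  (forall y, Q y -> exists Q', [/\ open Q', Q' y & Q' `<=` Q]) -> open Q.
Proof.
move=> H; rewrite openE => y /H[Q' [oO' Q'y sO]].
by apply: (filterS sO); apply: open_nbhs_nbhs.
Qed.

Lemma open_Cinf_preimage (V W : normedModType R) (f : V -> W) U Q :
  open U -> open Q -> Cinf U f -> open (U `&` f @^-1` Q).
Proof.
by move=> oU oQ cf; apply: open_preimage_on => // y; exact: Cinf_continuous.
Qed.

Lemma jacobian_comp_near d e r (f : 'rV[R]_d -> 'rV[R]_e) (g : 'rV[R]_e -> 'rV[R]_r)
    (h : 'rV[R]_d -> 'rV[R]_r) (x : 'rV[R]_d) (y : 'rV[R]_e) (U : set 'rV[R]_d) :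
  open U -> U x -> (forall z, U z -> h z = g (f z)) -> f x = y ->
  differentiable f x -> differentiable g y ->
  'J h x = 'J f x *m 'J g y.
Proof.
move=> oU Ux E <- df dg; apply: (etrans _ (jacobian_comp df dg)); apply: esym.
apply: near_eq_jacobian; last exact: differentiable_comp.
by apply: (near_open oU) => // z /E.
Qed.

End OpenSets.

Section Charts.
Variables (R : realType) (d : nat) (X : mfd R d).
Implicit Types c : chart R (pt X) d.

(** The part of the structure of a manifold on which calculus in charts rests.
    The bundles of jets and of momenta inherit it from M and E, through their
    atlases of induced charts. *)
Record wf_mfd : Prop := WfMfd {
  wf_chart : forall c, atlas (m := X) c -> is_chart c;
  wf_cover : forall x, carrier (m := X) x ->
    exists2 c, atlas (m := X) c & chart_dom c x;
  wf_compat : forall c c', atlas (m := X) c -> atlas (m := X) c' ->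
    smooth_transition c c' }.

Lemma manifold_wf : is_manifold X -> wf_mfd.
Proof. by case=> *; split. Qed.

Definition tr (c c' : chart R (pt X) d) := chart_map c' \o chart_inv c.

Definition overlap (c c' : chart R (pt X) d) :=
  chart_map c @` (chart_dom c `&` chart_dom c').

Lemma chart_invK c x : is_chart (X := X) c -> chart_dom c x ->
  chart_inv c (chart_map c x) = x.
Proof. by case=> _ _; apply. Qed.

Lemma chart_dom_carrier c x : is_chart c -> chart_dom c x -> carrier (m := X) x.
Proof. by case=> + _ _; apply. Qed.

Lemma chart_image_inv c y : is_chart (X := X) c -> chart_image c y ->
  chart_dom c (chart_inv c y) /\ chart_map c (chart_inv c y) = y.
Proof. by move=> ic [x cx <-]; rewrite chart_invK. Qed.

Lemma chart_map_image c x : chart_dom c x -> chart_image c (chart_map c x).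
Proof. by exists x. Qed.

Lemma overlapP c c' y : is_chart c ->
  overlap c c' y <-> chart_image c y /\ chart_dom c' (chart_inv c y).
Proof.
move=> ic; split=> [[x [cx c'x] <-]|[cy c'y]].
  by rewrite chart_invK //; split=> //; exact: chart_map_image.
have [h1 h2] := chart_image_inv ic cy.
by exists (chart_inv c y).
Qed.

Lemma overlap_map c c' x : chart_dom c x -> chart_dom c' x ->
  overlap c c' (chart_map c x).
Proof. by move=> cx c'x; exists x. Qed.

Hypothesis wX : wf_mfd.

Lemma pref_chartP x : carrier (m := X) x ->
  atlas (m := X) (pref_chart (X := X) x) /\ chart_dom (pref_chart (X := X) x) x.
Proof.
move=> /(wf_cover wX)[c ac cx]; rewrite /pref_chart.
have := @xgetPex {classic chart R (pt X) d} (Chart set0 (fun=> 0) (fun=> x))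
  [set c : {classic chart R (pt X) d} | atlas (m := X) c /\ chart_dom c x].
by apply; exists c.
Qed.

Section Transitions.
Variables c c' c'' : chart R (pt X) d.
Hypotheses (ac : atlas (m := X) c) (ac' : atlas (m := X) c') (ac'' : atlas (m := X) c'').

Lemma open_overlap : open (overlap c c').
Proof. by have [] := wf_compat wX ac ac'. Qed.

Lemma Cinf_tr : Cinf (overlap c c') (tr c c').
Proof. by have [] := wf_compat wX ac ac'. Qed.

Lemma tr_map x : chart_dom c x -> tr c c' (chart_map c x) = chart_map c' x.
Proof. by move=> cx; rewrite /tr /= chart_invK //; exact: (wf_chart wX). Qed.

Lemma diff_tr x : chart_dom c x -> chart_dom c' x ->
  differentiable (tr c c') (chart_map c x).
Proof. by move=> cx c'x; apply: (Cinf_diff Cinf_tr); exact: overlap_map. Qed.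

End Transitions.

Lemma jacobian_tr_comp c c' c'' x :
  atlas (m := X) c -> atlas (m := X) c' -> atlas (m := X) c'' ->
  chart_dom c x -> chart_dom c' x -> chart_dom c'' x ->
  'J (tr c c') (chart_map c x) *m 'J (tr c' c'') (chart_map c' x) =
  'J (tr c c'') (chart_map c x).
Proof.
move=> ac ac' ac'' cx c'x c''x.
apply: esym; apply: (jacobian_comp_near (U := overlap c c')).
- exact: open_overlap.
- exact: overlap_map.
- move=> _ [z [cz c'z] <-] /=; rewrite /tr /= !chart_invK //; exact: (wf_chart wX).
- by rewrite tr_map.
- exact: diff_tr.
- exact: diff_tr.
Qed.

Lemma jacobian_tr_id c x : atlas (m := X) c -> chart_dom c x ->
  'J (tr c c) (chart_map c x) = 1%:M.
Proof.
move=> ac cx; rewrite -(jacobian_id (chart_map c x)); apply: near_eq_jacobian.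
  apply: (near_open (U := overlap c c)); first exact: open_overlap.
    exact: overlap_map.
  by move=> _ [z [cz c'z] <-] /=; rewrite tr_map.
exact: diff_tr.
Qed.

Lemma jacobian_trK c c' x :
  atlas (m := X) c -> atlas (m := X) c' -> chart_dom c x -> chart_dom c' x ->
  'J (tr c c') (chart_map c x) *m 'J (tr c' c) (chart_map c' x) = 1%:M.
Proof. by move=> *; rewrite jacobian_tr_comp // jacobian_tr_id. Qed.

Lemma dchart_tr c c' x :
  atlas (m := X) c -> atlas (m := X) c' -> chart_dom c x -> chart_dom c' x ->
  dchart c' x = dchart c x *m 'J (tr c c') (chart_map c x).
Proof.
move=> ac ac' cx c'x.
have [ap px] := pref_chartP (chart_dom_carrier (wf_chart wX ac) cx).
by rewrite /dchart jacobian_tr_comp.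
Qed.

Lemma dchart_unit c x : atlas (m := X) c -> chart_dom c x ->
  dchart c x \in unitmx.
Proof.
move=> ac cx.
have [ap px] := pref_chartP (chart_dom_carrier (wf_chart wX ac) cx).
have [+ _] := mulmx1_unit (jacobian_trK ap ac px cx); exact.
Qed.

Lemma dchart_tr_inv c c' x :
  atlas (m := X) c -> atlas (m := X) c' -> chart_dom c x -> chart_dom c' x ->
  invmx (dchart c x) *m dchart c' x = 'J (tr c c') (chart_map c x).
Proof.
by move=> ac ac' cx c'x; rewrite (dchart_tr ac ac') // mulKmx // dchart_unit.
Qed.

(** The differential is defined in the preferred chart at x; the chain rule
    through the transition map expresses it in the chart c. *)
Lemma dfun_chart (f : pt X -> R) c x v : atlas (m := X) c -> chart_dom c x ->
  Cinf (chart_image c) (f \o chart_inv c) ->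
  dfun f x v = \sum_i dcoord c x i v * pderiv c i f x.
Proof.
move=> ac cx cf; have ic := wf_chart wX ac.
have [ap px] := pref_chartP (chart_dom_carrier ic cx).
set p := pref_chart x in ap px *.
have df : differentiable (f \o chart_inv c) (chart_map c x).
  by apply: (Cinf_diff cf); exact: chart_map_image.
have dt := diff_tr ap ac px cx.
have df' : differentiable (f \o chart_inv c) (tr p c (chart_map p x)).
  by rewrite tr_map.
rewrite /dfun -/p.
rewrite (near_eq_derive (g := (f \o chart_inv c) \o tr p c)); last first.
  apply: (near_open (U := overlap p c)); first exact: open_overlap.
    exact: overlap_map.
  by move=> _ [z [pz cz] <-]; rewrite /= tr_map // !chart_invK //; exact: (wf_chart wX).
rewrite derive_comp_rV // tr_map //; apply: eq_bigr => i _; congr (_ * _).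
have := deriveEjacobian v dt.
rewrite (derive_mx (M := tr p c)); last exact: diff_derivable.
by move=> /matrixP/(_ 0 i); rewrite mxE.
Qed.

End Charts.

Section SmoothMaps.
Variables (R : realType).

Section Two.
Variables (d e : nat) (X : mfd R d) (Y : mfd R e).
Implicit Types (f g : pt X -> pt Y) (cX : chart R (pt X) d) (cY : chart R (pt Y) e).

Definition rep f cX cY : 'rV[R]_d -> 'rV[R]_e := chart_map cY \o f \o chart_inv cX.

(** Smoothness as a property of a germ in one pair of charts. It implies the
    same in all pairs of charts ([smooth_at_chart]), hence the definition by
    atlases ([smooth_at_map]), and it composes. *)
Definition smooth_at f cX cY x := chart_dom cX x /\ exists Q,
  [/\ open Q, Q (chart_map cX x),
      forall y, Q y -> chart_image cX y /\ chart_dom cY (f (chart_inv cX y))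
    & Cinf Q (rep f cX cY)].

Lemma smooth_at_diff f cX cY x : smooth_at f cX cY x ->
  differentiable (rep f cX cY) (chart_map cX x).
Proof. by case=> _ [Q [_ Ox _ cf]]; exact: Cinf_diff cf Ox. Qed.

Lemma rep_map f cX cY x : is_chart cX -> chart_dom cX x ->
  rep f cX cY (chart_map cX x) = chart_map cY (f x).
Proof. by move=> ic cx; rewrite /rep /= chart_invK. Qed.

Lemma smooth_at_dom f cX cY x : is_chart cX -> smooth_at f cX cY x ->
  chart_dom cY (f x).
Proof. by move=> ic [cx [Q [_ Ox /(_ _ Ox)[_]]]]; rewrite chart_invK. Qed.

Lemma smooth_map_at U f cX cY x : is_chart cX ->
  atlas (m := X) cX -> atlas (m := Y) cY -> smooth_map U f ->
  U x -> chart_dom cX x -> chart_dom cY (f x) -> smooth_at f cX cY x.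
Proof.
move=> ic aX aY [_ /(_ _ _ aX aY)] [oO cf] Ux cx cy; split=> //.
eexists; split; [exact: oO|by exists x| |exact: cf].
by move=> _ [z [Uz cz cyz] <-]; rewrite chart_invK //; split=> //; exists z.
Qed.

Hypotheses (wX : wf_mfd X) (wY : wf_mfd Y).

(** Coordinate expressions in two pairs of charts differ by transition maps,
    and their Jacobians by those of the transition maps. *)
Lemma smooth_at_chart f cX cY cX' cY' x :
  atlas (m := X) cX -> atlas (m := Y) cY -> atlas (m := X) cX' -> atlas (m := Y) cY' ->
  chart_dom cX' x -> chart_dom cY' (f x) -> smooth_at f cX cY x ->
  smooth_at f cX' cY' x /\
  'J (rep f cX' cY') (chart_map cX' x) =
  'J (tr cX' cX) (chart_map cX' x) *m 'J (rep f cX cY) (chart_map cX x)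
    *m 'J (tr cY cY') (chart_map cY (f x)).
Proof.
move=> aX aY aX' aY' cx' cy' sf; have [cx [Q [oO Ox HO cf]]] := sf.
have iX := wf_chart wX aX; have iX' := wf_chart wX aX'.
have iY := wf_chart wY aY; have cy := smooth_at_dom iX sf.
have cT := Cinf_tr wX aX' aX; have cT' := Cinf_tr wY aY aY'.
have oV := open_overlap wX aX' aX; have oV' := open_overlap wY aY aY'.
pose D := overlap cX' cX `&` tr cX' cX @^-1` Q.
have oD : open D := open_Cinf_preimage oV oO cT.
have cD : Cinf D (rep f cX cY \o tr cX' cX).
  apply: (Cinf_comp_mx (U' := Q)) => //; first by move=> y [].
  by apply: Cinf_sub cT => y [].
pose D' := D `&` (rep f cX cY \o tr cX' cX) @^-1` overlap cY cY'.
have oD' : open D' := open_Cinf_preimage oD oV' cD.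
have cD' : Cinf D' (tr cY cY' \o (rep f cX cY \o tr cX' cX)).
  apply: (Cinf_comp_mx (U' := overlap cY cY')) => //; first by move=> y [].
  by apply: Cinf_sub cD => y [].
have E y : D y -> exists z, [/\ chart_map cX' z = y, chart_dom cX' z, chart_dom cX z,
    tr cX' cX y = chart_map cX z & rep f cX cY (tr cX' cX y) = chart_map cY (f z) /\
    chart_dom cY (f z)].
  move=> [[z [cz' cz] <-]]; rewrite /= tr_map // => /HO[_].
  by rewrite chart_invK // => dz; exists z; rewrite rep_map.
have RE y : D' y -> rep f cX' cY' y = tr cY cY' (rep f cX cY (tr cX' cX y)).
  move=> [/E[z [<- cz' cz -> [E2 dz]]] _]; rewrite rep_map // rep_map //.
  by rewrite tr_map.
have Dx : D (chart_map cX' x) by split; [exact: overlap_map|rewrite /= tr_map].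
have Dx' : D' (chart_map cX' x).
  by split=> //=; rewrite tr_map // rep_map //; exact: overlap_map.
split.
  split=> //; exists D'; split=> //.
    move=> y [/E[z [<- cz' cz E1 [E2 dz]]]]; rewrite /= E2 => /overlapP h.
    have [_] := h iY; rewrite !chart_invK // => h2; split=> //.
    exact: chart_map_image.
  by apply: Cinf_ext cD' => // y /RE.
have d1 := diff_tr wX aX' aX cx' cx.
have d2 : differentiable (rep f cX cY) (tr cX' cX (chart_map cX' x)).
  by rewrite tr_map //; exact: smooth_at_diff.
have d3 : differentiable (tr cY cY') ((rep f cX cY \o tr cX' cX) (chart_map cX' x)).
  by rewrite /= tr_map // rep_map //; exact: diff_tr.
have E1 : 'J (rep f cX cY \o tr cX' cX) (chart_map cX' x) =
    'J (tr cX' cX) (chart_map cX' x) *m 'J (rep f cX cY) (chart_map cX x).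
  apply: (jacobian_comp_near oD) => //; first by rewrite tr_map.
  exact: smooth_at_diff.
rewrite -E1; apply: (jacobian_comp_near oD') => //.
- by rewrite /= tr_map // rep_map.
- exact: differentiable_comp.
- exact: diff_tr.
Qed.

(** Tangent maps are defined through preferred charts; in any charts they are
    the Jacobian of the coordinate expression, up to the matrices dchart which
    convert components. *)
Lemma Tmap_chart f cX cY x : atlas (m := X) cX -> atlas (m := Y) cY ->
  smooth_at f cX cY x ->
  Tmap f x *m dchart cY (f x) = dchart cX x *m 'J (rep f cX cY) (chart_map cX x).
Proof.
move=> aX aY sf; have [cx _] := sf.
have iX := wf_chart wX aX; have iY := wf_chart wY aY.
have cy := smooth_at_dom iX sf.
have [ap px] := pref_chartP wX (chart_dom_carrier iX cx).
have [aq qx] := pref_chartP wY (chart_dom_carrier iY cy).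
have [_ E] := smooth_at_chart aX aY ap aq px qx sf.
rewrite /Tmap -[_ \o f \o _]/(rep f _ _) E -!mulmxA; congr (_ *m _).
by rewrite /dchart jacobian_trK // mulmx1.
Qed.

Lemma Tmap_chart_inv f cX cY x : atlas (m := X) cX -> atlas (m := Y) cY ->
  smooth_at f cX cY x ->
  invmx (dchart cX x) *m Tmap f x *m dchart cY (f x) =
  'J (rep f cX cY) (chart_map cX x).
Proof.
move=> aX aY sf; have [cx _] := sf.
by rewrite -mulmxA (Tmap_chart aX aY) // mulKmx // dchart_unit.
Qed.

Lemma smooth_at_map U f : mopen U ->
  (forall x, U x -> exists cX cY, [/\ atlas (m := X) cX, atlas (m := Y) cY
     & smooth_at f cX cY x]) -> smooth_map U f.
Proof.
move=> mU H; split.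
  move=> x /H[cX [cY [aX aY /(smooth_at_dom (wf_chart wX aX))]]].
  exact: chart_dom_carrier (wf_chart wY aY).
move=> cX cY aX aY; set D := _ @` _.
have iX := wf_chart wX aX.
suff HD y : D y -> exists Q, [/\ open Q, Q y, Q `<=` D & Cinf Q (rep f cX cY)].
  split; first by apply: open_of_nbhs => y /HD[Q [? ? ? _]]; exists Q.
  by apply: Cinf_local => y /HD[Q [? ? _ ?]]; exists Q.
move=> [x [Ux cx cy] <-].
have [cX' [cY' [aX' aY' sf]]] := H x Ux.
have [[_ [Q [oO Ox HO cf]]] _] := smooth_at_chart aX' aY' aX aY cx cy sf.
have oU := mU.2 _ aX.
exists (Q `&` chart_map cX @` (U `&` chart_dom cX)); split.
- exact: openI.
- by split=> //; exists x.
- move=> y' [/HO[_ h] [z [Uz cz] zE]]; exists z => //; split=> //.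
  by move: h; rewrite -zE chart_invK.
- by apply: Cinf_sub cf => y' [].
Qed.

End Two.

Lemma smooth_at_comp d e r (X : mfd R d) (Y : mfd R e) (Z : mfd R r)
    (f : pt X -> pt Y) (g : pt Y -> pt Z) cX cY cZ x :
  is_chart cX -> is_chart cY ->
  smooth_at f cX cY x -> smooth_at g cY cZ (f x) ->
  smooth_at (g \o f) cX cZ x /\
  'J (rep (g \o f) cX cZ) (chart_map cX x) =
  'J (rep f cX cY) (chart_map cX x) *m 'J (rep g cY cZ) (chart_map cY (f x)).
Proof.
move=> iX iY sf sg; have [cx [Q [oO Ox HO cf]]] := sf.
have [cy [Q' [oO' Oy HO' cg]]] := sg.
pose D := Q `&` rep f cX cY @^-1` Q'.
have oD : open D := open_Cinf_preimage oO oO' cf.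
have Dx : D (chart_map cX x) by split=> //=; rewrite rep_map.
have cD : Cinf D (rep g cY cZ \o rep f cX cY).
  apply: (Cinf_comp_mx (U' := Q')) => //; first by move=> y [].
  by apply: Cinf_sub cf => y [].
have RE y : D y -> rep (g \o f) cX cZ y = rep g cY cZ (rep f cX cY y).
  by move=> [/HO[_ h] _]; rewrite /rep /= chart_invK.
split.
  split=> //; exists D; split=> //; last by apply: Cinf_ext cD => // y /RE.
  move=> y [Oy1 /HO' [_ h]]; have [h1 h2] := HO _ Oy1; split=> //.
  by rewrite /rep /= chart_invK in h.
apply: (jacobian_comp_near oD) => //.
- exact: rep_map.
- exact: smooth_at_diff.
- exact: smooth_at_diff.
Qed.

End SmoothMaps.

(** * Alternating forms *)

Section AlternatingForms.
Variable R : realType.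

Definition setrow k d (V : 'M[R]_(k, d)) (i : 'I_k) (u : 'rV[R]_d) : 'M[R]_(k, d) :=
  \matrix_(a, b) if a == i then u 0 b else V a b.

Lemma row_setrow k d (V : 'M[R]_(k, d)) i u : row i (setrow V i u) = u.
Proof. by apply/rowP => b; rewrite !mxE eqxx. Qed.

Lemma row_setrow_neq k d (V : 'M[R]_(k, d)) i j u : j != i ->
  row j (setrow V i u) = row j V.
Proof. by move=> /negbTE ji; apply/rowP => b; rewrite !mxE ji. Qed.

Lemma row'_setrow k d (V : 'M[R]_(k, d)) i u : row' i (setrow V i u) = row' i V.
Proof. by apply/matrixP => a b; rewrite !mxE eq_sym (negbTE (neq_lift _ _)). Qed.

Lemma setrow_row k d (V : 'M[R]_(k, d)) i : setrow V i (row i V) = V.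
Proof. by apply/matrixP => a b; rewrite !mxE; case: eqP => // ->. Qed.

Section Fixed.
Variables (k d : nat) (w : altform R k d).
Hypothesis aw : is_altform w.

Lemma alt_setrow V i (b c : R) u v :
  w (setrow V i (b *: u + c *: v)) = b * w (setrow V i u) + c * w (setrow V i v).
Proof. by apply: (aw.1 i); rewrite ?row_setrow ?row'_setrow. Qed.

Lemma alt_setrow0 V i : w (setrow V i 0) = 0.
Proof.
by have := alt_setrow V i 0 0 0 0; rewrite !scale0r addr0 !mul0r addr0.
Qed.

Lemma alt_setrow_sum V i n (c : 'I_n -> R) (u : 'I_n -> 'rV[R]_d) :
  w (setrow V i (\sum_j c j *: u j)) = \sum_j c j * w (setrow V i (u j)).
Proof.
elim/big_rec2 : _ => [|j y x _ <-]; first exact: alt_setrow0.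
by rewrite -[x]scale1r alt_setrow mul1r scale1r.
Qed.

(** Expand the rows in the standard basis one after the other; the bound n
    counts the rows still to be expanded. *)
Lemma alt_basis_eq0 :
  (forall f : 'I_k -> 'I_d, w (\matrix_(j < k) delta_mx 0 (f j)) = 0) ->
  forall V, w V = 0.
Proof.
move=> w0.
suff H n : (n <= k)%N -> forall V,
    (forall i : 'I_k, (n <= i)%N -> exists j, row i V = delta_mx 0 j) -> w V = 0.
  by move=> V; apply: (H k (leqnn k)) => i; rewrite leqNgt ltn_ord.
elim: n => [|n IH] nk V Vf.
  have {}Vf i : {j | row i V = delta_mx 0 j} by apply: cid; exact: Vf.
  rewrite (_ : V = \matrix_(j < k) delta_mx 0 (sval (Vf j))) ?w0 //.
  by apply/row_matrixP => i; rewrite rowK; exact: (svalP (Vf i)).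
pose i := Ordinal nk.
rewrite -(setrow_row V i) (row_sum_delta (row i V)) alt_setrow_sum big1 // => j _.
rewrite (IH (ltnW nk)) ?mulr0 // => l.
have [->|li] := eqVneq l i; first by exists j; rewrite row_setrow.
rewrite leq_eqVlt => /orP[/eqP nl|nl]; last by rewrite row_setrow_neq //; exact: Vf.
by case/eqP: li; apply: val_inj.
Qed.

(** Polarization: w vanishes when the rows i and j are both u + v, u or v. *)
Lemma alt_tperm V i j : i != j -> w (xrow i j V) = - w V.
Proof.
move=> ij.
pose Z u v := setrow (setrow V i u) j v.
have Zl u u' v : Z (u + u') v = setrow (setrow V j v) i (u + u').
  apply/matrixP => a b; rewrite !mxE.
  by case: eqP => // ->; rewrite eq_sym (negbTE ij).
have Zc u v : Z u v = setrow (setrow V j v) i u.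
  apply/matrixP => a b; rewrite !mxE.
  by case: eqP => // ->; rewrite eq_sym (negbTE ij).
have D1 u u' v : w (Z (u + u') v) = w (Z u v) + w (Z u' v).
  have := alt_setrow (setrow V j v) i 1 1 u u'.
  by rewrite !scale1r !mul1r !Zc.
have D2 u v v' : w (Z u (v + v')) = w (Z u v) + w (Z u v').
  have := alt_setrow (setrow V i u) j 1 1 v v'.
  by rewrite !scale1r !mul1r.
have Z0 u : w (Z u u) = 0.
  by apply: (aw.2 i j) => //; rewrite /Z row_setrow row_setrow_neq // row_setrow.
have := Z0 (row i V + row j V).
rewrite D1 !D2 !Z0 add0r addr0 => /eqP; rewrite addr_eq0 => /eqP.
have -> : Z (row i V) (row j V) = V.
  apply/matrixP => a b; rewrite !mxE.
  by case: eqP => [->//|_]; case: eqP => [->|].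
have -> : Z (row j V) (row i V) = xrow i j V; last by move=> ->; rewrite opprK.
apply/matrixP => a b; rewrite !mxE; case: tpermP => [->|->|].
- by rewrite (negbTE ij) eqxx.
- by rewrite eqxx.
- by move=> /eqP/negbTE-> /eqP/negbTE->.
Qed.

Lemma alt_row_perm_eq0 (s : 'S_k) V : w V = 0 -> w (row_perm s V) = 0.
Proof.
have [ts -> dts] := prod_tpermP s.
elim: ts V dts => [|[i j] ts IH] V /=.
  by rewrite big_nil row_perm1.
move=> /andP[ij dts] w0; rewrite big_cons row_permM.
by rewrite -[LHS]/(w (xrow i j _)) alt_tperm // IH // oppr0.
Qed.

End Fixed.

Lemma row'_mul k d e (A : 'M[R]_(k, d)) (B : 'M[R]_(d, e)) i :
  row' i (A *m B) = row' i A *m B.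
Proof.
by apply/matrixP => a b; rewrite !mxE; apply: eq_bigr => l _; rewrite mxE.
Qed.

(** Wedge products of k linear forms appear as the forms V |-> det (V *m C),
    the columns of C being the linear forms. *)
Lemma alt_det_mul d k (C : 'M[R]_(d, k)) : is_altform (fun V : 'M[R]_(k, d) => \det (V *m C)).
Proof.
split=> [i A B D b c rA rB rD|i j A ij rA].
  apply: (determinant_multilinear (i0 := i)).
  - by rewrite !row_mul rA mulmxDl !scalemxAl.
  - by rewrite !row'_mul rB.
  - by rewrite !row'_mul rD.
apply: (determinant_alternate ij) => l.
have := congr1 (fun u : 'rV[R]_d => (u *m C) 0 l) rA.
by rewrite -!row_mul !mxE.
Qed.

Lemma altD k d (w w' : altform R k d) (a b : R) :
  is_altform w -> is_altform w' -> is_altform (fun V => a * w V + b * w' V).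
Proof.
move=> [l1 a1] [l2 a2]; split=> [i A B C x y rA rB rC|i j A ij rA].
  by rewrite (l1 i A B C x y) // (l2 i A B C x y) //; ring.
by rewrite (a1 i j) // (a2 i j) // !mulr0 addr0.
Qed.

Lemma alt0 k d : is_altform (fun _ : 'M[R]_(k, d) => 0).
Proof. by split=> // *; rewrite !mulr0 addr0. Qed.

Lemma alt_sum k d (I : Type) (r : seq I) (a : I -> R) (w : I -> altform R k d) :
  (forall i, is_altform (w i)) -> is_altform (fun V => \sum_(i <- r) a i * w i V).
Proof.
move=> aw; elim: r => [|i r IH].
  by rewrite (_ : (fun V => _) = fun=> 0); [exact: alt0|apply/funext => V; rewrite big_nil].
rewrite (_ : (fun V => _) = fun V => a i * w i V + 1 * \sum_(j <- r) a j * w j V).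
  exact: altD.
by apply/funext => V; rewrite big_cons mul1r.
Qed.

Lemma alt_mulmx k d e (w : altform R k e) (B : 'M[R]_(d, e)) :
  is_altform w -> is_altform (fun V => w (V *m B)).
Proof.
move=> [l a]; split=> [i A C D b c rA rC rD|i j A ij rA].
  apply: (l i).
  - by rewrite !row_mul rA mulmxDl !scalemxAl.
  - by rewrite !row'_mul rC.
  - by rewrite !row'_mul rD.
by apply: (a i j) => //; rewrite !row_mul rA.
Qed.

Lemma alt_noninj k d (w : altform R k d) (f : 'I_k -> 'I_d) : is_altform w ->
  ~ injective f -> w (\matrix_(j < k) delta_mx 0 (f j)) = 0.
Proof.
move=> aw /injectiveP/injectivePn[i [j ij fij]].
by apply: (aw.2 i j) => //; rewrite !rowK fij.
Qed.

(** The difference of the two sides is alternating and vanishes on the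
    identity, hence on all permutations of the standard basis. *)
Lemma alt_top d (w : altform R d d) : is_altform w ->
  forall V, w V = \det V * w 1%:M.
Proof.
move=> aw V.
pose w' V := 1 * w V + (- w 1%:M) * \det (V *m 1%:M).
have aw' : is_altform w' by apply: altD => //; exact: alt_det_mul.
have w'1 : w' 1%:M = 0 by rewrite /w' mulmx1 det1 mul1r mulr1 subrr.
suff : w' V = 0.
  by rewrite /w' mulmx1 mul1r mulNr => /eqP; rewrite subr_eq0 mulrC => /eqP.
apply: alt_basis_eq0 => // f.
have [/injectiveP fi|fn] := boolP (injectiveb f); last first.
  by apply: alt_noninj => // /injectiveP; apply/negP.
rewrite (_ : \matrix_(j < d) _ = row_perm (perm fi) 1%:M).
  exact: alt_row_perm_eq0.
by apply/matrixP => a b; rewrite !mxE permE eqxx eq_sym.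
Qed.

(** The values on htuple and vtuple of a form annihilated by two vertical
    vectors are its coefficients on d^m x and on du^a /\ d^(m-1)x_i. *)
Definition htuple m n : 'M[R]_(m, m + n) := \matrix_(j < m) delta_mx 0 (lshift n j).
Definition vtuple m n (i : 'I_m) (a : 'I_n) : 'M[R]_(m, m + n) :=
  \matrix_(j < m) if j == i then delta_mx 0 (rshift m a) else delta_mx 0 (lshift n j).

(** A tuple of distinct basis vectors has at least two vertical entries, or it
    is a permutation of htuple or of some vtuple. *)
Lemma alt_semibasic_eq0 m n (w : altform R m (m + n)) : is_altform w ->
  (forall (A : 'M[R]_(m, m + n)) (i j : 'I_m), i != j ->
     lsubmx (row i A) = 0 -> lsubmx (row j A) = 0 -> w A = 0) ->
  w (htuple m n) = 0 -> (forall i a, w (vtuple i a) = 0) -> forall V, w V = 0.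
Proof.
move=> aw wv w0 w1; apply: alt_basis_eq0 => // f.
have [/injectiveP fi|fn] := boolP (injectiveb f); last first.
  by apply: alt_noninj => // /injectiveP; apply/negP.
pose W := \matrix_(j < m) (delta_mx 0 (f j) : 'rV[R]_(m + n)).
have ver j a : f j = rshift m a -> lsubmx (row j W) = 0.
  move=> fj; apply/rowP => b; rewrite !mxE fj eqxx /=.
  by rewrite eq_lrshift.
have [[j0 [a0 fj0]]|nv] := pselect (exists j a, f j = rshift m a); last first.
  have fl j : {l | f j = lshift n l}.
    case: (split_ordP (f j)) => [l E|a E]; first by exists l.
    by exfalso; apply: nv; exists j, a.
  pose s j := sval (fl j).
  have sE j : f j = lshift n (s j) by exact: svalP (fl j).
  have si : injective s by move=> i j E; apply: fi; rewrite !sE E.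
  rewrite (_ : \matrix_(j < m) _ = row_perm (perm si) (htuple m n)).
    exact: alt_row_perm_eq0.
  by apply/matrixP => a b; rewrite !mxE permE sE.
have [[j1 [a1 [j10 fj1]]]|nv] := pselect (exists j a, j != j0 /\ f j = rshift m a).
  by apply: (wv _ j1 j0) => //; [apply: ver fj1|apply: ver fj0].
have fl j : {l | j != j0 -> f j = lshift n l}.
  case: (split_ordP (f j)) => [l E|a E]; first by exists l.
  exists j0 => jj0; exfalso; apply: nv; by exists j, a.
pose g j := sval (fl j).
have gE j : j != j0 -> f j = lshift n (g j) by exact: svalP (fl j).
(* the index of the horizontal vector whose place is taken by the vertical one *)
have [i0 gi0] : exists i0, forall j, j != j0 -> g j != i0.
  apply: contrapT => /forallNP H.
  have : (#|[set: 'I_m]%SET| <= #|(g @: [set~ j0])%SET|)%N.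
    apply: subset_leq_card; apply/fintype.subsetP => i _.
    have /existsNP[j /not_implyP[jj0 /negP/negPn/eqP ij]] := H i.
    by apply/imsetP; exists j; rewrite ?inE.
  move=> /leq_trans/(_ (leq_imset_card _ _)).
  by rewrite cardsC1 cardsT card_ord leqNgt; case: (m) j0 {fj0 fl g gE H fi nv ver W} => [[]|m' _] //; rewrite ltnSn.
pose s j := if j == j0 then i0 else g j.
have si : injective s.
  move=> i j; rewrite /s; have [->|ii] := eqVneq i j0; have [->|jj] := eqVneq j j0 => //.
  - by move=> E; have := gi0 j jj; rewrite E eqxx.
  - by move=> E; have := gi0 i ii; rewrite E eqxx.
  - by move=> E; apply: fi; rewrite !gE ?E.
rewrite (_ : \matrix_(j < m) _ = row_perm (perm si) (vtuple i0 a0)).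
  by apply: alt_row_perm_eq0.
apply/matrixP => a b; rewrite !mxE permE /s.
have [->|aj] := eqVneq a j0; first by rewrite !eqxx fj0 mxE.
by rewrite (negbTE (gi0 a aj)) gE // mxE.
Qed.

End AlternatingForms.

(** * Charts in which the volume form is d^m x *)

Section Straightening.
Variables (R : realType) (m : nat).
Notation V := 'rV[R]_m.+1.

(** A change of the first coordinate, written as a translation along the first
    basis vector so that derivatives in this direction apply. *)
Definition upd (y : V) (t : R) : V := y + (t - y 0 0) *: delta_mx 0 0.

Lemma upd0 y t : upd y t 0 0 = t.
Proof. by rewrite !mxE !eqxx mulr1 addrC subrK. Qed.

Lemma updS y t j : j != 0 -> upd y t 0 j = y 0 j.
Proof. by move=> /negbTE j0; rewrite !mxE j0 andbF mulr0 addr0. Qed.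

Lemma upd_upd y t u : upd (upd y t) u = upd y u.
Proof.
apply/rowP => j; have [->|j0] := eqVneq j 0; first by rewrite !upd0.
by rewrite !updS.
Qed.

Lemma upd_line y t u : upd y (t + u) = upd y t + u *: delta_mx 0 0.
Proof. by apply/rowP => j; rewrite !mxE; ring. Qed.

Lemma upd_id y : upd y (y 0 0) = y.
Proof. by rewrite /upd subrr scale0r addr0. Qed.

Lemma derive_coord d (y v : 'rV[R]_d) j : 'D_v (fun z : 'rV[R]_d => z 0 j) y = v 0 j.
Proof.
have dI : derivable (@id 'rV[R]_d) y v by exact: derivable_id.
by have := derive_mx dI; rewrite derive_id => /matrixP/(_ 0 j); rewrite mxE => <-.
Qed.

Lemma lform_delta d (c : 'I_d -> R) i : lform c (delta_mx 0 i) = c i.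
Proof.
rewrite /lform (bigD1 i) //= big1 ?addr0; first by rewrite mxE !eqxx mul1r.
by move=> j /negbTE ji; rewrite mxE ji andbF mul0r.
Qed.

Lemma jt_delta_mx d i : jt 0 (delta_mx 0 i : 'rV[R]_d) = delta_mx 0 (rshift 1 i).
Proof.
apply/rowP => j; rewrite [RHS]mxE /=; have [k|k] := split_ordP j => ->.
  by rewrite row_mxEl mxE eq_lrshift.
by rewrite row_mxEr mxE eq_rshift.
Qed.

Lemma between_opp_sign (u v w : R) : (u - w) * (v - w) < 0 ->
  Num.min v u <= w <= Num.max v u.
Proof.
rewrite ge_min le_max => hz; apply/andP; split; apply: contraLR hz;
  rewrite negb_or -!ltNge -leNgt => /andP[h1 h2]; nra.
Qed.

Lemma mxBE p q (A A' : 'M[R]_(p, q)) i j : (A - A') i j = A i j - A' i j.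
Proof. by rewrite !mxE. Qed.

Lemma norm_row_lt (v : V) (r : R) : 0 < r -> (forall j, `|v 0 j| < r) -> `|v| < r.
Proof.
move=> r0 H; rewrite /Num.Def.normr /= mx_normrE bigmax_lt //= => -[i j] _ /=.
by rewrite ord1.
Qed.

Lemma ball_rowP (y z : V) (r : R) : 0 < r ->
  ball y r z <-> forall j, `|y 0 j - z 0 j| < r.
Proof.
move=> r0; rewrite -ball_normE /ball_ /=; split=> [yz j|H].
  by apply: le_lt_trans yz; have := entry_norm (y - z) 0 j; rewrite !mxE.
by apply: norm_row_lt => // j; rewrite !mxE.
Qed.

Variables (f : V -> R) (Om : set V) (ys : V).
Hypotheses (oOm : open Om) (sf : Cinf Om f) (f0 : forall y, Om y -> f y != 0).
Variable r : R.
Hypotheses (r0 : 0 < r) (rOm : ball ys r `<=` Om).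
Hypothesis fsign : forall y, ball ys r y -> 0 < f y * f ys.
Let B : set V := ball ys r.
Let a := ys 0 0.

Let oB : open B.
Proof. exact: ball_open. Qed.

(** Polynomial in all variables, hence smooth; on jt s y it moves the first
    coordinate of y to a + s (y_0 - a), which for s from 0 to 1 runs from a to
    y_0. *)
Definition sq (z : 'rV[R]_(1 + m.+1)) : V :=
  rsubmx z + ((z 0 0 - 1) * (z 0 (rshift 1 0) - a)) *: delta_mx 0 0.

Lemma sq_jt s y : sq (jt s y) = upd y (a + s * (y 0 0 - a)).
Proof.
have j0 : jt s y 0 0 = s.
  have -> : (0 : 'I_(1 + m.+1)) = lshift m.+1 0 by exact: val_inj.
  by rewrite row_mxEl mxE.
rewrite /sq j0 {2}/jt row_mxEr /jt row_mxKr /upd; congr (_ + _ *: _); ring.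
Qed.

Lemma Cinf_sq : Cinf setT sq.
Proof.
have oT : open [set: 'rV[R]_(1 + m.+1)] by exact: openT.
apply: Cinf_mx => // i j.
apply: (@Cinf_ext _ _ _ _ (fun z : 'rV[R]_(1 + m.+1) => z 0 (rshift 1 j) +
   ((z 0 0 - 1) * (z 0 (rshift 1 0) - a)) * (delta_mx 0 0 : V) i j)) => //.
  by move=> z _; rewrite !mxE ord1.
have cE l : Cinf setT (fun z : 'rV[R]_(1 + m.+1) => z 0 l).
  exact: (Cinf_entry 0 l oT (Cinf_id setT)).
apply: CinfD => //; apply: CinfM => //; last exact: Cinf_cst.
by apply: CinfM => //; apply: CinfB => //; exact: Cinf_cst.
Qed.

Let N := sq @^-1` B.

Let oN : open N.
Proof. by rewrite -[N]setTI; apply: open_Cinf_preimage Cinf_sq => //; exact: openT. Qed.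

Let BN s y : `[0, 1]%classic s -> B y -> N (jt s y).
Proof.
rewrite /= in_itv /= => /andP[s0 s1] /(ball_rowP _ _ r0) By.
rewrite /N /= sq_jt; apply/ball_rowP => // j.
have [->|j0] := eqVneq j 0; last by rewrite updS.
rewrite upd0 opprD addNKr normrN normrM distrC.
by rewrite (le_lt_trans _ (By 0)) // ler_piMl // ger0_norm.
Qed.

Let cfq : Cinf N (f \o sq).
Proof.
apply: (Cinf_comp (U' := Om)) => //; first by move=> z /rOm.
by apply: Cinf_sub Cinf_sq.
Qed.

(** The integral of f in the first coordinate from a to y_0, rescaled to
    [0, 1]. *)
Definition primitive (y : V) : R :=
  (y 0 0 - a) * itg (fun s => (f \o sq) (jt s y)).
Let G := primitive.

Lemma Cinf_primitive : Cinf B G.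
Proof.
move=> k; apply: CkM => //.
  apply: CkB => //; last exact: Ck_cst.
  exact: (Ck_entry oB 0 0 (Ck_id k B)).
exact: (Ck_itg_jt oB BN (cfq k)).
Qed.

(** Differentiation under the integral sign yields the integral of f + (y_0 -
    a) s D_0 f along the path, and this is the derivative of s |-> s f. *)
Lemma derive_primitive y : B y -> 'D_(delta_mx 0 0) G y = f y.
Proof.
move=> By; pose e0 : V := delta_mx 0 0.
have c1 := cfq 1%N.
have [dI EI] := is_diff_itg_jt oB BN c1 By.
have dy0 : differentiable (fun y : V => y 0 0) y by exact: differentiable_coord.
have dc : differentiable (fun y : V => y 0 0 - a) y.
  by apply: differentiableB => //; exact: differentiable_cst.
have Dy0 : 'D_e0 (fun y : V => y 0 0 - a) y = 1.
  rewrite deriveB; [|exact: diff_derivable|exact: derivable_cst].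
  rewrite derive_cst subr0.
  by rewrite derive_coord mxE !eqxx.
rewrite (deriveM (f := fun y : V => y 0 0 - a)); try exact: diff_derivable.
rewrite Dy0 /GRing.scale /= mulr1 (deriveE _ dI) EI.
have dfq z : N z -> differentiable (f \o sq) z by exact: Cinf_diff cfq.
pose D s := 'D_(jt 0 e0) (f \o sq) (jt s y).
have cD : cont_I D.
  exact: (jt_cont_I BN (Cinf_deriv (jt 0 e0) cfq 0%N) By).
have -> : lform (fun i => itg (fun s => 'D_(delta_mx 0 (rshift 1 i)) (f \o sq) (jt s y))) e0
    = itg D.
  by rewrite lform_delta; congr itg; apply/funext => s; rewrite /D jt_delta_mx.
have cF : cont_I (fun s => (f \o sq) (jt s y)).
  exact: (jt_cont_I BN (cfq 0%N) By).
rewrite -itgZ // -itgD //; last exact: cont_IZ.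
pose p s := upd y (a + s * (y 0 0 - a)).
have pE s : p s = upd y a + s *: ((y 0 0 - a) *: e0).
  by rewrite /p upd_line scalerA.
have Bp s : `[0, 1]%classic s -> Om (p s).
  by move=> s01; apply: rOm; have := BN s01 By; rewrite /N /= sq_jt.
have dline (s : R) : `[0, 1]%classic s ->
    is_derive s 1 (fun s => f (p s)) ((y 0 0 - a) * 'D_e0 f (p s)).
  move=> s01; have dfp : differentiable f (p s) by apply: (Cinf_diff sf); exact: Bp.
  have := @is_derive_line R _ _ f (upd y a) ((y 0 0 - a) *: e0) s.
  rewrite -pE => /(_ dfp).
  have -> : (fun s => f (upd y a + s *: ((y 0 0 - a) *: e0))) = (fun s => f (p s)).
    by apply/funext => t; rewrite pE.
  by rewrite deriveE // linearZ -deriveE.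
have DE s : `[0, 1]%classic s -> D s = s * 'D_e0 f (p s).
  move=> s01; have dfp : differentiable f (p s) by apply: (Cinf_diff sf); exact: Bp.
  have h1 := @is_derive_line R _ _ (f \o sq) (jt s y) (jt 0 e0) 0.
  rewrite scale0r addr0 in h1.
  have [_ E1] := h1 (dfq _ (BN s01 By)).
  have h2 := @is_derive_line R _ _ f (p s) (s *: e0) 0.
  rewrite scale0r addr0 in h2; have [_ E2] := h2 dfp.
  have -> : s * 'D_e0 f (p s) = 'D_(s *: e0) f (p s).
    by rewrite [RHS]deriveE // linearZ -deriveE.
  apply: (etrans (esym E1)); apply: (etrans _ E2).
  have FE : (fun t : R => (f \o sq) (jt s y + t *: jt 0 e0)) =
      (fun t : R => f (p s + t *: (s *: e0))).
    apply/funext => t; have yt : y + t *: e0 = upd y (y 0 0 + t) by rewrite upd_line upd_id.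
    rewrite /= row_mx_jt sq_jt yt upd_upd upd0 /p scalerA -upd_line.
    by congr (f (upd y _)); ring.
  by rewrite FE.
have -> : itg (fun s => (y 0 0 - a) * D s + (f \o sq) (jt s y)) =
   1 * f (p 1) - 0 * f (p 0).
  apply: (itg_FTC (g := fun s => s * f (p s))).
    by apply: cont_ID => //; exact: cont_IZ.
  move=> s s01; have [d1 E1] := dline s s01.
  have did : derivable (@id R) s 1 by exact: derivable_id.
  have dm := derivableM did d1.
  apply: DeriveDef; first exact: dm.
  apply: (etrans (deriveM did d1)); rewrite E1 derive_id /GRing.scale /= mulr1.
  by rewrite DE // sq_jt -/(p s); ring.
by rewrite mul0r subr0 mul1r /p mul1r addrC subrK upd_id.
Qed.

Lemma primitive_MVT y t : B y -> B (upd y t) ->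
  exists2 xi, B xi & G (upd y t) - G y = (t - y 0 0) * f xi.
Proof.
wlog ty : y t / y 0 0 < t => [H By Bt|By Bt].
  have [ty|ty|ty] := ltgtP (y 0 0) t; first exact: H.
    have [||| xi Bxi E] := H (upd y t) (y 0 0).
    - by rewrite upd0.
    - by [].
    - by rewrite upd_upd upd_id.
    exists xi => //; move: E; rewrite upd_upd upd_id upd0 => E.
    by rewrite -opprB E -mulNr opprB.
  by exists y => //; rewrite -ty upd_id !subrr mul0r.
have ty' : 0 < t - y 0 0 by rewrite subr_gt0.
have Bs s : 0 <= s <= t - y 0 0 -> B (y + s *: delta_mx 0 0).
  move=> /andP[s0 st]; move: By Bt => /(ball_rowP _ _ r0) By /(ball_rowP _ _ r0) Bt.
  apply/(ball_rowP _ _ r0) => j.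
  have [->|/negbTE j0] := eqVneq j 0; last by rewrite !mxE j0 andbF mulr0 addr0.
  have := By 0; have := Bt 0; rewrite upd0 !mxE !eqxx mulr1 !ltr_norml.
  by move=> /andP[? ?] /andP[? ?]; apply/andP; split; lra.
have [c /andP[c0 ct] E] := @line_MVT R V G y (delta_mx 0 0) _ ty'
  (fun s hs => Cinf_diff Cinf_primitive (Bs s hs)).
have Bc : B (y + c *: delta_mx 0 0) by apply: Bs; rewrite !ltW.
by exists (y + c *: delta_mx 0 0) => //; rewrite -/(upd y t) in E; rewrite E derive_primitive.
Qed.

(** The first coordinate is replaced by the primitive of f, so the Jacobian is
    triangular and its diagonal is (f, 1, ..., 1). *)
Definition straight (y : V) : V := upd y (G y).
Let phi := straight.

Lemma Cinf_straight : Cinf B phi.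
Proof.
apply: Cinf_mx => // i j.
have cE l : Cinf B (fun z : V => z 0 l) by exact: (Cinf_entry 0 l oB (Cinf_id B)).
apply: (@Cinf_ext _ _ _ _ (fun z : V => z 0 j + (G z - z 0 0) * (delta_mx 0 0 : V) i j)) => //.
  by move=> z _; rewrite !mxE ord1.
apply: CinfD => //; apply: CinfM => //; last exact: Cinf_cst.
by apply: CinfB => //; exact: Cinf_primitive.
Qed.

Lemma det_straight y : B y -> \det ('J phi y) = f y.
Proof.
move=> By; have dphi := Cinf_diff Cinf_straight By.
have JS i j : j != 0 -> 'J phi y i j = (i == j)%:R.
  move=> j0; rewrite jacobian_entry //.
  rewrite (_ : (fun z => phi z 0 j) = fun z : V => z 0 j); last first.
    by apply/funext => z; rewrite /phi /straight updS.
  by rewrite derive_coord mxE eqxx eq_sym.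
have J0 : 'J phi y 0 0 = f y.
  rewrite jacobian_entry // (_ : (fun z => phi z 0 0) = G).
    exact: derive_primitive.
  by apply/funext => z; rewrite /phi /straight upd0.
rewrite det_trig.
  rewrite big_ord_recl J0 big1 ?mulr1 // => i _.
  by rewrite JS ?eqxx.
apply/is_trig_mxP => i j ij; rewrite JS.
  by case: eqP ij => // ->; rewrite ltnn.
by apply: contraTneq ij => ->.
Qed.

(** Points with the same image differ in the first coordinate only, and in
    this direction the primitive is injective because its derivative f has no
    zero. *)
Lemma straight_inj y y' : B y -> B y' -> phi y = phi y' -> y = y'.
Proof.
move=> By By' E.
have yE : y' = upd y (y' 0 0).
  apply/rowP => j; have [->|j0] := eqVneq j 0; first by rewrite upd0.
  by have := congr1 (fun v : V => v 0 j) E; rewrite /phi /straight !updS.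
have GE : G y = G y'.
  by have := congr1 (fun v : V => v 0 0) E; rewrite /phi /straight !upd0.
have By1 := By'; rewrite yE in By1.
have [xi Bxi] := primitive_MVT By By1; rewrite -yE GE subrr => /esym/eqP.
rewrite mulf_eq0 (negbTE (f0 (rOm Bxi))) orbF subr_eq0 => /eqP y0.
by rewrite yE y0 upd_id.
Qed.

(** Openness of the image and continuity of the inverse at once. On a short
    segment through y in the first direction, the primitive minus z_0 changes
    sign for z = phi(y), hence for all z near phi(y); the intermediate value
    theorem then solves phi(p) = z on this segment. *)
Lemma straight_local y (e : R) : B y -> 0 < e ->
  \forall z \near phi y, exists p, [/\ B p, phi p = z & `|y - p| < e].
Proof.
move=> By e0.
have /nbhs_ballP[q /= q0 qB] : nbhs y B by apply: open_nbhs_nbhs.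
(* d is the half-length of the segment, small with respect to B and to e *)
pose d := Num.min q e / 2.
have m0 : 0 < Num.min q e by rewrite lt_min q0.
have d0 : 0 < d by rewrite divr_gt0.
have dm : d < Num.min q e by rewrite /d ltr_pdivrMr // mulr_natr mulr2n ltrDl.
have [dq de] : d < q /\ d < e by move: dm; rewrite lt_min => /andP[].
have Bz (z : V) t : `|z - phi y| < d -> `|t - y 0 0| <= d ->
    B (upd z t) /\ `|y - upd z t| < e.
  move=> zy ty.
  have H j : `|y 0 j - upd z t 0 j| <= d.
    have [->|j0] := eqVneq j 0; first by rewrite upd0 distrC.
    rewrite updS //; apply: ltW; apply: le_lt_trans zy; rewrite distrC.
    have := entry_norm (z - phi y) 0 j.
    by rewrite mxBE /phi /straight updS.
  split; first by apply: qB; apply/ball_rowP => // j; exact: le_lt_trans (H j) dq.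
  by apply: norm_row_lt => // j; rewrite mxBE; exact: le_lt_trans (H j) de.
pose tp := y 0 0 + d; pose tm := y 0 0 - d.
have tpd : `|tp - y 0 0| <= d by rewrite /tp addrC addKr ger0_norm // ltW.
have tmd : `|tm - y 0 0| <= d by rewrite /tm addrC addKr normrN ger0_norm // ltW.
have updphi t : upd (phi y) t = upd y t by rewrite /phi /straight upd_upd.
have zz : `|phi y - phi y| < d by rewrite subrr normr0.
have Btp : B (upd y tp) by rewrite -updphi; have [] := Bz _ _ zz tpd.
have Btm : B (upd y tm) by rewrite -updphi; have [] := Bz _ _ zz tmd.
pose h (t : R) (z : V) := G (upd z t) - z 0 0.
have ch t : B (upd y t) -> {for phi y, continuous (h t)}.
  move=> Bt; apply: continuousB; last first.
    by apply: differentiable_continuous; exact: differentiable_coord.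
  apply: (@continuous_comp _ _ _ (upd^~ t) G); last first.
    by rewrite updphi; exact: (Cinf_continuous Cinf_primitive).
  apply: continuous_at_mx => i j.
  have [->|j0] := eqVneq j 0.
    rewrite (_ : (fun _ => _) = fun=> t); first exact: cst_continuous.
    by apply/funext => z; rewrite ord1 upd0.
  rewrite (_ : (fun _ => _) = fun z : V => z 0 j).
    by apply: differentiable_continuous; exact: differentiable_coord.
  by apply/funext => z; rewrite ord1 updS.
have hneg : h tp (phi y) * h tm (phi y) < 0.
  rewrite /h !updphi /phi /straight upd0.
  have [x1 B1 E1] := primitive_MVT By Btp; have [x2 B2 E2] := primitive_MVT By Btm.
  rewrite [G (upd y tp) - _]E1 [G (upd y tm) - _]E2.
  have -> : tp - y 0 0 = d by rewrite /tp addrC addKr.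
  have -> : tm - y 0 0 = - d by rewrite /tm addrC addKr.
  have f12 : 0 < f x1 * f x2.
    have := mulr_gt0 (fsign B1) (fsign B2).
    have fs : 0 < f ys * f ys by apply: fsign; exact: ballxx.
    have -> : f x1 * f ys * (f x2 * f ys) = (f x1 * f x2) * (f ys * f ys) by ring.
    by rewrite pmulr_lgt0.
  have -> : d * f x1 * (- d * f x2) = - (d ^+ 2 * (f x1 * f x2)) by ring.
  by rewrite oppr_lt0 mulr_gt0 // exprn_gt0.
have ch2 : {for phi y, continuous (fun z => h tp z * h tm z)}.
  by apply: continuousM; exact: ch.
have N1 : \forall z \near phi y, h tp z * h tm z < 0.
  exact: (cvgr_lt _ ch2 _ hneg).
have N2 : \forall z \near phi y, `|phi y - z| < d.
  by apply/nbhs_ballP; exists d => // z; rewrite -ball_normE.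
apply: filterS2 N1 N2 => z hz; rewrite distrC => zd.
have tmp : tm <= tp by rewrite /tm /tp lerD2l (le_trans _ (ltW d0)) // oppr_le0 ltW.
have Bt t : t \in `[tm, tp] -> B (upd z t) /\ `|y - upd z t| < e.
  rewrite in_itv /= => /andP[t1 t2]; apply: Bz => //.
  by rewrite ler_distl t1.
have cG : {within `[tm, tp], continuous (fun t => G (upd z t))}.
  apply: continuous_in_subspaceT => t; rewrite inE /= => tI.
  apply: (@continuous_comp _ _ _ (upd z) G); last first.
    by apply: (Cinf_continuous Cinf_primitive); have [] := Bt t tI.
  apply: continuous_at_mx => i j.
  have [->|j0] := eqVneq j 0.
    by rewrite (_ : (fun _ => _) = id) //; apply/funext => u; rewrite ord1 upd0.
  rewrite (_ : (fun _ => _) = fun=> z 0 j); first exact: cst_continuous.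
  by apply/funext => u; rewrite ord1 updS.
have [|t tI Gt] := IVT (v := z 0 0) tmp cG.
  exact: between_opp_sign.
have [Bp pe] := Bt t tI; exists (upd z t); split=> //.
by rewrite /phi /straight upd_upd Gt upd_id.
Qed.

End Straightening.

Section UnimodularCharts.
Variable R : realType.

(** The ball B is small enough for f to keep its sign, which makes
    straightening a smooth injective map with invertible Jacobian and
    continuous inverse. *)
Lemma jacobian_prescribed m (f : 'rV[R]_m.+1 -> R) (Om : set 'rV[R]_m.+1) ys :
  open Om -> Cinf Om f -> (forall y, Om y -> f y != 0) -> Om ys ->
  exists (B : set 'rV[R]_m.+1) (phi psi : 'rV[R]_m.+1 -> 'rV[R]_m.+1),
  [/\ [/\ open B, B ys & B `<=` Om], open (phi @` B), Cinf B phi,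
      Cinf (phi @` B) psi /\ (forall y, B y -> psi (phi y) = y)
    & forall y, B y -> \det ('J phi y) = f y].
Proof.
move=> oOm cf f0 Oys.
have ff : 0 < f ys * f ys by rewrite -expr2 exprn_even_gt0 // f0.
have cff : Cinf Om (fun y => f y * f ys) by apply: CinfM => //; exact: Cinf_cst.
have o2 : open (Om `&` (fun y => f y * f ys) @^-1` [set t | 0 < t]).
  by apply: open_Cinf_preimage cff => //; exact: open_gt.
have /nbhs_ballP[r /= r0 Hr] : nbhs ys (Om `&` (fun y => f y * f ys) @^-1` [set t | 0 < t]).
  by apply: open_nbhs_nbhs.
have rOm : ball ys r `<=` Om by move=> y /Hr[].
have fs y : ball ys r y -> 0 < f y * f ys by move=> /Hr[].
pose B : set 'rV[R]_m.+1 := ball ys r.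
pose phi : 'rV[R]_m.+1 -> 'rV[R]_m.+1 := straight f ys.
pose psi z := xget ys [set y | B y /\ phi y = z].
have oB : open B by exact: ball_open.
have cphi : Cinf B phi := Cinf_straight oOm cf r0 rOm.
have psiP z : (phi @` B) z -> B (psi z) /\ phi (psi z) = z.
  move=> [y By yz].
  exact: (@xgetPex _ ys [set y | B y /\ phi y = z] (ex_intro _ y (conj By yz))).
have psiK y : B y -> psi (phi y) = y.
  move=> By; have [h1 h2] : B (psi (phi y)) /\ phi (psi (phi y)) = phi y.
    by apply: psiP; exists y.
  exact: (straight_inj oOm cf f0 r0 rOm h1 By h2).
have loc y e : B y -> 0 < e -> \forall z \near phi y, exists p, [/\ B p, phi p = z & `|y - p| < e].
  exact: (straight_local oOm cf r0 rOm fs).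
have oD : open (phi @` B).
  rewrite openE => _ [y By <-].
  by apply: filterS (loc y 1 By ltr01) => z [p [Bp pz _]]; exists p.
have cpsi z : (phi @` B) z -> {for z, continuous psi}.
  move=> [y By <-]; apply/(@cvgrPdist_lt _ _ _ (nbhs (phi y)) _) => e e0.
  apply: filterS (loc y e By e0) => z' [p [Bp <- yp]].
  by rewrite !psiK.
have detJ y : B y -> \det ('J phi y) = f y := det_straight oOm cf r0 rOm (y := y).
have Jphi y : B y -> 'J phi y \in unitmx.
  by move=> By; rewrite unitmxE unitfE detJ // f0 //; exact: rOm.
exists B, phi, psi; split=> //; first by split=> //; exact: ballxx.
split=> //; apply: (Cinf_inverse oB oD cphi Jphi) => //; by move=> z /psiP[].
Qed.

(** By maximality of the atlas, a chart may be restricted and followed by a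
    diffeomorphism between open sets. *)
Lemma refine_chart d (X : mfd R d) c0 (B : set 'rV[R]_d) phi psi :
  is_manifold X -> atlas (m := X) c0 -> open B -> B `<=` chart_image c0 ->
  open (phi @` B) -> Cinf B phi -> Cinf (phi @` B) psi ->
  (forall y, B y -> psi (phi y) = y) ->
  atlas (m := X) (Chart [set p | chart_dom c0 p /\ B (chart_map c0 p)]
    (phi \o chart_map c0) (chart_inv c0 \o psi)).
Proof.
move=> HX a0 oB BI oD cphi cpsi psiK; have wX := manifold_wf HX.
have i0 := wf_chart wX a0.
set c1 := Chart _ _ _.
have imE : chart_image c1 = phi @` B.
  apply/seteqP; split=> [_ [p [cp Bp] <-]|_ [y By <-]]; first by exists (chart_map c0 p).
  have [h1 h2] := chart_image_inv i0 (BI _ By).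
  by exists (chart_inv c0 y); rewrite /c1 /= h2.
apply: (mfd_maximal HX).
  split; [|by rewrite imE|].
    by move=> p [cp _]; exact: chart_dom_carrier i0 cp.
  by move=> p [cp Bp] /=; rewrite psiK // chart_invK.
move=> c' a'; have i' := wf_chart wX a'.
have ov := open_overlap wX a0 a'; have ov' := open_overlap wX a' a0.
have ct := Cinf_tr wX a0 a'; have ct' := Cinf_tr wX a' a0.
split; rewrite /smooth_transition.
  set D := _ @` _.
  have DE : D = (phi @` B) `&` psi @^-1` overlap c0 c'.
    apply/seteqP; split=> [_ [p [[cp Bp] c'p] <-]|_ [[y By <-]] /=].
      by split; [exists (chart_map c0 p)|rewrite /= psiK //; exact: overlap_map].
    rewrite psiK // => -[p [cp c'p] py].
    by exists p; rewrite /= ?py //; split=> //; split=> //; rewrite py.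
  have oDD : open D by rewrite DE; exact: open_Cinf_preimage.
  split=> //.
  apply: (Cinf_comp_mx (U' := overlap c0 c') (f := psi) (g := tr c0 c')) => //.
    by rewrite DE => y [].
  by apply: Cinf_sub cpsi; rewrite DE => y [].
set D := _ @` _.
have DE : D = overlap c' c0 `&` tr c' c0 @^-1` B.
  apply/seteqP; split=> [_ [p [c'p [cp Bp]] <-]|_ [[p [c'p cp] <-]]].
    by split; [exact: overlap_map|rewrite /= tr_map].
  by rewrite /= tr_map // => Bp; exists p.
have oDD : open D by rewrite DE; exact: open_Cinf_preimage.
split=> //.
apply: (Cinf_comp_mx (U' := B) (f := tr c' c0) (g := phi)) => //.
  by rewrite DE => y [].
by apply: Cinf_sub ct'; rewrite DE => y [].
Qed.

Lemma coord_volume_id m (M : mfd R m) (c : chart R (pt M) m) x (V : 'M[R]_m) :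
  coord_volume c id x V = \det (V *m dchart c x).
Proof.
congr (\det _); apply/matrixP => i j; rewrite !mxE /dcoord mxE.
by apply: eq_bigr => k _; rewrite mxE.
Qed.

(** In any chart eta is f d^m x, with f its value on the coordinate vectors,
    by [alt_top]. A change of coordinates with Jacobian determinant f absorbs
    the factor. *)
Lemma unimodular_chart m (M : mfd R m.+1) (eta : pt M -> altform R m.+1 m.+1) x :
  is_manifold M -> is_volume_form eta -> carrier (m := M) x ->
  exists c, [/\ atlas (m := M) c, chart_dom c x & unimodular eta c].
Proof.
move=> HM Heta Mx; have wM := manifold_wf HM.
have [c0 a0 cx] := wf_cover wM Mx; have i0 := wf_chart wM a0.
pose f y := eta (chart_inv c0 y) (\matrix_i coord_vec c0 (chart_inv c0 y) i).
have fE p : chart_dom c0 p -> f (chart_map c0 p) = eta p (invmx (dchart c0 p)).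
  move=> cp; rewrite /f chart_invK //; congr (eta p _).
  by apply/row_matrixP => i; rewrite rowK.
have etaE p V : chart_dom c0 p -> eta p V = \det (V *m dchart c0 p) * f (chart_map c0 p).
  move=> cp; have ap := volume_form Heta (chart_dom_carrier i0 cp).
  have U := dchart_unit wM a0 cp.
  rewrite fE // -[V in LHS](mulmxK U).
  have := alt_top (alt_mulmx (invmx (dchart c0 p)) ap) (V *m dchart c0 p).
  by rewrite mul1mx.
have f0 y : chart_image c0 y -> f y != 0.
  move=> [p cp <-]; have [V] := volume_nonzero Heta (chart_dom_carrier i0 cp).
  by rewrite etaE // mulf_eq0 negb_or => /andP[].
have oI : open (chart_image c0) by have [] := i0.
have cf : Cinf (chart_image c0) f := volume_smooth Heta a0.
clearbody f.
have [B [phi [psi [[oB Bx BI] oD cphi [cpsi psiK] detJ]]]] :=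
  jacobian_prescribed oI cf f0 (chart_map_image cx).
have a1 := refine_chart HM a0 oB BI oD cphi cpsi psiK.
set c1 := Chart _ _ _ in a1.
have trE y : B y -> tr c0 c1 y = phi y.
  by move=> By; rewrite /tr /= (chart_image_inv i0 (BI _ By)).2.
have c1E p : chart_dom c1 p <-> chart_dom c0 p /\ B (chart_map c0 p) by [].
clearbody c1; exists c1; split=> //; first by apply/c1E.
move=> p c1p; have [cp Bp] := (c1E p).1 c1p; apply/funext => V.
apply: (etrans (etaE p V cp)); apply: (etrans _ (esym (coord_volume_id c1 p V))).
have -> : dchart c1 p = dchart c0 p *m 'J (tr c0 c1) (chart_map c0 p).
  exact: dchart_tr.
have -> : 'J (tr c0 c1) (chart_map c0 p) = 'J phi (chart_map c0 p).
  apply: esym; apply: near_eq_jacobian; last exact: Cinf_diff cphi Bp.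
  by apply: (near_open oB) => // y /trE.
by rewrite (mulmxA V) [RHS]det_mulmx (detJ _ Bp).
Qed.

End UnimodularCharts.

(** * Adapted charts *)

Section LinearMaps.
Variables (R : realType) (V : normedModType R) (U : set V).
Hypothesis oU : open U.

Lemma Cinf_lin_mx p q r s (f : {linear 'M[R]_(p, q) -> 'M[R]_(r, s)}) (F : V -> 'M[R]_(p, q)) :
  Cinf U F -> Cinf U (fun x => f (F x)).
Proof.
move=> cF; apply: Cinf_mx => // i j.
apply: (@Cinf_ext _ _ _ _ (fun x => \sum_a \sum_b F x a b * f (delta_mx a b) i j)) => //.
  move=> x _; rewrite {2}[F x]matrix_sum_delta linear_sum summxE; apply: eq_bigr => a _.
  by rewrite linear_sum summxE; apply: eq_bigr => b _; rewrite linearZ mxE.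
apply: Cinf_sum => // a _; apply: Cinf_sum => // b _; apply: CinfM => //.
  exact: Cinf_entry.
exact: Cinf_cst.
Qed.

Lemma Cinf_lsubmx p q r (F : V -> 'M[R]_(p, q + r)) :
  Cinf U F -> Cinf U (fun x => lsubmx (F x)).
Proof. exact: (Cinf_lin_mx lsubmx). Qed.

Lemma Cinf_rsubmx p q r (F : V -> 'M[R]_(p, q + r)) :
  Cinf U F -> Cinf U (fun x => rsubmx (F x)).
Proof. exact: (Cinf_lin_mx rsubmx). Qed.

Lemma Cinf_mxvec p q (F : V -> 'M[R]_(p, q)) :
  Cinf U F -> Cinf U (fun x => mxvec (F x)).
Proof. exact: (Cinf_lin_mx mxvec). Qed.

Lemma Cinf_vec_mx p q (F : V -> 'rV[R]_(p * q)) :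
  Cinf U F -> Cinf U (fun x => vec_mx (F x)).
Proof. exact: (Cinf_lin_mx vec_mx). Qed.

Lemma Cinf_row_mx p q r (F : V -> 'M[R]_(p, q)) (G : V -> 'M[R]_(p, r)) :
  Cinf U F -> Cinf U G -> Cinf U (fun x => row_mx (F x) (G x)).
Proof.
move=> cF cG; apply: Cinf_mx => // i j.
have [k|k] := split_ordP j => ->.
  apply: Cinf_ext oU _ (Cinf_entry i k oU cF) => x _; by rewrite row_mxEl.
by apply: Cinf_ext oU _ (Cinf_entry i k oU cG) => x _; rewrite row_mxEr.
Qed.

End LinearMaps.

Section AdaptedCharts.
Variable R : realType.

Lemma open_sub_preimage d e (O1 : set 'rV[R]_d) (O2 : set 'rV[R]_e) :
  open O1 -> open O2 ->
  open [set y : 'rV[R]_(d + e) | O1 (lsubmx y) /\ O2 (rsubmx y)].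
Proof.
move=> o1 o2; have oT := @openT 'rV[R]_(d + e).
have c1 := Cinf_lsubmx oT (Cinf_id [set: 'rV[R]_(d + e)]).
have c2 := Cinf_rsubmx oT (Cinf_id [set: 'rV[R]_(d + e)]).
have := openI (open_Cinf_preimage oT o1 c1) (open_Cinf_preimage oT o2 c2).
by congr open; apply/seteqP; split=> [y [[_ h1] [_ h2]]|y [h1 h2]].
Qed.

Variables (m n : nat) (M : mfd R m.+1) (E : mfd R (m.+1 + n)) (pi : pt E -> pt M).
Variable eta : pt M -> altform R m.+1 m.+1.
Hypotheses (HM : is_manifold M) (HE : is_manifold E) (Hpi : is_fiber_bundle pi).
Hypothesis Heta : is_volume_form eta.

(** In a local trivialization, a unimodular chart of M and a chart of the
    fibre form a chart of E; it belongs to the atlas of E by maximality. *)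
Lemma adapted_chart e : carrier (m := E) e ->
  exists cM cE, adapted eta pi cM cE /\ chart_dom cE e.
Proof.
move=> Ee; case: Hpi => spi _ [F [HF triv]].
have wM := manifold_wf HM; have wE := manifold_wf HE; have wF := manifold_wf HF.
have Me : carrier (m := M) (pi e) by apply: spi.1.
have [c1 [a1 c1e uc1]] := unimodular_chart HM Heta Me; have i1 := wf_chart wM a1.
have [U [t [s [[mU Ue] st ss sK Ks]]]] := triv _ Me.
have Fe : carrier (m := F) (t e) by apply: st.1.
have [cF aF cFe] := wf_cover wF Fe; have iF := wf_chart wF aF.
pose cE : chart R (pt E) (m.+1 + n) := Chart
  [set e | [/\ carrier (m := E) e, U (pi e), chart_dom c1 (pi e) & chart_dom cF (t e)]]
  (fun e => row_mx (chart_map c1 (pi e)) (chart_map cF (t e)))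
  (fun y => s (chart_inv c1 (lsubmx y), chart_inv cF (rsubmx y))).
exists c1, cE; split; last by split.
have sE x f : U x -> chart_dom c1 x -> chart_dom cF f ->
    chart_dom cE (s (x, f)) /\ chart_map cE (s (x, f)) = row_mx (chart_map c1 x) (chart_map cF f).
  move=> Ux cx cf; have Ff := chart_dom_carrier iF cf.
  have [h1 h2] := Ks x f Ux Ff; rewrite /cE /= h1 h2; split=> //; split=> //.
  by apply: (ss.1 (x, f)).
have imE : chart_image cE = [set y | (chart_map c1 @` (U `&` chart_dom c1)) (lsubmx y) /\
    chart_image cF (rsubmx y)].
  apply/seteqP; split=> [_ [p [Ep Up cp cfp] <-]|y [[x [Ux cx] xl] [f cf fr]]].
    rewrite /= row_mxKl row_mxKr; split; first by exists (pi p).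
    exact: chart_map_image.
  have [h1 h2] := sE x f Ux cx cf.
  by exists (s (x, f)); rewrite // h2 xl fr hsubmxK.
have oU := mU.2 _ a1.
have oF : open (chart_image cF) by have [] := iF.
split=> //; last first.
  by move=> p [Ep Up cp cfp] /=; rewrite row_mxKl.
have aE : is_chart (X := E) cE.
  split; first by move=> p [].
    by rewrite imE; exact: open_sub_preimage.
  by move=> p [Ep Up cp cfp] /=; rewrite row_mxKl row_mxKr !chart_invK // sK.
apply: (mfd_maximal HE) => // c' a'; have i' := wf_chart wE a'.
split; rewrite /smooth_transition.
  have aP : atlas (m := prod_mfd M F) (prod_chart c1 cF) by exists c1, cF.
  have [oO cO] := ss.2 _ _ aP a'.
  set O1 := _ @` _ in oO cO.
  set D := _ @` _.
  suff -> : D = O1 by [].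
  apply/seteqP; split=> [_ [p [[Ep Up cp cfp] c'p] <-]|_ [[x f] [[/= Ux Ff] [/= cx cf] c'p] <-]].
    by exists (pi p, t p); split=> //=; rewrite ?sK //; split=> //; exact: chart_dom_carrier cfp.
  by have [h1 h2] := sE x f Ux cx cf; exists (s (x, f)).
have [oO1 cO1] := spi.2 _ _ a' a1; have [oO2 cO2] := st.2 _ _ a' aF.
set O1 := _ @` _ in oO1 cO1; set O2 := _ @` _ in oO2 cO2.
set D := _ @` _.
have DE : D = O1 `&` O2.
  apply/seteqP; split=> [_ [p [c'p [Ep Up cp cfp]] <-]|_ [[p [Ep c'p cp] <-] [q [[Eq Uq] c'q cfq] qp]]].
    by split; exists p.
  have pq : p = q by rewrite -(chart_invK i' c'p) -qp chart_invK.
  by exists p => //; split=> //; split=> //; rewrite pq.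
have oD : open D by rewrite DE; exact: openI.
split=> //.
by apply: (Cinf_row_mx oD); [apply: Cinf_sub cO1|apply: Cinf_sub cO2]; rewrite DE => y [].
Qed.

End AdaptedCharts.

(** * Jets of sections *)

Section LinearRepresentations.
Variable R : realType.

(** Bundle projections are linear in adapted charts; this gives their
    smoothness and their tangent maps together. *)
Lemma smooth_at_linear d e (X : mfd R d) (Y : mfd R e) (f : pt X -> pt Y) cX cY
    (C : 'M[R]_(d, e)) x : is_chart (X := X) cX -> chart_dom cX x ->
  (forall z, chart_dom cX z -> chart_dom cY (f z) /\
     chart_map cY (f z) = chart_map cX z *m C) ->
  smooth_at f cX cY x /\ 'J (rep f cX cY) (chart_map cX x) = C.
Proof.
move=> iX cx H; have oI : open (chart_image cX) by have [] := iX.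
have RE y : chart_image cX y -> rep f cX cY y = y *m C.
  by move=> [z cz <-]; rewrite rep_map // (H z cz).2.
have cL := Cinf_linmx C oI.
split.
  split=> //; exists (chart_image cX); split=> //; first exact: chart_map_image.
    by move=> y Iy; split=> //; have [h _] := chart_image_inv iX Iy; exact: (H _ h).1.
  by apply: Cinf_ext cL => // y /RE.
rewrite -[RHS](jacobian_linmx C (chart_map cX x)); apply: esym.
have Ix := chart_map_image cx.
apply: near_eq_jacobian; last exact: Cinf_diff cL Ix.
by apply: (near_open oI) => // y /RE.
Qed.

Lemma lsubmx_mul p q r (A : 'M[R]_(p, q + r)) : lsubmx A = A *m col_mx 1%:M 0.
Proof. by rewrite -{2}[A]hsubmxK mul_row_col mulmx1 mulmx0 addr0. Qed.

End LinearRepresentations.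

Section Jets.
Variables (R : realType) (m k : nat) (M : mfd R m) (P : mfd R (m + k)).
Variables (eta : pt M -> altform R m m) (rho : pt P -> pt M).
Hypotheses (wM : wf_mfd M) (wP : wf_mfd P).
Hypothesis cover : forall p, carrier (m := P) p ->
  exists cM cP, adapted eta rho cM cP /\ chart_dom cP p.

Lemma adapted_proj cM cP p : adapted eta rho cM cP -> chart_dom cP p ->
  smooth_at rho cP cM p /\
  'J (rep rho cP cM) (chart_map cP p) = col_mx 1%:M 0.
Proof.
move=> [aM aP _ H] cp; apply: smooth_at_linear => //; first exact: (wf_chart wP).
by move=> z /H[h1 h2]; split=> //; rewrite -lsubmx_mul.
Qed.

Lemma Tmap_proj cM cP p : adapted eta rho cM cP -> chart_dom cP p ->
  Tmap rho p *m dchart cM (rho p) = dchart cP p *m col_mx 1%:M 0.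
Proof.
move=> ad cp; have [s <-] := adapted_proj ad cp; have [aM aP _ _] := ad.
exact: Tmap_chart.
Qed.

(** The jet as a linear map, in the coordinate frames of M and P. Its right
    block holds the derivative coordinates; its left block is the identity, by
    [jet_setE]. *)
Definition jet_matrix (cM : chart R (pt M) m) (cP : chart R (pt P) (m + k))
    (z : pt P * 'M[R]_(m, m + k)) : 'M[R]_(m, m + k) :=
  invmx (dchart cM (rho z.1)) *m z.2 *m dchart cP z.1.

(** The condition that defines jets, that z.2 is a right inverse of the
    tangent map of rho, bears on the left block only, rho being the projection
    on the first coordinates. *)
Lemma jet_setE cM cP z : adapted eta rho cM cP -> chart_dom cP z.1 ->
  jet_set rho z <-> lsubmx (jet_matrix cM cP z) = 1%:M.
Proof.
move=> ad cz; have [aM aP _ H] := ad; have [cMz _] := H _ cz.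
have uM := dchart_unit wM aM cMz.
have Pz := chart_dom_carrier (wf_chart wP aP) cz.
have E : lsubmx (jet_matrix cM cP z) =
    invmx (dchart cM (rho z.1)) *m (z.2 *m Tmap rho z.1) *m dchart cM (rho z.1).
  by rewrite lsubmx_mul /jet_matrix -!mulmxA (Tmap_proj ad).
rewrite E; split=> [[_ ->]|]; first by rewrite mulmx1 mulVmx.
move=> /(congr1 (fun A => dchart cM (rho z.1) *m A *m invmx (dchart cM (rho z.1)))).
by rewrite !mulmxA mulmxV // mul1mx mulmx1 mulmxV // mulmxK //; split.
Qed.

Lemma jet_matrixE cM cP z : adapted eta rho cM cP -> chart_dom cP z.1 ->
  jet_set rho z -> jet_matrix cM cP z = row_mx 1%:M (rsubmx (jet_matrix cM cP z)).
Proof. by move=> ad cz /(jet_setE ad cz) <-; rewrite hsubmxK. Qed.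

Lemma jet_chart_mapE cM cP z : chart_map (jet_chart rho cM cP) z =
  row_mx (chart_map cP z.1) (mxvec (rsubmx (jet_matrix cM cP z))).
Proof. by []. Qed.

Lemma jet_chart_point cM cP y : adapted eta rho cM cP ->
  chart_image cP (lsubmx y) ->
  chart_dom (jet_chart rho cM cP) (chart_inv (jet_chart rho cM cP) y) /\
  chart_map (jet_chart rho cM cP) (chart_inv (jet_chart rho cM cP) y) = y.
Proof.
move=> ad Iy; have [aM aP _ H] := ad.
have [cp pE] := chart_image_inv (wf_chart wP aP) Iy.
set z := chart_inv (jet_chart rho cM cP) y.
have z1 : z.1 = chart_inv cP (lsubmx y) by [].
have cz : chart_dom cP z.1 by rewrite z1.
have [cMz _] := H _ cz.
have jE : jet_matrix cM cP z = row_mx 1%:M (vec_mx (rsubmx y)).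
  rewrite /jet_matrix /z /= -!mulmxA mulVmx ?mulmx1; last exact: dchart_unit.
  by rewrite mulmxA mulVmx ?mul1mx //; exact: dchart_unit.
split.
  by split=> //; apply/(jet_setE ad cz); rewrite jE row_mxKl.
by rewrite jet_chart_mapE jE row_mxKr vec_mxK z1 pE hsubmxK.
Qed.

Lemma jet_chart_imageE cM cP y : adapted eta rho cM cP ->
  chart_image (jet_chart rho cM cP) y <-> chart_image cP (lsubmx y).
Proof.
move=> ad; split=> [[z [_ cz] <-]|Iy].
  by rewrite jet_chart_mapE row_mxKl; exact: chart_map_image.
have [h1 h2] := jet_chart_point ad Iy.
by exists (chart_inv (jet_chart rho cM cP) y).
Qed.

Lemma jet_chart_invK cM cP z : adapted eta rho cM cP ->
  chart_dom (jet_chart rho cM cP) z ->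
  chart_inv (jet_chart rho cM cP) (chart_map (jet_chart rho cM cP) z) = z.
Proof.
move=> ad [jz cz]; have [aM aP _ H] := ad; have [cMz _] := H _ cz.
rewrite jet_chart_mapE /= row_mxKl row_mxKr mxvecK.
rewrite chart_invK //; last exact: (wf_chart wP).
rewrite -(jet_matrixE ad cz jz) /jet_matrix -!mulmxA mulmxV ?mulmx1; last exact: dchart_unit.
by rewrite mulmxA mulmxV ?mul1mx //; [case: z jz cz cMz|exact: dchart_unit].
Qed.

Lemma jet_is_chart cM cP : adapted eta rho cM cP ->
  is_chart (X := jet_mfd eta rho) (jet_chart rho cM cP).
Proof.
move=> ad; have [aM aP _ H] := ad.
split; first by move=> z [].
  have -> : chart_image (jet_chart rho cM cP) =
      [set y | chart_image cP (lsubmx y) /\ setT (rsubmx y)].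
    by apply/seteqP; split=> y; [move=> /(jet_chart_imageE _ ad)|move=> [h _]; apply/(jet_chart_imageE _ ad)].
  by apply: open_sub_preimage; [have [] := wf_chart wP aP|exact: openT].
by move=> z; exact: jet_chart_invK.
Qed.

(** The prolonged change of coordinates: the matrix of a jet is multiplied by
    the Jacobian of the change of coordinates of P on the right, and by that
    of the inverse change of coordinates of M on the left. *)
Definition jet_change (cM cM' : chart R (pt M) m) (cP cP' : chart R (pt P) (m + k))
    (y : 'rV[R]_(m + k + m * k)) :=
  let p := tr cP cP' (lsubmx y) in
  row_mx p (mxvec (rsubmx ('J (tr cM' cM) (lsubmx p)
    *m row_mx 1%:M (vec_mx (rsubmx y)) *m 'J (tr cP cP') (lsubmx y)))).

Lemma jet_changeE cM cM' cP cP' z :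
  adapted eta rho cM cP -> adapted eta rho cM' cP' ->
  chart_dom (jet_chart rho cM cP) z -> chart_dom cP' z.1 ->
  chart_map (jet_chart rho cM' cP') z =
  jet_change cM cM' cP cP' (chart_map (jet_chart rho cM cP) z).
Proof.
move=> ad ad' [jz cz] c'z; have [aM aP _ H] := ad; have [aM' aP' _ H'] := ad'.
have [cMz _] := H _ cz; have [cMz' l'] := H' _ c'z.
have uM := dchart_unit wM aM cMz; have uP := dchart_unit wP aP cz.
apply: (etrans (jet_chart_mapE cM' cP' z)); rewrite /jet_change.
set y := chart_map (jet_chart rho cM cP) z.
have -> : lsubmx y = chart_map cP z.1 by exact: row_mxKl.
have -> : vec_mx (rsubmx y) = rsubmx (jet_matrix cM cP z).
  by apply: (etrans _ (mxvecK _)); congr vec_mx; exact: row_mxKr.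
have -> : tr cP cP' (chart_map cP z.1) = chart_map cP' z.1 by exact: tr_map.
have e1 := dchart_tr_inv wM aM' aM cMz' cMz.
have e2 := dchart_tr_inv wP aP aP' cz c'z.
rewrite l' -(jet_matrixE ad cz jz) -e1 -e2 /jet_matrix.
congr (row_mx _ (mxvec (rsubmx _))).
by rewrite !mulmxA (mulmxK uM) (mulmxK uP).
Qed.

Lemma jet_smooth_transition cM cM' cP cP' :
  adapted eta rho cM cP -> adapted eta rho cM' cP' ->
  smooth_transition (jet_chart rho cM cP) (jet_chart rho cM' cP').
Proof.
move=> ad ad'; have [aM aP _ H] := ad; have [aM' aP' _ H'] := ad'.
rewrite /smooth_transition; set D := _ @` _.
have DE : D = [set y | overlap cP cP' (lsubmx y) /\ setT (rsubmx y)].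
  apply/seteqP; split=> [_ [z [[jz cz] [_ c'z]] <-]|y [/= [p [cp c'p] py] _]].
    by split=> //; rewrite jet_chart_mapE row_mxKl; exact: overlap_map.
  have Iy : chart_image cP (lsubmx y) by rewrite -py; exact: chart_map_image.
  have [[jz cz] h2] := jet_chart_point ad Iy.
  exists (chart_inv (jet_chart rho cM cP) y) => //; split=> //; split=> //.
  by rewrite /= -py chart_invK //; exact: (wf_chart wP).
have oO := open_overlap wP aP aP'.
have oD : open D by rewrite DE; apply: open_sub_preimage => //; exact: openT.
have Dl y : D y -> overlap cP cP' (lsubmx y) by rewrite DE => -[].
split=> //.
suff ce : Cinf D (jet_change cM cM' cP cP').
  apply: (Cinf_ext oD _ ce) => _ [z [cz [_ c'z]] <-].
  apply: (etrans _ (esym (congr1 (chart_map (jet_chart rho cM' cP')) (jet_chart_invK ad cz)))).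
  by apply: esym; exact: (jet_changeE ad ad').
have cl := Cinf_lsubmx oD (Cinf_id D).
have cr := Cinf_rsubmx oD (Cinf_id D).
have cp : Cinf D (fun y => tr cP cP' (lsubmx y)).
  exact: (Cinf_comp_mx oD oO Dl cl (Cinf_tr wP aP aP')).
have clp := Cinf_lsubmx oD cp.
have oO' := open_overlap wM aM' aM.
have Dm y : D y -> overlap cM' cM (lsubmx (tr cP cP' (lsubmx y))).
  move=> /Dl[p [cp' c'p] <-]; rewrite tr_map //.
  by have [h1 ->] := H' _ c'p; apply: overlap_map => //; have [] := H _ cp'.
apply: (Cinf_row_mx oD) => //; apply: (Cinf_mxvec oD); apply: (Cinf_rsubmx oD).
apply: Cinf_mulmx => //; first apply: Cinf_mulmx => //.
- apply: (Cinf_comp_mx oD oO' Dm clp (g := fun y => 'J (tr cM' cM) y)).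
  by apply: Cinf_jacobian => //; exact: Cinf_tr.
- by apply: (Cinf_row_mx oD); [exact: Cinf_cst|exact: Cinf_vec_mx].
- apply: (Cinf_comp_mx oD oO Dl cl (g := fun y => 'J (tr cP cP') y)).
  by apply: Cinf_jacobian => //; exact: Cinf_tr.
Qed.

(** Applied both to E, giving J^1 pi, and to the bundle of momenta, giving J^1
    (pi o nu). *)
Lemma jet_wf : wf_mfd (jet_mfd eta rho).
Proof.
split.
- by move=> c [cM [cP [ad ->]]]; exact: jet_is_chart.
- move=> z jz; have [cM [cP [ad cp]]] := cover jz.1.
  by exists (jet_chart rho cM cP); [exists cM, cP|split].
- by move=> c c' [cM [cP [ad ->]]] [cM' [cP' [ad' ->]]]; exact: jet_smooth_transition.
Qed.

Section JetsOfSections.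
Variables (U : set (pt M)) (s : pt M -> pt P) (cM : chart R (pt M) m)
  (cP : chart R (pt P) (m + k)).
Hypothesis ls : local_section rho U s.
Hypothesis ad : adapted eta rho cM cP.

Lemma section_smooth_at x : U x -> chart_dom cP (s x) -> smooth_at s cM cP x.
Proof.
move=> Ux cx; have [aM aP _ H] := ad; have [_ ss rs] := ls.
have [cMx _] := H _ cx; rewrite rs // in cMx.
by apply: (smooth_map_at (wf_chart wM aM) aM aP ss Ux).
Qed.

Lemma section_dom x : U x -> chart_dom cP (s x) -> chart_dom cM x.
Proof. by move=> Ux cx; have [_ _ _ H] := ad; have [_ _ rs] := ls; have [] := H _ cx; rewrite rs. Qed.

Lemma section_lsub x : U x -> chart_dom cP (s x) ->
  lsubmx (chart_map cP (s x)) = chart_map cM x.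
Proof. by move=> Ux cx; have [_ _ _ H] := ad; have [_ _ rs] := ls; have [_ ->] := H _ cx; rewrite rs. Qed.

(** Provides, around a point, an open set of coordinates on which a section
    stays in the given chart: equations between sections are differentiated on
    such sets. *)
Lemma section_rep x : U x -> chart_dom cP (s x) -> exists Q,
  [/\ open Q, Q (chart_map cM x), Cinf Q (rep s cM cP) &
      forall y, Q y -> exists x', [/\ U x', chart_dom cP (s x'), chart_map cM x' = y &
        chart_inv cM y = x']].
Proof.
move=> Ux cx; have [aM aP _ H] := ad; have [mU ss rs] := ls.
have [_ [Q [oO Ox HO cO]]] := section_smooth_at Ux cx.
have cMx := section_dom Ux cx; have iM := wf_chart wM aM.
have oU := mU.2 _ aM.
exists (Q `&` chart_map cM @` (U `&` chart_dom cM)); split.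
- exact: openI.
- by split=> //; exists x.
- by apply: Cinf_sub cO => y [].
- move=> y [/HO[_ h] [x' [Ux' cx'] xy]]; exists x'.
  by move: h; rewrite -xy chart_invK.
Qed.

Lemma jet_matrix_section x : U x -> chart_dom cP (s x) ->
  jet_matrix cM cP (j1 s x) = 'J (rep s cM cP) (chart_map cM x).
Proof.
move=> Ux cx; have [aM aP _ H] := ad; have [_ _ rs] := ls.
by rewrite /jet_matrix /= rs //; apply: Tmap_chart_inv => //; exact: section_smooth_at.
Qed.

(** The left block of the Jacobian of a section is the identity, since the
    first coordinates of s x are those of x. *)
Lemma jet_section x : U x -> chart_dom cP (s x) ->
  chart_dom (jet_chart rho cM cP) (j1 s x).
Proof.
move=> Ux cx; split=> //; apply: (jet_setE (z := j1 s x) ad cx).2.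
rewrite jet_matrix_section //; apply/matrixP => i j; have [aM aP _ H] := ad.
have [Q [oO Ox cO HO]] := section_rep Ux cx.
rewrite mxE jacobian_entry; last exact: Cinf_diff cO Ox.
rewrite (near_eq_derive (g := fun y : 'rV[R]_m => y 0 j)); last first.
  apply: (near_open oO) => // y /HO[x' [Ux' cx' <- E]].
  rewrite rep_map //; [|exact: (wf_chart wM aM)|exact: section_dom].
  by rewrite -(section_lsub Ux' cx') mxE.
by rewrite derive_coord mxE eqxx mxE eq_sym.
Qed.

Lemma jet_section_map x : U x -> chart_dom cP (s x) ->
  chart_map (jet_chart rho cM cP) (j1 s x) =
  row_mx (chart_map cP (s x)) (mxvec (rsubmx ('J (rep s cM cP) (chart_map cM x)))).
Proof. by move=> Ux cx; rewrite jet_chart_mapE jet_matrix_section. Qed.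

Lemma jet_section_smooth x : U x -> chart_dom cP (s x) ->
  smooth_at (Y := jet_mfd eta rho) (j1 s) cM (jet_chart rho cM cP) x.
Proof.
move=> Ux cx; have [Q [oO Ox cO HO]] := section_rep Ux cx.
have [aM aP _ H] := ad.
split; first exact: section_dom.
exists Q; split=> //.
  move=> y /HO[x' [Ux' cx' <- ->]]; split; last exact: jet_section.
  by apply: chart_map_image; exact: section_dom.
apply: (Cinf_ext (f := fun y => row_mx (rep s cM cP y) (mxvec (rsubmx ('J (rep s cM cP) y))))) => //.
  move=> y /HO[x' [Ux' cx' <- E]].
  rewrite !rep_map; [|exact: (wf_chart wM)|exact: section_dom|exact: (wf_chart wM)|exact: section_dom].
  by rewrite jet_section_map.
apply: (Cinf_row_mx oO) => //; apply: (Cinf_mxvec oO); apply: (Cinf_rsubmx oO).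
exact: Cinf_jacobian.
Qed.

(** Differential equations for a section become algebraic equations on the
    coordinates of its jet. *)
Lemma jet_section_der x i b : U x -> chart_dom cP (s x) ->
  chart_map (jet_chart rho cM cP) (j1 s x) 0 (jder i b) =
  pderiv cM i (fun x => chart_map cP (s x) 0 (rshift m b)) x.
Proof.
move=> Ux cx; rewrite jet_section_map // /jder row_mxEr mxvecE mxE.
have [Q [oO Ox cO HO]] := section_rep Ux cx.
by rewrite jacobian_entry //; exact: Cinf_diff cO Ox.
Qed.

End JetsOfSections.

End Jets.

(** * The bundle of momenta *)

Section SelectionMatrices.
Variables (R : realType) (m n : nat).

(** The columns of Cbase are dx^1, ..., dx^m. In Csel i a the column dx^i is
    replaced by du^a, so that det (V *m Csel i a) is du^a /\ d^(m-1)x_i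
    evaluated on the rows of V. *)
Definition Cbase : 'M[R]_(m.+1 + n, m.+1) := col_mx 1%:M 0.
Definition Csel (i : 'I_m.+1) (a : 'I_n) : 'M[R]_(m.+1 + n, m.+1) :=
  \matrix_(l, j) (if j == i then l == rshift m.+1 a else l == lshift n j)%:R.

Lemma det_col0 d (A : 'M[R]_d) i : (forall j, A j i = 0) -> \det A = 0.
Proof.
by move=> A0; rewrite (expand_det_col A i) big1 // => j _; rewrite A0 mul0r.
Qed.

Lemma det_row0 d (A : 'M[R]_d) i : (forall j, A i j = 0) -> \det A = 0.
Proof.
by move=> A0; rewrite (expand_det_row A i) big1 // => j _; rewrite A0 mul0r.
Qed.

Lemma mul_Cbase p (V : 'M[R]_(p, m.+1 + n)) : V *m Cbase = lsubmx V.
Proof. by rewrite [RHS]lsubmx_mul. Qed.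

Lemma mul_Csel p (V : 'M[R]_(p, m.+1 + n)) i a j l :
  (V *m Csel i a) j l = if l == i then V j (rshift m.+1 a) else V j (lshift n l).
Proof.
rewrite mxE; under eq_bigr do rewrite mxE.
case: ifP => _.
  rewrite (bigD1 (rshift m.+1 a)) //= eqxx mulr1 big1 ?addr0 // => b /negbTE ->.
  by rewrite mulr0.
rewrite (bigD1 (lshift n l)) //= eqxx mulr1 big1 ?addr0 // => b /negbTE ->.
by rewrite mulr0.
Qed.

Lemma htupleE j b : htuple R m.+1 n j b = (b == lshift n j)%:R.
Proof. by rewrite !mxE eqxx. Qed.

Lemma vtupleE i a j b : vtuple R (m := m.+1) (n := n) i a j b =
  (b == if j == i then rshift m.+1 a else lshift n j)%:R.
Proof. by rewrite !mxE; case: ifP => _; rewrite mxE eqxx. Qed.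

Lemma det_htuple_Cbase : \det (htuple R m.+1 n *m Cbase) = 1.
Proof.
rewrite mul_Cbase (_ : lsubmx _ = 1%:M) ?det1 //.
by apply/matrixP => i j; rewrite mxE htupleE mxE eq_lshift eq_sym.
Qed.

Lemma det_htuple_Csel i a : \det (htuple R m.+1 n *m Csel i a) = 0.
Proof.
by apply: (@det_col0 _ _ i) => j; rewrite mul_Csel eqxx htupleE eq_rlshift.
Qed.

Lemma det_vtuple_Cbase i a : \det (vtuple R i a *m Cbase) = 0.
Proof.
apply: (@det_row0 _ _ i) => j.
by rewrite mul_Cbase mxE vtupleE eqxx eq_lrshift.
Qed.

Lemma det_vtuple_Csel i a i' a' :
  \det (vtuple R i a *m Csel i' a') = ((i == i') && (a == a'))%:R.
Proof.
have [<-|ii'] := eqVneq i i'; last first.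
  apply: (@det_col0 _ _ i) => j; rewrite mul_Csel (negbTE ii') vtupleE.
  have [_|ji] := eqVneq j i; first by rewrite eq_lrshift.
  by rewrite eq_lshift eq_sym (negbTE ji).
rewrite (_ : _ *m _ = diag_mx (\row_j if j == i then (a == a')%:R else 1)).
  rewrite det_diag (bigD1 i) //= mxE eqxx big1 ?mulr1 // => j /negbTE ji.
  by rewrite mxE ji.
apply/matrixP => j l; rewrite mul_Csel !vtupleE mxE mxE.
have [->|li] := eqVneq l i.
  have [_|ji] := eqVneq j i; first by rewrite eq_rshift mulr1n eq_sym.
  by rewrite eq_rlshift.
have [ji|ji] := eqVneq j i.
  by rewrite eq_lrshift ji [i == l]eq_sym (negbTE li).
by rewrite eq_lshift eq_sym; case: eqP => _; rewrite ?mulr1n ?mulr0n.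
Qed.

Lemma det_Cbase_vertical (V : 'M[R]_(m.+1, m.+1 + n)) i :
  (forall l, V i (lshift n l) = 0) -> \det (V *m Cbase) = 0.
Proof. by move=> V0; apply: (@det_row0 _ _ i) => j; rewrite mul_Cbase mxE. Qed.

Lemma det_Csel_vertical (V : 'M[R]_(m.+1, m.+1 + n)) i j i' a' : i != j ->
  (forall l, V i (lshift n l) = 0) -> (forall l, V j (lshift n l) = 0) ->
  \det (V *m Csel i' a') = 0.
Proof.
move=> ij Vi Vj; rewrite (expand_det_row _ i) big1 // => l _.
rewrite mul_Csel; case: eqP => [->|_]; last by rewrite Vi mul0r.
have [j' jE _] := unlift_some ij.
rewrite /cofactor (@det_row0 _ (row' i _) j') ?mulr0 // => b.
rewrite !mxE -jE; have := mul_Csel V i' a' j (lift i' b); rewrite mxE => ->.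
by rewrite eq_sym (negbTE (neq_lift _ _)).
Qed.

(** The coordinate expression of a multimomentum form, with determinants in
    place of wedge products and contractions. *)
Definition mform (p : R) (q : 'M[R]_(m.+1, n)) (V : 'M[R]_(m.+1, m.+1 + n)) : R :=
  p * \det (V *m Cbase) + \sum_i \sum_a q i a * \det (V *m Csel i a).

Lemma mform_alt p q : is_altform (mform p q : altform R m.+1 (m.+1 + n)).
Proof.
rewrite (_ : mform p q = fun V => p * \det (V *m Cbase) +
   1 * \sum_i 1 * \sum_a q i a * \det (V *m Csel i a)).
  apply: (@altD _ _ _ (fun V => \det (V *m Cbase))
     (fun V => \sum_i 1 * \sum_a q i a * \det (V *m Csel i a))).
    exact: alt_det_mul.
  apply: (@alt_sum _ _ _ _ _ _ (fun i V => \sum_a q i a * \det (V *m Csel i a))) => i.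
  by apply: (@alt_sum _ _ _ _ _ _ (fun a V => \det (V *m Csel i a))) => a; exact: alt_det_mul.
apply/funext => V; rewrite /mform mul1r; congr (_ + _).
by apply: eq_bigr => i _; rewrite mul1r.
Qed.

Lemma mform_htuple p q : mform p q (htuple R m.+1 n) = p.
Proof.
rewrite /mform det_htuple_Cbase mulr1 big1 ?addr0 // => i _.
by rewrite big1 // => a _; rewrite det_htuple_Csel mulr0.
Qed.

Lemma mform_vtuple p q i a : mform p q (vtuple R i a) = q i a.
Proof.
rewrite /mform det_vtuple_Cbase mulr0 add0r (bigD1 i) //= (bigD1 a) //=.
rewrite det_vtuple_Csel !eqxx mulr1 big1 ?addr0; last first.
  by move=> b /negbTE ba; rewrite det_vtuple_Csel eqxx eq_sym ba mulr0.
rewrite big1 ?addr0 // => j /negbTE ji; rewrite big1 // => b _.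
by rewrite det_vtuple_Csel eq_sym ji mulr0.
Qed.

Lemma mform_vertical p q (V : 'M[R]_(m.+1, m.+1 + n)) i j : i != j ->
  (forall l, V i (lshift n l) = 0) -> (forall l, V j (lshift n l) = 0) ->
  mform p q V = 0.
Proof.
move=> ij Vi Vj; rewrite /mform (det_Cbase_vertical Vi) mulr0 add0r.
rewrite big1 // => i' _; rewrite big1 // => a' _.
by rewrite (det_Csel_vertical _ _ ij Vi Vj) mulr0.
Qed.

(** The cofactor expansion along the column of du^a, which is the definition
    of du^a /\ d^(m-1)x_i by a wedge product and a contraction. *)
Lemma wedge_Csel (V : 'M[R]_(m.+1, m.+1 + n)) i a :
  \det (V *m Csel i a) = \sum_(j < m.+1) (-1) ^+ j * V j (rshift m.+1 a) *
    \det (col_mx (delta_mx 0 i) (lsubmx (row' j V)) : 'M[R]_(1 + m)).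
Proof.
rewrite (expand_det_col _ i); apply: eq_bigr => j _.
rewrite mul_Csel eqxx -[RHS]mulrA [RHS]mulrCA; congr (_ * _).
rewrite /cofactor exprD -mulrA; congr (_ * _).
set C : 'M[R]_(1 + m) := col_mx _ _.
have Cu l : C 0 l = (l == i)%:R.
  have -> : (0 : 'I_(1 + m)) = lshift m 0 by exact: val_inj.
  by rewrite [LHS]col_mxEu mxE eqxx.
have Cd b l : C (lift 0 b) l = V (lift j b) (lshift n l).
  have -> : lift (0 : 'I_(1 + m)) b = rshift 1 b by exact: val_inj.
  by rewrite [LHS]col_mxEd !mxE.
clearbody C; rewrite (expand_det_row _ 0) (bigD1 i) //= big1 ?addr0; last first.
  by move=> l /negbTE li; rewrite Cu li mul0r.
rewrite Cu eqxx mul1r /cofactor add0n; congr (_ * \det _).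
apply/matrixP => b c; rewrite mxE mxE mul_Csel eq_sym (negbTE (neq_lift _ _)).
by rewrite mxE mxE Cd.
Qed.

End SelectionMatrices.

Section MultimomentumBundle.
Variables (R : realType) (m n : nat) (M : mfd R m.+1) (E : mfd R (m.+1 + n)).
Variables (pi : pt E -> pt M) (eta : pt M -> altform R m.+1 m.+1).
Hypotheses (wM : wf_mfd M) (wE : wf_mfd E).
Hypothesis cover : forall e, carrier (m := E) e ->
  exists cM cE, adapted eta pi cM cE /\ chart_dom cE e.

Lemma coord_volume_lshift (cE : chart R (pt E) (m.+1 + n)) e V :
  coord_volume cE (@lshift m.+1 n) e V = \det (V *m dchart cE e *m Cbase R m n).
Proof.
rewrite mul_Cbase; congr (\det _); apply/matrixP => i j.
by rewrite !mxE /dcoord mxE; apply: eq_bigr => k _; rewrite mxE.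
Qed.

Lemma multimomentumE cE e p q V : atlas (m := E) cE -> chart_dom cE e ->
  multimomentum cE e p q V = mform p q (V *m dchart cE e).
Proof.
move=> aE ce; have uE := dchart_unit wE aE ce.
rewrite /multimomentum /mform coord_volume_lshift; congr (_ + _).
apply: eq_bigr => i _; apply: eq_bigr => a _; congr (_ * _).
rewrite wedge_Csel; apply: eq_bigr => j _; congr (_ * _ * _).
  by rewrite /dcoord -row_mul mxE.
rewrite /Defs.contract coord_volume_lshift mul_Cbase; congr (\det _).
have F (v : 'rV[R]_(m.+1 + n)) (W : 'M[R]_(m, m.+1 + n)) (B : 'M[R]_(m.+1 + n)) :
    lsubmx ((col_mx v W : 'M[R]_(1 + m, m.+1 + n)) *m B) =
    (col_mx (lsubmx (v *m B)) (lsubmx (W *m B)) : 'M[R]_(1 + m, m.+1)).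
  rewrite mul_col_mx; apply/matrixP => b c; rewrite mxE.
  by case: (split_ordP b) => b' ->; rewrite ?col_mxEu ?col_mxEd !mxE.
apply: (etrans (F _ _ _)); rewrite row'_mul /coord_vec -row_mul mulVmx //.
congr col_mx; apply/rowP => c; rewrite !mxE eqxx /=.
by rewrite eq_lshift eq_sym.
Qed.

Lemma verticalE cM cE e v : adapted eta pi cM cE -> chart_dom cE e ->
  vertical pi e v <-> lsubmx (v *m dchart cE e) = 0.
Proof.
move=> ad ce; have [aM aE _ H] := ad; have [cm _] := H _ ce.
have uM := dchart_unit wM aM cm.
rewrite lsubmx_mul -mulmxA -(Tmap_proj wM wE ad ce) mulmxA /vertical /=.
split=> [->|]; first by rewrite mul0mx.
by move=> /(congr1 (mulmx^~ (invmx (dchart cM (pi e))))); rewrite mulmxK // mul0mx.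
Qed.

Lemma dx_tuple cE e : atlas (m := E) cE -> chart_dom cE e ->
  (\matrix_(j < m.+1) coord_vec cE e (lshift n j)) *m dchart cE e = htuple R m.+1 n.
Proof.
move=> aE ce; apply/row_matrixP => j; rewrite row_mul !rowK /coord_vec.
by rewrite -row_mul mulVmx ?row1 //; exact: dchart_unit.
Qed.

Lemma du_tuple cE e i a : atlas (m := E) cE -> chart_dom cE e ->
  (\matrix_(j < m.+1) if j == i then coord_vec cE e (rshift m.+1 a)
     else coord_vec cE e (lshift n j)) *m dchart cE e = vtuple R i a.
Proof.
move=> aE ce; apply/row_matrixP => j; rewrite row_mul !rowK /coord_vec.
by case: ifP => _; rewrite -row_mul mulVmx ?row1 //; exact: dchart_unit.
Qed.

Definition mm_p (cE : chart R (pt E) (m.+1 + n)) (z : pt E * altform R m.+1 (m.+1 + n)) : R :=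
  z.2 (\matrix_j coord_vec cE z.1 (lshift n j)).
Definition mm_q (cE : chart R (pt E) (m.+1 + n)) (z : pt E * altform R m.+1 (m.+1 + n)) :
    'M[R]_(m.+1, n) :=
  \matrix_(i, a) z.2 (\matrix_j if j == i then coord_vec cE z.1 (rshift m.+1 a)
     else coord_vec cE z.1 (lshift n j)).

Lemma mm_mapE cE z : chart_map (mm_chart pi cE) z =
  row_mx (lsubmx (chart_map cE z.1)) (row_mx (rsubmx (chart_map cE z.1))
    (row_mx (mm_p cE z)%:M (mxvec (mm_q cE z)))).
Proof. by []. Qed.

Lemma multimomentum_Lambda cM cE e p q : adapted eta pi cM cE -> chart_dom cE e ->
  Lambda 2 pi (e, multimomentum cE e p q).
Proof.
move=> ad ce; have [aM aE _ H] := ad.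
have mE : multimomentum cE e p q = fun V => mform p q (V *m dchart cE e).
  by apply/funext => V; exact: multimomentumE.
split=> /=; first exact: chart_dom_carrier (wf_chart wE aE) ce.
  by rewrite mE; apply: alt_mulmx; exact: mform_alt.
move=> A S S2 vS; rewrite mE.
have /card_gt1P[i [j [iS jS ij]]] := S2.
have z0 l : l \in S -> forall b, (A *m dchart cE e) l (lshift n b) = 0.
  move=> lS b; have := (verticalE _ ad ce).1 (vS _ lS).
  by rewrite -row_mul => /rowP/(_ b); rewrite !mxE.
exact: (mform_vertical _ _ ij (z0 _ iS) (z0 _ jS)).
Qed.

Lemma mm_p_multimomentum cM cE e p q : adapted eta pi cM cE -> chart_dom cE e ->
  mm_p cE (e, multimomentum cE e p q) = p.
Proof.
move=> [aM aE _ H] ce; rewrite /mm_p /= multimomentumE // dx_tuple //.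
exact: mform_htuple.
Qed.

Lemma mm_q_multimomentum cM cE e p q : adapted eta pi cM cE -> chart_dom cE e ->
  mm_q cE (e, multimomentum cE e p q) = q.
Proof.
move=> [aM aE _ H] ce; apply/matrixP => i a.
by rewrite mxE /= multimomentumE // du_tuple // mform_vtuple.
Qed.

(** The difference of the two sides is annihilated by two vertical vectors and
    has zero momenta, so [alt_semibasic_eq0] applies. Hence p and p^i_a are
    coordinates on the fibres of the bundle. *)
Lemma Lambda_mform cM cE z V : adapted eta pi cM cE -> chart_dom cE z.1 ->
  Lambda 2 pi z -> z.2 V = mform (mm_p cE z) (mm_q cE z) (V *m dchart cE z.1).
Proof.
move=> ad cz [Ez az vz]; have [aM aE _ H] := ad.
have uE := dchart_unit wE aE cz.
set B := dchart cE z.1 in uE *.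
pose D (W : 'M[R]_(m.+1, m.+1 + n)) :=
  1 * z.2 (W *m invmx B) + (-1) * mform (mm_p cE z) (mm_q cE z) W.
have aD : is_altform (D : altform R m.+1 (m.+1 + n)).
  apply: (@altD _ _ _ (fun W => z.2 (W *m invmx B)) (mform (mm_p cE z) (mm_q cE z))).
    exact: alt_mulmx.
  exact: mform_alt.
suff D0 W : D W = 0.
  have := D0 (V *m B); rewrite /D mulmxK // mul1r mulN1r => /eqP.
  by rewrite subr_eq0 => /eqP.
apply: (alt_semibasic_eq0 aD).
- move=> A i j ij Ai Aj; have Zi l : A i (lshift n l) = 0.
    by have /rowP/(_ l) := Ai; rewrite !mxE.
  have Zj l : A j (lshift n l) = 0 by have /rowP/(_ l) := Aj; rewrite !mxE.
  rewrite /D (mform_vertical _ _ ij Zi Zj) mulr0 addr0 mul1r.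
  apply: (vz _ [set i; j]%SET); first by rewrite cards2 ij.
  move=> l; rewrite !inE => /orP[]/eqP ->; apply/(verticalE _ ad cz);
    by rewrite row_mul -mulmxA mulVmx // mulmx1.
- rewrite /D mform_htuple -(dx_tuple aE cz) -/B mulmxK // /mm_p.
  by rewrite mul1r mulN1r subrr.
- move=> i a; rewrite /D mform_vtuple -(du_tuple i a aE cz) -/B mulmxK // /mm_q mxE.
  by rewrite mul1r mulN1r subrr.
Qed.

Definition mm_base (y : 'rV[R]_(m.+1 + dimMf m n)) : 'rV[R]_(m.+1 + n) :=
  row_mx (lsubmx y) (lsubmx (rsubmx y)).
Definition mm_cp (y : 'rV[R]_(m.+1 + dimMf m n)) : R := y 0 (rshift m.+1 (fp m n)).
Definition mm_cq (y : 'rV[R]_(m.+1 + dimMf m n)) : 'M[R]_(m.+1, n) :=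
  vec_mx (rsubmx (rsubmx (rsubmx y))).

Lemma mm_coordsK y : row_mx (lsubmx (mm_base y)) (row_mx (rsubmx (mm_base y))
    (row_mx (mm_cp y)%:M (mxvec (mm_cq y)))) = y.
Proof.
rewrite /mm_base row_mxKl row_mxKr /mm_cq vec_mxK.
have -> : (mm_cp y)%:M = lsubmx (rsubmx (rsubmx y)).
  apply/rowP => i; rewrite !ord1 !mxE eqxx mulr1n /mm_cp /fp.
  by congr (y 0 (rshift _ (rshift _ (lshift _ _)))).
by rewrite !hsubmxK.
Qed.

Lemma mm_base_map cE z : mm_base (chart_map (mm_chart pi cE) z) = chart_map cE z.1.
Proof. by rewrite mm_mapE /mm_base row_mxKl row_mxKr row_mxKl hsubmxK. Qed.

Lemma mm_cp_map cE z : mm_cp (chart_map (mm_chart pi cE) z) = mm_p cE z.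
Proof.
rewrite mm_mapE /mm_cp /fp row_mxEr row_mxEr row_mxEl mxE.
by rewrite eqxx mulr1n.
Qed.

Lemma mm_cq_map cE z : mm_cq (chart_map (mm_chart pi cE) z) = mm_q cE z.
Proof. by rewrite mm_mapE /mm_cq !row_mxKr mxvecK. Qed.

Lemma mm_invE cE y : chart_inv (mm_chart pi cE) y =
  (chart_inv cE (mm_base y), multimomentum cE (chart_inv cE (mm_base y)) (mm_cp y) (mm_cq y)).
Proof. by []. Qed.

Lemma mm_chart_point cM cE y : adapted eta pi cM cE -> chart_image cE (mm_base y) ->
  chart_dom (mm_chart pi cE) (chart_inv (mm_chart pi cE) y) /\
  chart_map (mm_chart pi cE) (chart_inv (mm_chart pi cE) y) = y.
Proof.
move=> ad Iy; have [aM aE _ H] := ad.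
have [ce eE] := chart_image_inv (wf_chart wE aE) Iy.
split.
  by split=> //; exact: multimomentum_Lambda ad ce.
apply: (etrans (mm_mapE _ _)).
rewrite mm_invE (mm_p_multimomentum _ _ ad ce) (mm_q_multimomentum _ _ ad ce) /= eE.
exact: mm_coordsK.
Qed.

Lemma mm_chart_imageE cM cE y : adapted eta pi cM cE ->
  chart_image (mm_chart pi cE) y <-> chart_image cE (mm_base y).
Proof.
move=> ad; split=> [[z [_ cz] <-]|Iy].
  by rewrite mm_base_map; exact: chart_map_image.
have [h1 h2] := mm_chart_point ad Iy.
by exists (chart_inv (mm_chart pi cE) y).
Qed.

Lemma mm_chart_invK cM cE z : adapted eta pi cM cE ->
  chart_dom (mm_chart pi cE) z ->
  chart_inv (mm_chart pi cE) (chart_map (mm_chart pi cE) z) = z.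
Proof.
move=> ad [Lz cz]; have [aM aE _ H] := ad.
rewrite mm_invE mm_base_map mm_cp_map mm_cq_map.
have -> : chart_inv cE (chart_map cE z.1) = z.1 by apply: chart_invK => //; exact: (wf_chart wE).
have -> : multimomentum cE z.1 (mm_p cE z) (mm_q cE z) = z.2; last by case: (z).
apply/funext => V; rewrite multimomentumE //; apply: esym; exact: (Lambda_mform _ ad cz Lz).
Qed.

Lemma Cinf_mm_base (U : set 'rV[R]_(m.+1 + dimMf m n)) : open U -> Cinf U mm_base.
Proof.
move=> oU; have cI := Cinf_id U.
apply: (Cinf_row_mx oU); first exact: Cinf_lsubmx.
by apply: (Cinf_lsubmx oU); exact: Cinf_rsubmx.
Qed.

Lemma mm_is_chart cM cE : adapted eta pi cM cE ->
  is_chart (X := Mpi eta pi) (mm_chart pi cE).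
Proof.
move=> ad; have [aM aE _ H] := ad.
split; first by move=> z [].
  have oT := @openT 'rV[R]_(m.+1 + dimMf m n).
  have oI : open (chart_image cE) by have [] := wf_chart wE aE.
  have := open_Cinf_preimage oT oI (Cinf_mm_base oT).
  congr open; apply/seteqP; split=> y.
    by move=> [_ h]; apply/(mm_chart_imageE _ ad).
  by move=> /(mm_chart_imageE _ ad).
by move=> z; exact: (mm_chart_invK ad).
Qed.

(** The new momenta are the values of the form on the new coordinate vectors,
    and the components of these are the rows of the Jacobian of the inverse
    change of coordinates. *)
Definition mm_change (cE cE' : chart R (pt E) (m.+1 + n)) (y : 'rV[R]_(m.+1 + dimMf m n)) :
    'rV[R]_(m.+1 + dimMf m n) :=
  let e := tr cE cE' (mm_base y) in
  let K := 'J (tr cE' cE) e in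
  row_mx (lsubmx e) (row_mx (rsubmx e)
   (row_mx (mform (mm_cp y) (mm_cq y) (htuple R m.+1 n *m K))%:M
     (mxvec (\matrix_(i, a) mform (mm_cp y) (mm_cq y) (vtuple R i a *m K))))).

Lemma mm_changeE cM cM' cE cE' z : adapted eta pi cM cE -> adapted eta pi cM' cE' ->
  chart_dom (mm_chart pi cE) z -> chart_dom cE' z.1 ->
  chart_map (mm_chart pi cE') z = mm_change cE cE' (chart_map (mm_chart pi cE) z).
Proof.
move=> ad ad' [Lz cz] c'z; have [aM aE _ H] := ad; have [aM' aE' _ H'] := ad'.
apply: (etrans (mm_mapE _ _)); rewrite /mm_change mm_base_map mm_cp_map mm_cq_map.
have -> : tr cE cE' (chart_map cE z.1) = chart_map cE' z.1.
  by apply: tr_map => //.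
have K := dchart_tr_inv wE aE' aE c'z cz.
have uE' := dchart_unit wE aE' c'z.
rewrite -K.
congr (row_mx _ (row_mx _ (row_mx _%:M (mxvec _)))).
  apply: (etrans (Lambda_mform _ ad cz Lz)); congr mform.
  by rewrite mulmxA -(dx_tuple aE' c'z) mulmxK.
apply/matrixP => i a; rewrite mxE [RHS]mxE.
apply: (etrans (Lambda_mform _ ad cz Lz)); congr mform.
by rewrite mulmxA -(du_tuple i a aE' c'z) mulmxK.
Qed.

Lemma Cinf_mform (V : normedModType R) (U : set V) (p : V -> R) (q : V -> 'M[R]_(m.+1, n))
    (F : V -> 'M[R]_(m.+1, m.+1 + n)) : open U ->
  Cinf U p -> Cinf U q -> Cinf U F -> Cinf U (fun x => mform (p x) (q x) (F x)).
Proof.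
move=> oU cp cq cF.
have cdet (C : 'M[R]_(m.+1 + n, m.+1)) : Cinf U (fun x => \det (F x *m C)).
  apply: Cinf_det => // i j.
  by apply: (Cinf_entry i j oU); apply: Cinf_mulmx => //; exact: Cinf_cst.
apply: CinfD => //; first exact: CinfM.
apply: Cinf_sum => // i _; apply: Cinf_sum => // a _.
by apply: CinfM => //; exact: (Cinf_entry i a oU).
Qed.

Lemma mm_smooth_transition cM cM' cE cE' :
  adapted eta pi cM cE -> adapted eta pi cM' cE' ->
  smooth_transition (mm_chart pi cE) (mm_chart pi cE').
Proof.
move=> ad ad'; have [aM aE _ H] := ad; have [aM' aE' _ H'] := ad'.
rewrite /smooth_transition; set D := _ @` _.
have DE : D = setT `&` mm_base @^-1` overlap cE cE'.
  apply/seteqP; split=> [_ [z [[Lz cz] [_ c'z]] <-]|y [_ /= [e [ce c'e] ey]]].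
    by split=> //=; rewrite mm_base_map; exact: overlap_map.
  have Iy : chart_image cE (mm_base y) by rewrite -ey; exact: chart_map_image.
  have [[Lz cz] h2] := mm_chart_point ad Iy.
  exists (chart_inv (mm_chart pi cE) y) => //; split=> //; split=> //.
  by rewrite mm_invE -ey /= chart_invK //; exact: (wf_chart wE).
have oO := open_overlap wE aE aE'.
have oD : open D.
  by rewrite DE; apply: open_Cinf_preimage oO _; [exact: openT|exact: Cinf_mm_base openT].
have Dl y : D y -> overlap cE cE' (mm_base y) by rewrite DE => -[].
split=> //.
suff ce : Cinf D (mm_change cE cE').
  apply: (Cinf_ext oD _ ce) => _ [z [cz [_ c'z]] <-].
  apply: (etrans _ (esym (congr1 (chart_map (mm_chart pi cE')) (mm_chart_invK ad cz)))).
  by apply: esym; exact: (mm_changeE ad ad').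
have cb := Cinf_mm_base oD.
have cI := Cinf_id D.
have ct : Cinf D (fun y => tr cE cE' (mm_base y)).
  exact: (Cinf_comp_mx oD oO Dl cb (Cinf_tr wE aE aE')).
have oO' := open_overlap wE aE' aE.
have Dm y : D y -> overlap cE' cE (tr cE cE' (mm_base y)).
  by move=> /Dl[e [ce c'e] <-]; rewrite tr_map //; exact: overlap_map.
have cK : Cinf D (fun y => 'J (tr cE' cE) (tr cE cE' (mm_base y))).
  apply: (Cinf_comp_mx oD oO' Dm ct (g := fun y => 'J (tr cE' cE) y)).
  by apply: Cinf_jacobian => //; exact: Cinf_tr.
have cp : Cinf D mm_cp by exact: (Cinf_entry 0 _ oD cI).
have cq : Cinf D mm_cq.
  by apply: (Cinf_vec_mx oD); do 3![apply: (Cinf_rsubmx oD)].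
have cform (W : 'M[R]_(m.+1, m.+1 + n)) : Cinf D (fun y => mform (mm_cp y) (mm_cq y)
    (W *m 'J (tr cE' cE) (tr cE cE' (mm_base y)))).
  by apply: Cinf_mform => //; apply: Cinf_mulmx => //; exact: Cinf_cst.
apply: (Cinf_row_mx oD); first exact: (Cinf_lsubmx oD).
apply: (Cinf_row_mx oD); first exact: (Cinf_rsubmx oD).
apply: (Cinf_row_mx oD).
  apply: Cinf_mx => // i j; apply: Cinf_ext oD _ (cform (htuple R m.+1 n)) => y _.
  by rewrite !ord1 mxE eqxx mulr1n.
apply: (Cinf_mxvec oD); apply: Cinf_mx => // i a.
by apply: Cinf_ext oD _ (cform (vtuple R i a)) => y _; rewrite mxE.
Qed.

Lemma Mpi_wf : wf_mfd (Mpi eta pi).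
Proof.
split.
- by move=> c [cM [cE [ad ->]]]; exact: mm_is_chart ad.
- move=> z Lz; have [Ez _ _] := Lz; have [cM [cE [ad ce]]] := cover Ez.
  by exists (mm_chart pi cE); [exists cM, cE|split].
- by move=> c c' [cM [cE [ad ->]]] [cM' [cE' [ad' ->]]]; exact: mm_smooth_transition ad ad'.
Qed.

Lemma adapted_mm cM cE : adapted eta pi cM cE ->
  adapted eta (pinu eta pi) cM (mm_chart pi cE).
Proof.
move=> ad; have [aM aE uM H] := ad; split=> //; first by exists cM, cE.
move=> z [Lz cz]; have [h1 h2] := H _ cz; split=> //.
by rewrite -h2 -(mm_base_map cE z) /mm_base row_mxKl.
Qed.

(** With [adapted_mm], the atlas of J^1 (pi o nu) consists of the charts
    induced by adapted charts of pi, in which the coordinate formulas are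
    stated. *)
Lemma adapted_pinu cM cP : adapted eta (pinu eta pi) cM cP ->
  exists2 cE, cP = mm_chart pi cE & adapted eta pi cM cE.
Proof.
move=> [aM [cM' [cE [ad ->]]] uM H]; exists cE => //.
have [aM' aE uM' H'] := ad; split=> // e ce.
have Lz := multimomentum_Lambda 0 0 ad ce.
have [h1 h2] := H (e, multimomentum cE e 0 0) (conj Lz ce).
by split=> //; rewrite -h2 -(mm_base_map cE (e, multimomentum cE e 0 0)) /mm_base row_mxKl.
Qed.

Lemma cover_Mpi z : carrier (m := Mpi eta pi) z ->
  exists cM cP, adapted eta (pinu eta pi) cM cP /\ chart_dom cP z.
Proof.
move=> Lz; have [Ez _ _] := Lz; have [cM [cE [ad ce]]] := cover Ez.
by exists cM, (mm_chart pi cE); split; [exact: adapted_mm|split].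
Qed.

End MultimomentumBundle.

(** * Wedge products as determinants *)

Section Wedges.
Variable R : realType.

(** Cofactor expansion along the first column is the definition of the wedge
    product by a linear form. *)
Lemma wedge_det d q (pi : 'cV[R]_d) (C : 'M[R]_(d, q)) V :
  wedge1 (fun v => (v *m pi) 0 0) (fun W : 'M[R]_(q, d) => \det (W *m C)) V =
  \det (V *m row_mx pi C : 'M[R]_(1 + q)).
Proof.
pose N : 'M[R]_(1 + q) := V *m row_mx pi C.
have N0 j : N j 0 = (V *m pi) j 0.
  have -> : (0 : 'I_(1 + q)) = lshift q 0 by exact: val_inj.
  by rewrite /N mul_mx_row row_mxEl.
have NS j l : N j (lift 0 l) = (V *m C) j l.
  have -> : lift (0 : 'I_(1 + q)) l = rshift 1 l by exact: val_inj.
  by rewrite /N mul_mx_row row_mxEr.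
rewrite -/N (expand_det_col N 0) /wedge1; apply: eq_bigr => j _.
rewrite [X in X * _]mulrC -mulrA N0 -row_mul mxE; congr (_ * _).
rewrite /cofactor addn0; congr (_ * \det _).
have E : row' j (V *m C) = row' j V *m C := row'_mul V C j.
by apply/matrixP => a b; rewrite -E [LHS]mxE [RHS]mxE [RHS]mxE NS.
Qed.

Lemma det_row_mx_sum p q (h : 'I_p -> R) (c : 'I_p -> 'cV[R]_(1 + q)) (N : 'M[R]_(1 + q, q)) :
  \det (row_mx (\sum_j h j *: c j) N : 'M[R]_(1 + q)) =
  \sum_j h j * \det (row_mx (c j) N : 'M[R]_(1 + q)).
Proof.
have exp c0 : \det (row_mx c0 N : 'M[R]_(1 + q)) =
    \sum_i c0 i 0 * cofactor (row_mx 0 N : 'M[R]_(1 + q)) i 0.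
  rewrite (expand_det_col _ 0); apply: eq_bigr => i _.
  have e0 : (0 : 'I_(1 + q)) = lshift q 0 by exact: val_inj.
  have -> : (row_mx c0 N : 'M[R]_(1 + q)) i 0 = c0 i 0 by rewrite e0; exact: row_mxEl.
  congr (_ * (_ * \det _)); apply/matrixP => a b.
  rewrite mxE mxE [RHS]mxE [RHS]mxE.
  have -> : lift (0 : 'I_(1 + q)) b = rshift 1 b by exact: val_inj.
  by transitivity (N (lift i a) b); [exact: row_mxEr|exact/esym/row_mxEr].
under [RHS]eq_bigr => j _ do rewrite exp mulr_sumr.
rewrite exp exchange_big /=; apply: eq_bigr => i _.
rewrite summxE mulr_suml; apply: eq_bigr => j _.
by rewrite mxE mulrA.
Qed.

Lemma det_row_mx_swap q (c c' : 'cV[R]_(1 + (1 + q))) (N : 'M[R]_(1 + (1 + q), q)) :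
  \det (row_mx c (row_mx c' N)) = - \det (row_mx c' (row_mx c N)).
Proof.
set i0 : 'I_(1 + (1 + q)) := lshift _ 0.
set i1 : 'I_(1 + (1 + q)) := rshift _ (lshift _ 0).
have aw := @alt_det_mul R _ _ (1%:M : 'M[R]_(1 + (1 + q))).
have i01 : i0 != i1 by [].
rewrite -[LHS]det_tr -[in RHS]det_tr.
have := alt_tperm aw (row_mx c' (row_mx c N))^T i01; rewrite !mulmx1 => <-.
congr (\det _); apply/matrixP => a b; rewrite mxE [RHS]mxE [RHS]mxE.
case: perm.tpermP => [->|->|].
- by rewrite /i0 /i1 row_mxEl row_mxEr row_mxEl.
- by rewrite /i0 /i1 row_mxEl row_mxEr row_mxEl.
case: (split_ordP a) => a' ->; first by rewrite ord1.
rewrite !row_mxEr; case: (split_ordP a') => a'' ->; first by rewrite ord1.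
by rewrite !row_mxEr.
Qed.

Lemma det_row_mx_dup q (c : 'cV[R]_(1 + q)) (N : 'M[R]_(1 + q, q)) i :
  (forall a, c a 0 = N a i) -> \det (row_mx c N : 'M[R]_(1 + q)) = 0.
Proof.
move=> cN; rewrite -det_tr.
have ii : lshift q 0 != rshift 1 i by rewrite eq_lrshift.
by apply: (determinant_alternate ii) => a; rewrite mxE [RHS]mxE row_mxEl row_mxEr cN.
Qed.

Lemma sum_mxvec_index (W : nmodType) p q (f : 'I_(p * q) -> W) :
  \sum_k f k = \sum_i \sum_j f (mxvec_index i j).
Proof.
rewrite (reindex (uncurry (@mxvec_index p q))) /=; last first.
  by have [g h1 h2] := curry_mxvec_bij p q; exists g => x xP; [apply: h1|apply: h2].
by rewrite pair_bigA; apply: eq_bigr => -[].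
Qed.

Lemma col_mul p q r (A : 'M[R]_(p, q)) (B : 'M[R]_(q, r)) j :
  col j (A *m B) = A *m col j B.
Proof. by apply/matrixP => a b; rewrite !mxE; apply: eq_bigr => l _; rewrite mxE. Qed.

End Wedges.

(** * Coordinates on the two jet bundles *)

Section JetIndices.
Variables (R : realType) (m n : nat).
Notation d1 := (m.+1 + n + m.+1 * n)%N.
Notation d2 := (m.+1 + dimMf m n + m.+1 * dimMf m n)%N.

Definition ix (i : 'I_m.+1) : 'I_d1 := jbase (lshift n i).

Variant jet_index_spec : 'I_d1 -> Type :=
| JetIndexX i : jet_index_spec (ix i)
| JetIndexU a : jet_index_spec (iu m a)
| JetIndexUi i a : jet_index_spec (iui i a).

Lemma jet_indexP j : jet_index_spec j.
Proof.
case: (split_ordP j) => [j' ->|k ->].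
  by case: (split_ordP j') => [i ->|a ->]; [exact: JetIndexX|exact: JetIndexU].
by case/mxvec_indexP: k => i a; exact: JetIndexUi.
Qed.

Lemma jet_row_eq (u v : 'rV[R]_d1) : (forall i, u 0 (ix i) = v 0 (ix i)) ->
  (forall a, u 0 (iu m a) = v 0 (iu m a)) ->
  (forall i a, u 0 (iui i a) = v 0 (iui i a)) -> u = v.
Proof. by move=> h1 h2 h3; apply/rowP => j; case: (jet_indexP j). Qed.

Lemma sum_jet_index (W : nmodType) (f : 'I_d1 -> W) :
  \sum_j f j = \sum_i f (ix i) + \sum_a f (iu m a) + \sum_i \sum_a f (iui i a).
Proof. by rewrite big_split_ord big_split_ord sum_mxvec_index. Qed.

Lemma ix_iu i a : (ix i == iu m a) = false.
Proof. by rewrite /ix /iu /jbase eq_lshift eq_lrshift. Qed.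

Lemma ix_iui i j a : (ix i == iui j a) = false.
Proof. by rewrite /ix /iui /jbase /jder eq_lrshift. Qed.

Lemma ix_inj : injective ix.
Proof. by move=> i j /lshift_inj /lshift_inj. Qed.

Definition jet_row (x : 'rV[R]_m.+1) (u : 'rV[R]_n) (v : 'M[R]_(m.+1, n)) : 'rV[R]_d1 :=
  row_mx (row_mx x u) (mxvec v).

Lemma jet_row_x x u v i : jet_row x u v 0 (ix i) = x 0 i.
Proof. by rewrite /jet_row /ix /jbase row_mxEl row_mxEl. Qed.

Lemma jet_row_u x u v a : jet_row x u v 0 (iu m a) = u 0 a.
Proof. by rewrite /jet_row /iu /jbase row_mxEl row_mxEr. Qed.

Lemma jet_row_ui x u v i a : jet_row x u v 0 (iui i a) = v i a.
Proof. by rewrite /jet_row /iui /jder row_mxEr mxvecE. Qed.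

Lemma jet_part_x (y : 'rV[R]_d2) i : jet_part y 0 (ix i) = y 0 (wx n i).
Proof. by rewrite [LHS]jet_row_x mxE. Qed.

Lemma jet_part_u (y : 'rV[R]_d2) a : jet_part y 0 (iu m a) = y 0 (wu m a).
Proof. by rewrite [LHS]jet_row_u mxE. Qed.

Lemma jet_part_ui (y : 'rV[R]_d2) i a : jet_part y 0 (iui i a) = y 0 (wui i a).
Proof. by rewrite [LHS]jet_row_ui mxE. Qed.

(** The momenta conjugate to the coordinates of J^1 pi under the morphism of
    Tulczyjew. Indexing them by the coordinates of J^1 pi gives the equations
    of S_L the form of a gradient equation, and makes Omega a sum over these
    coordinates. *)
Definition mom_part (y : 'rV[R]_d2) : 'rV[R]_d1 :=
  jet_row 0 (\row_a \sum_i y 0 (wpj i a i)) (\matrix_(i, a) y 0 (wp i a)).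

Lemma mom_part_x y i : mom_part y 0 (ix i) = 0.
Proof. by rewrite jet_row_x mxE. Qed.

Lemma mom_part_u y a : mom_part y 0 (iu m a) = \sum_i y 0 (wpj i a i).
Proof. by rewrite jet_row_u mxE. Qed.

Lemma mom_part_ui y i a : mom_part y 0 (iui i a) = y 0 (wp i a).
Proof. by rewrite jet_row_ui mxE. Qed.

Lemma jet_part_linear : linear (@jet_part R m n).
Proof.
move=> c u v; apply: jet_row_eq => *;
  by rewrite [RHS]mxE [X in _ = X + _]mxE ?(jet_part_x, jet_part_u, jet_part_ui) mxE mxE.
Qed.
HB.instance Definition _ := GRing.isLinear.Build R 'rV[R]_d2 'rV[R]_d1 _
  (@jet_part R m n) jet_part_linear.

Lemma mom_part_linear : linear mom_part.
Proof.
move=> c u v; apply: jet_row_eq => [i|a|i a];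
  rewrite [RHS]mxE [X in _ = X + _]mxE ?(mom_part_x, mom_part_u, mom_part_ui).
- by rewrite mulr0 addr0.
- by rewrite mulr_sumr -big_split; apply: eq_bigr => i _; rewrite mxE mxE.
- by rewrite mxE mxE.
Qed.
HB.instance Definition _ := GRing.isLinear.Build R 'rV[R]_d2 'rV[R]_d1 _
  mom_part mom_part_linear.

(** The components along u^a and u^a_i, the only ones that survive a wedge
    product with d^m x. *)
Definition vpart (g : 'rV[R]_d1) : 'rV[R]_(n + m.+1 * n) :=
  row_mx (rsubmx (lsubmx g)) (rsubmx g).

Lemma vpart_linear : linear vpart.
Proof.
by move=> c u v; rewrite /vpart !linearP /= scale_row_mx add_row_mx.
Qed.
HB.instance Definition _ := GRing.isLinear.Build R 'rV[R]_d1 'rV[R]_(n + m.+1 * n) _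
  vpart vpart_linear.

Lemma vpart_jet_row x u v : vpart (jet_row x u v) = row_mx u (mxvec v).
Proof. by rewrite /vpart row_mxKl row_mxKr row_mxKr. Qed.

Lemma vpart_eq0 g : vpart g = 0 <->
  (forall a, g 0 (iu m a) = 0) /\ (forall i a, g 0 (iui i a) = 0).
Proof.
split=> [/rowP g0|[g1 g2]].
  split=> [a|i a].
    by have := g0 (lshift _ a); rewrite row_mxEl !mxE.
  by have := g0 (rshift _ (mxvec_index i a)); rewrite row_mxEr !mxE.
apply/rowP => j; rewrite [RHS]mxE; case: (split_ordP j) => [a ->|k ->].
  by rewrite row_mxEl !mxE -(g1 a).
by case/mxvec_indexP: k => i a; rewrite row_mxEr mxE -(g2 i a).
Qed.

(** With [corr], which adjusts the momenta without moving the jet components,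
    this lifts any vector of the jet space to a tangent vector of S_L. *)
Definition emb (xi : 'rV[R]_d1) : 'rV[R]_d2 :=
  row_mx (row_mx (lsubmx (lsubmx xi)) (row_mx (rsubmx (lsubmx xi)) 0))
    (mxvec (row_mx (vec_mx (rsubmx xi)) 0 : 'M[R]_(m.+1, dimMf m n))).

Lemma jet_part_emb xi : jet_part (emb xi) = xi.
Proof.
apply: jet_row_eq => [i|a|i a]; rewrite ?(jet_part_x, jet_part_u, jet_part_ui) /emb.
- by rewrite /wx /jbase row_mxEl row_mxEl !mxE.
- by rewrite /wu /fu /jbase row_mxEl row_mxEr row_mxEl !mxE.
- by rewrite /wui /fu /jder row_mxEr mxvecE row_mxEl !mxE.
Qed.

(** A prescribed trace sum_i p^i_{a i} is carried by the first diagonal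
    entry. *)
Definition corr (z : 'rV[R]_(n + m.+1 * n)) : 'rV[R]_d2 :=
  row_mx (row_mx 0 (row_mx 0 (row_mx 0 (rsubmx z))))
    (mxvec (row_mx 0 (row_mx 0
       (\matrix_j (if j == 0 then mxvec (\matrix_(i, a) if i == 0 then lsubmx z 0 a else 0)
                   else 0))) : 'M[R]_(m.+1, n + (1 + m.+1 * n)))).

Lemma jet_part_corr z : jet_part (corr z) = 0.
Proof.
apply: jet_row_eq => [i|a|i a]; rewrite [RHS]mxE ?(jet_part_x, jet_part_u, jet_part_ui) /corr.
- by rewrite /wx /jbase row_mxEl row_mxEl mxE.
- by rewrite /wu /fu /jbase row_mxEl row_mxEr row_mxEl mxE.
- by rewrite /wui /fu /jder row_mxEr mxvecE row_mxEl mxE.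
Qed.

Lemma mom_part_corr z : vpart (mom_part (corr z)) = z.
Proof.
rewrite vpart_jet_row -[RHS]hsubmxK; congr row_mx.
  apply/rowP => a; rewrite mxE (bigD1 0) //= big1 ?addr0 => [|i /negbTE i0];
    rewrite /corr /wpj /fpi /jder row_mxEr mxvecE row_mxEr row_mxEr mxE.
    by rewrite eqxx mxvecE mxE eqxx.
  by rewrite i0 mxE.
apply: (can_inj vec_mxK); rewrite mxvecK; apply/matrixP => i a.
rewrite mxE /corr /wp /fpi /jbase row_mxEl row_mxEr row_mxEr row_mxEr.
by rewrite [RHS]mxE.
Qed.

End JetIndices.

(** * The form Omega in coordinates *)

Section Isotropy.
Variables (R : realType) (m n : nat).
Notation d1 := (m.+1 + n + m.+1 * n)%N.
Notation d2 := (m.+1 + dimMf m n + m.+1 * dimMf m n)%N.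

(** With Pi, the jet components and the conjugate momenta as matrices, which
    act on all rows of a tuple of vectors at once. *)
Definition Xi : 'M[R]_(d2, d1) := lin1_mx (@jet_part R m n).
Definition Pi : 'M[R]_(d2, d1) := lin1_mx (@mom_part R m n).

Lemma mul_Xi (y : 'rV[R]_d2) : y *m Xi = jet_part y.
Proof. exact: mul_rV_lin1. Qed.

Lemma mul_Pi (y : 'rV[R]_d2) : y *m Pi = mom_part y.
Proof. exact: mul_rV_lin1. Qed.

Definition Xcols p (Y : 'M[R]_(p, d1)) : 'M[R]_(p, m.+1) := colsub (@ix m n) Y.

Lemma Xcols_mul p q (V : 'M[R]_(p, q)) (Y : 'M[R]_(q, d1)) :
  V *m Xcols Y = Xcols (V *m Y).
Proof. by apply/matrixP => i j; rewrite !mxE; apply: eq_bigr => l _; rewrite mxE. Qed.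

Lemma Xcols0 p : Xcols (0 : 'M[R]_(p, d1)) = 0.
Proof. by apply/matrixP => i j; rewrite !mxE. Qed.

Lemma col0 p q (j : 'I_q) : col j (0 : 'M[R]_(p, q)) = 0.
Proof. by apply/matrixP => a b; rewrite !mxE. Qed.

(** det (V *m frame A) is the value on the rows of V of d pi_A /\ dz^A /\ d^m
    x, where z^A is a coordinate of J^1 pi and pi_A the conjugate momentum. *)
Definition frame A : 'M[R]_(d2, 1 + (1 + m.+1)) :=
  row_mx (col A Pi) (row_mx (col A Xi) (Xcols Xi)).

Definition omega (V : 'M[R]_(1 + (1 + m.+1), d2)) : R :=
  - \sum_(A : 'I_d1) \det (V *m frame A).

Lemma omega_alt : is_altform (omega : altform R m.+3 d2).
Proof.
rewrite (_ : omega = fun V => \sum_(A : 'I_d1) (-1) * \det (V *m frame A)).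
  by apply: (@alt_sum _ _ _ _ _ (fun=> -1) (fun A V => \det (V *m frame A))) => A;
     exact: (@alt_det_mul R _ (1 + (1 + m.+1)) (frame A)).
by apply/funext => V; rewrite /omega -sumrN; apply: eq_bigr => A _; rewrite mulN1r.
Qed.

Lemma col_Pi_ix i : col (ix n i) Pi = 0.
Proof.
apply/matrixP => l j; rewrite mxE [RHS]mxE [LHS]mxE; exact: mom_part_x.
Qed.

Lemma det_frameE V A : \det (V *m frame A) =
  \det (row_mx (col A (V *m Pi)) (row_mx (col A (V *m Xi)) (Xcols (V *m Xi))) :
    'M[R]_(1 + (1 + m.+1))).
Proof. by rewrite /frame !mul_mx_row Xcols_mul !col_mul. Qed.

Definition tangent_rows p (H : 'M[R]_d1) (V : 'M[R]_(p, d2)) :=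
  forall i, vpart (row i V *m Pi - row i V *m Xi *m H) = 0.

(** For tangent vectors d pi_A = sum_B H_AB dz^B modulo the dx^i, and omega
    becomes the sum of H_AB dz^B /\ dz^A /\ d^m x: symmetric coefficients
    against a skew-symmetric form. *)
Lemma omega_isotropic (H : 'M[R]_d1) V : H^T = H -> tangent_rows H V -> omega V = 0.
Proof.
move=> Hsym tV.
pose e j A := \det (row_mx (col j (V *m Xi)) (row_mx (col A (V *m Xi)) (Xcols (V *m Xi))) :
    'M[R]_(1 + (1 + m.+1))).
have ex j i : e j (ix n i) = 0.
  rewrite /e det_row_mx_swap (@det_row_mx_dup _ _ _ _ (rshift 1 i)) ?oppr0 // => a.
  by rewrite row_mxEr !mxE.
have DE A : \det (V *m frame A) = \sum_j H j A * e j A.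
  rewrite det_frameE; case: (jet_indexP A) => [i|a|i a].
  - rewrite [RHS]big1 => [|j _]; last by rewrite ex mulr0.
    rewrite (_ : col (ix n i) (V *m Pi) = \sum_(j < 0) 0 *: 0).
      by rewrite det_row_mx_sum big_ord0.
    by rewrite big_ord0 col_mul col_Pi_ix mulmx0.
  - rewrite /e -det_row_mx_sum; congr (\det (row_mx _ _)).
    apply/colP => r; rewrite summxE.
    have [/(_ a) h _] := (vpart_eq0 _).1 (tV r).
    move: h; rewrite mxBE => /eqP; rewrite subr_eq0 => /eqP.
    rewrite -!row_mul !mxE => ->; apply: eq_bigr => j _.
    by rewrite !mxE mulrC.
  - rewrite /e -det_row_mx_sum; congr (\det (row_mx _ _)).
    apply/colP => r; rewrite summxE.
    have [_ /(_ i a) h] := (vpart_eq0 _).1 (tV r).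
    move: h; rewrite mxBE => /eqP; rewrite subr_eq0 => /eqP.
    rewrite -!row_mul !mxE => ->; apply: eq_bigr => j _.
    by rewrite !mxE mulrC.
rewrite /omega; under eq_bigr => A _ do rewrite DE.
set S := \sum_A _.
have SN : S = - S.
  rewrite {1}/S exchange_big -sumrN; apply: eq_bigr => A _ /=.
  rewrite -sumrN; apply: eq_bigr => j _.
  rewrite /e det_row_mx_swap mulrN; congr (- (_ * _)).
  by rewrite -[in LHS]Hsym mxE.
by move: S SN => S' SN; lra.
Qed.

Lemma omega_kernel v (W : 'M[R]_(1 + m.+1, d2)) : v *m Xi = 0 -> v *m Pi = 0 ->
  omega (col_mx v W : 'M[R]_(1 + (1 + m.+1), d2)) = 0.
Proof.
move=> vX vP; rewrite /omega big1 ?oppr0 // => A _.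
have vF : v *m frame A = 0.
  by rewrite /frame !mul_mx_row Xcols_mul -!col_mul vX vP !col0 Xcols0 !row_mx0.
rewrite mul_col_mx vF; apply: (@det_row0 _ _ _ (lshift _ 0)) => j.
by rewrite [LHS]col_mxEu mxE.
Qed.

(** For lifts of d/dz^A, d/dx^1, ..., d/dx^m the matrices are block
    triangular, and only the momentum component of v conjugate to z^A
    remains. *)
Lemma omega_test v (T : 'M[R]_(1 + m.+1, d2)) A :
  (forall i, A != ix n i) -> v *m Xi = 0 ->
  (forall B, (T *m Xi) (lshift _ 0) B = (B == A)%:R) ->
  (forall i B, (T *m Xi) (rshift _ i) B = (B == ix n i)%:R) ->
  omega (col_mx v T : 'M[R]_(1 + (1 + m.+1), d2)) = - (v *m Pi) 0 A.
Proof.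
move=> Ax vX T0 TS; rewrite /omega; congr (- _).
have D B : \det ((col_mx v T : 'M[R]_(1 + (1 + m.+1), d2)) *m frame B) =
    (v *m Pi) 0 B * (B == A)%:R.
  rewrite mul_col_mx /frame [v *m _]mul_mx_row [T *m _]mul_mx_row.
  have -> : v *m row_mx (col B Xi) (Xcols Xi) = 0.
    by rewrite mul_mx_row Xcols_mul -col_mul vX col0 Xcols0 row_mx0.
  rewrite -[col_mx _ _]/(block_mx _ _ _ _) det_lblock det_mx11 -col_mul mxE.
  congr (_ * _).
  rewrite mul_mx_row Xcols_mul -col_mul.
  have -> : row_mx (col B (T *m Xi)) (Xcols (T *m Xi)) =
      (block_mx (B == A)%:R%:M 0 (\col_i (B == ix n i)%:R) 1%:M : 'M[R]_(1 + m.+1)).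
    apply/matrixP => a b; case: (split_ordP a) => a' ->; case: (split_ordP b) => b' ->.
    - by rewrite block_mxEul row_mxEl !ord1 mxE T0 mxE eqxx mulr1n.
    - by rewrite block_mxEur row_mxEr !ord1 mxE T0 mxE eq_sym (negbTE (Ax b')).
    - by rewrite block_mxEdl row_mxEl mxE TS mxE.
    - by rewrite block_mxEdr row_mxEr mxE TS mxE (inj_eq (@ix_inj _ _)) eq_sym.
  by rewrite det_lblock det_scalar1 det1 mulr1.
by rewrite (bigD1 A) //= D eqxx mulr1 big1 ?addr0 // => B /negbTE BA; rewrite D BA mulr0.
Qed.

End Isotropy.

(** * The equations of S_L in coordinates *)

Section GraphEquations.
Variables (R : realType) (m n : nat).
Notation d1 := (m.+1 + n + m.+1 * n)%N.
Notation d2 := (m.+1 + dimMf m n + m.+1 * dimMf m n)%N.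
Variables (Lc : 'rV[R]_d1 -> R) (O1 : set 'rV[R]_d1).
Hypotheses (oO : open O1) (sL : Cinf O1 Lc).

Definition grad (v : 'rV[R]_d1) : 'rV[R]_d1 := \row_j 'D_(delta_mx 0 j) Lc v.

Lemma Cinf_grad : Cinf O1 grad.
Proof.
apply: Cinf_mx => // i j; apply: (Cinf_ext (f := 'D_(delta_mx 0 j) Lc)) => //.
  by move=> v _; rewrite mxE.
exact: Cinf_deriv.
Qed.

Definition hess v := 'J grad v.

(** This symmetry is the reason for which S_L is isotropic. *)
Lemma hess_sym v : O1 v -> (hess v)^T = hess v.
Proof.
move=> Ov; apply/matrixP => i j; rewrite mxE.
have dg := Cinf_diff Cinf_grad Ov.
have E k : (fun y => grad y 0 k) = 'D_(delta_mx 0 k) Lc.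
  by apply/funext => y; rewrite mxE.
rewrite /hess !jacobian_entry // !E.
have := @derive_swap R _ O1 Lc v (delta_mx 0 j) (delta_mx 0 i) oO Ov (sL 2).
by move=> ->.
Qed.

(** The equations pi_A = L_A for the coordinates u^a and u^a_i: the pair
    (jet_part, mom_part) of a point of S_L lies on the graph of dL, taken
    modulo the dx^i. *)
Definition graph_eq (y : 'rV[R]_d2) : 'rV[R]_(n + m.+1 * n) :=
  vpart (mom_part y - grad (jet_part y)).

Definition graph_dom : set 'rV[R]_d2 := [set y | O1 (jet_part y)].

Lemma Cinf_jet_part (U : set 'rV[R]_d2) : open U -> Cinf U (@jet_part R m n).
Proof.
move=> oU; apply: (Cinf_ext (f := fun y => y *m Xi R m n)) => //.
  by move=> y _; exact: mul_Xi.
exact: Cinf_linmx.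
Qed.

Lemma open_graph_dom : open graph_dom.
Proof.
have -> : graph_dom = setT `&` (@jet_part R m n) @^-1` O1 by rewrite setTI.
by apply: open_Cinf_preimage => //; [exact: openT|exact/Cinf_jet_part/openT].
Qed.

Definition Vp : 'M[R]_(d1, n + m.+1 * n) := lin1_mx (@vpart R m n).

Lemma mul_Vp g : g *m Vp = vpart g.
Proof. exact: mul_rV_lin1. Qed.

Lemma graph_eqE y :
  graph_eq y = (y *m Pi R m n - grad (y *m Xi R m n)) *m Vp.
Proof. by rewrite mul_Vp mul_Pi mul_Xi. Qed.

Lemma Cinf_graph_eq : Cinf graph_dom graph_eq.
Proof.
have oG := open_graph_dom.
apply: (Cinf_ext (f := fun y => (y *m Pi R m n + grad (jet_part y) *m (- 1%:M)) *m Vp)) => //.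
  by move=> y _; rewrite graph_eqE mulmxN mulmx1 mul_Xi.
apply: Cinf_mulmx => //; last exact: Cinf_cst.
apply: CinfD => //; first exact: Cinf_linmx.
apply: Cinf_mulmx => //; last exact: Cinf_cst.
apply: (Cinf_comp_mx (U' := O1) (f := @jet_part R m n)) => //; last exact: Cinf_grad.
exact: Cinf_jet_part.
Qed.

Lemma jacobian_graph_eq y : graph_dom y ->
  'J graph_eq y = (Pi R m n - Xi R m n *m hess (jet_part y)) *m Vp.
Proof.
move=> Gy; have oG := open_graph_dom.
have dg : differentiable grad (jet_part y) := Cinf_diff Cinf_grad Gy.
have dX : differentiable (@jet_part R m n) y := Cinf_diff (Cinf_jet_part openT) I.
have dgX : differentiable (grad \o @jet_part R m n) y.
  exact: differentiable_comp.
have dlin p q (B : 'M[R]_(p, q)) (z : 'rV[R]_p) :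
  differentiable (fun x : 'rV[R]_p => x *m B) z.
  exact: Cinf_diff (Cinf_linmx B openT) I.
have JX : 'J (@jet_part R m n) y = Xi R m n.
  by rewrite -(jacobian_linmx (Xi R m n) y); congr ('J _ y); apply/funext => x; rewrite mul_Xi.
have JgX : 'J (grad \o @jet_part R m n) y = Xi R m n *m hess (jet_part y).
  by rewrite jacobian_comp // JX.
have dk : differentiable (fun x => - (grad \o @jet_part R m n) x) y by exact: differentiableN.
have dh : differentiable (fun x => x *m Pi R m n - (grad \o @jet_part R m n) x) y.
  exact: differentiableD (dlin _ _ _ _) dk.
have e := jacobian_comp_near oG Gy _ erefl dh (dlin _ _ Vp _).
rewrite (e graph_eq) => [|x _]; last by rewrite graph_eqE mul_Xi.
rewrite jacobian_linmx; congr (_ *m _).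
apply/row_matrixP => i; rewrite [LHS]rowE [RHS]rowE -[LHS]jacobianE.
have -> := diffB (dlin _ _ (Pi R m n) y) dgX.
have e1 := jacobianE (fun x => x *m Pi R m n) y (delta_mx 0 i).
have e2 := jacobianE (grad \o @jet_part R m n) y (delta_mx 0 i).
rewrite jacobian_linmx in e1; rewrite JgX in e2.
by rewrite mulmxBr -e1 -e2.
Qed.

(** The equations are solved for the momenta. Hence they have maximal rank,
    and any curve is turned into a curve of solutions by moving its
    momenta. *)
Lemma graph_eq_shift y z : graph_eq (y + corr z) = graph_eq y + z.
Proof.
rewrite !graph_eqE [(y + _) *m Pi _ _ _]mulmxDl [(y + _) *m Xi _ _ _]mulmxDl.
rewrite [corr z *m Xi _ _ _]mul_Xi jet_part_corr addr0.
rewrite (_ : _ - _ = y *m Pi R m n - grad (y *m Xi R m n) + corr z *m Pi R m n).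
  by rewrite [LHS]mulmxDl (mul_Pi (corr z)) [X in _ + X = _]mul_Vp mom_part_corr.
by rewrite addrAC.
Qed.

Lemma corr_jacobian y z : graph_dom y -> corr z *m 'J graph_eq y = z.
Proof.
move=> Gy; rewrite jacobian_graph_eq // mulmxA mulmxBr mulmxA mul_Xi jet_part_corr.
by rewrite mul0mx subr0 mul_Vp mul_Pi mom_part_corr.
Qed.

Lemma rank_graph_eq y : graph_dom y -> \rank ('J graph_eq y) = (n + m.+1 * n)%N.
Proof.
move=> Gy; apply/eqP; rewrite -[_ == _]/(row_full _) -sub1mx.
by apply/row_subP => i; rewrite -(corr_jacobian (row i 1%:M) Gy) submxMl.
Qed.

Lemma kernel_graph_eq y v : graph_dom y ->
  v *m 'J graph_eq y = vpart (v *m Pi R m n - v *m Xi R m n *m hess (jet_part y)).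
Proof. by move=> Gy; rewrite jacobian_graph_eq // mulmxA mulmxBr mulmxA mul_Vp. Qed.

Lemma corr_linear : linear (@corr R m n).
Proof.
move=> c u v; rewrite /corr scale_row_mx add_row_mx; congr row_mx.
  rewrite !scale_row_mx !add_row_mx !scaler0 !addr0.
  by rewrite -linearP.
rewrite -linearP /=; congr mxvec.
rewrite !scale_row_mx !add_row_mx !scaler0 !addr0; congr (row_mx _ (row_mx _ _)).
apply/row_matrixP => j; rewrite [RHS]linearP /= [LHS]rowK [in RHS]rowK [X in _ = _ + X]rowK.
case: ifP => _; last by rewrite scaler0 addr0.
rewrite -linearP; congr mxvec; apply/matrixP => i a; rewrite [RHS]mxE [X in _ = X + _]mxE !mxE.
by case: ifP => _; rewrite ?mulr0 ?addr0 // !mxE.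
Qed.
HB.instance Definition _ := GRing.isLinear.Build R 'rV[R]_(n + m.+1 * n) 'rV[R]_d2 _
  (@corr R m n) corr_linear.

(** A curve of solutions. When y is a solution and v is in the kernel of the
    Jacobian of the equations, the correction is o(t), so that the velocity is
    v. *)
Definition graph_curve (y v : 'rV[R]_d2) (t : 'rV[R]_1) : 'rV[R]_d2 :=
  y + t *m v - corr (graph_eq (y + t *m v)).

Lemma graph_eq_curve y v t : graph_eq (graph_curve y v t) = 0.
Proof. by rewrite /graph_curve -linearN graph_eq_shift subrr. Qed.

Lemma jet_part_curve y v t : jet_part (graph_curve y v t) = jet_part (y + t *m v).
Proof. by rewrite /graph_curve linearB /= jet_part_corr subr0. Qed.

End GraphEquations.

(** * The equations of S_L on the manifold *)

Section WedgeCoefficients.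
Variables (R : realType) (m n : nat).
Notation d1 := (m.+1 + n + m.+1 * n)%N.

Definition Xsel : 'M[R]_(d1, m.+1) := Xcols 1%:M.

Lemma mul_Xsel p (V : 'M[R]_(p, d1)) : V *m Xsel = Xcols V.
Proof. by rewrite Xcols_mul mulmx1. Qed.

(** Evaluation on the tuples (d/dz^A, d/dx^1, ..., d/dx^m) isolates the
    coefficients along u^a and u^a_i. *)
Lemma wedge_coeff (c c' : 'rV[R]_d1) :
  (forall V : 'M[R]_(1 + m.+1, d1),
    \det (V *m row_mx c^T Xsel) = \det (V *m row_mx c'^T Xsel)) <-> vpart c = vpart c'.
Proof.
have E (b : 'rV[R]_d1) (V : 'M[R]_(1 + m.+1, d1)) : \det (V *m row_mx b^T Xsel) =
    \sum_a b 0 (iu m a) * \det (row_mx (col (iu m a) V) (Xcols V) : 'M[R]_(1 + m.+1)) +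
    \sum_i \sum_a b 0 (iui i a) * \det (row_mx (col (iui i a) V) (Xcols V) : 'M[R]_(1 + m.+1)).
  rewrite mul_mx_row mul_Xsel.
  have -> : V *m b^T = \sum_j b 0 j *: col j V.
    apply/colP => r; rewrite summxE mxE; apply: eq_bigr => j _.
    by rewrite !mxE mulrC.
  rewrite det_row_mx_sum sum_jet_index [X in X + _ + _]big1 ?add0r // => i _.
  by rewrite (@det_row_mx_dup _ _ _ _ i) ?mulr0 // => a; rewrite !mxE.
split=> [H|H V].
  (* the tuple (d/dz^A, d/dx^1, ..., d/dx^m) *)
  pose T A : 'M[R]_(1 + m.+1, d1) := col_mx (delta_mx 0 A) (\matrix_i delta_mx 0 (ix n i)).
  have TE b A : (forall i, A != ix n i) -> \det (T A *m row_mx b^T Xsel) = b 0 A.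
    move=> nA; rewrite mul_mx_row mul_Xsel mul_col_mx.
    have -> : row_mx (col_mx (delta_mx 0 A *m b^T) (\matrix_i delta_mx 0 (ix n i) *m b^T))
      (Xcols (T A)) = (block_mx (b 0 A)%:M 0
        (\matrix_i delta_mx 0 (ix n i) *m b^T) 1%:M : 'M[R]_(1 + m.+1)).
      apply/matrixP => k l; case: (split_ordP k) => k' ->; case: (split_ordP l) => l' ->.
      - rewrite block_mxEul row_mxEl col_mxEu !ord1 -rowE mxE mxE.
        by rewrite mxE eqxx mulr1n.
      - by rewrite block_mxEur row_mxEr mxE col_mxEu mxE [_ == A]eq_sym (negbTE (nA _)) andbF mxE.
      - by rewrite block_mxEdl row_mxEl col_mxEd.
      - by rewrite block_mxEdr row_mxEr mxE col_mxEd !mxE (inj_eq (@ix_inj _ _)) eq_sym.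
    by rewrite det_lblock det_scalar1 det1 mulr1.
  apply/eqP; rewrite -subr_eq0 -linearB; apply/eqP/vpart_eq0; split=> [a|i a];
    rewrite mxBE; apply/eqP; rewrite subr_eq0 -!TE ?H // => j;
    by rewrite eq_sym ?ix_iu ?ix_iui.
have [h1 h2] : (forall a, c 0 (iu m a) = c' 0 (iu m a)) /\
    (forall i a, c 0 (iui i a) = c' 0 (iui i a)).
  have [h1 h2] := (vpart_eq0 (c - c')).1 (etrans (linearB _ _ _) (etrans (congr1 (fun u => u - _) H) (subrr _))).
  split=> [a|i a].
    by apply/eqP; rewrite -subr_eq0 -mxBE h1.
  by apply/eqP; rewrite -subr_eq0 -mxBE h2.
rewrite !E; congr (_ + _); first by apply: eq_bigr => a _; rewrite h1.
by apply: eq_bigr => i _; apply: eq_bigr => a _; rewrite h2.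
Qed.

End WedgeCoefficients.

Lemma wedge_chart (R : realType) (m n : nat) (D : 'M[R]_(m.+1 + n + m.+1 * n)) c
    (a : 'rV[R]__ -> R) (w : altform R m.+1 _) :
  (forall v, a v = (v *m D *m c^T) 0 0) -> (forall W, w W = \det (W *m D *m Xsel R m n)) ->
  wedge1 a w = fun V => \det (V *m D *m row_mx c^T (Xsel R m n) : 'M[R]_(1 + m.+1)).
Proof.
move=> aE wE; apply/funext => V.
rewrite (_ : a = fun v => (v *m (D *m c^T)) 0 0); last by apply/funext => v; rewrite aE mulmxA.
rewrite (_ : w = fun W => \det (W *m (D *m Xsel R m n))); last first.
  by apply/funext => W; rewrite wE mulmxA.
by rewrite wedge_det -mul_mx_row mulmxA.
Qed.

Section Equations.
Variables (R : realType) (m n : nat).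
Notation d1 := (m.+1 + n + m.+1 * n)%N.
Notation d2 := (m.+1 + dimMf m n + m.+1 * dimMf m n)%N.
Variables (M : mfd R m.+1) (E : mfd R (m.+1 + n)) (pi : pt E -> pt M).
Variable eta : pt M -> altform R m.+1 m.+1.
Variable L : pt (J1pi eta pi) -> R.
Variable A : pt (J1pinu eta pi) -> pt (J1pi eta pi) * altform R m.+2 d1.
Hypotheses (wM : wf_mfd M) (wE : wf_mfd E).
Hypothesis cover : forall e, carrier (m := E) e ->
  exists cM cE, adapted eta pi cM cE /\ chart_dom cE e.
Hypothesis HL : smooth_function L.
Hypothesis HA : is_tulczyjew A.

Lemma wf_J1pi : wf_mfd (J1pi eta pi).
Proof. exact: jet_wf. Qed.

Lemma wf_Mpi : wf_mfd (Mpi eta pi).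
Proof. exact: Mpi_wf. Qed.

Lemma wf_J1pinu : wf_mfd (J1pinu eta pi).
Proof. by apply: (jet_wf wM wf_Mpi); exact: cover_Mpi. Qed.

Lemma lsubmx_jet_part (y : 'rV[R]_d2) : lsubmx (jet_part y) = mm_base (lsubmx y).
Proof.
rewrite /jet_part row_mxKl /mm_base; congr row_mx; apply/rowP => i.
  by rewrite !mxE.
by rewrite !mxE.
Qed.

Section InCharts.
Variables (cM : chart R (pt M) m.+1) (cE : chart R (pt E) (m.+1 + n)).
Hypothesis ad : adapted eta pi cM cE.
Notation cJ := (chartE eta pi cM cE).
Notation cW := (chartM eta pi cM cE).

Lemma atlas_chartE : atlas (m := J1pi eta pi) cJ.
Proof. by exists cM, cE. Qed.

Lemma atlas_chartM : atlas (m := J1pinu eta pi) cW.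
Proof. by exists cM, (mm_chart pi cE); split=> //; exact: adapted_mm. Qed.

Lemma is_chartE : is_chart (X := J1pi eta pi) cJ.
Proof. exact (wf_chart wf_J1pi atlas_chartE). Qed.

Lemma is_chartM : is_chart (X := J1pinu eta pi) cW.
Proof. exact (wf_chart wf_J1pinu atlas_chartM). Qed.

Lemma chartM_image y : chart_image cW y <-> chart_image cJ (jet_part y).
Proof.
rewrite (jet_chart_imageE wM wf_Mpi y (adapted_mm ad)).
rewrite (mm_chart_imageE wM wE _ ad).
by rewrite (jet_chart_imageE wM wE _ ad) lsubmx_jet_part.
Qed.

Definition Lc : 'rV[R]_d1 -> R := L \o chart_inv cJ.

Lemma Cinf_Lc : Cinf (chart_image cJ) Lc.
Proof. exact: HL atlas_chartE. Qed.

Lemma pderiv_L j v : chart_image cJ v -> pderiv cJ j L (chart_inv cJ v) = grad Lc v 0 j.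
Proof. by move=> Iv; rewrite /pderiv (chart_image_inv is_chartE Iv).2 mxE. Qed.

Lemma SL_equationsE y : chart_image cW y -> SL_equations L cM cE y = graph_eq Lc y.
Proof.
move=> /chartM_image Iy; rewrite /graph_eq /SL_equations.
rewrite linearB /= vpart_jet_row /vpart.
rewrite opp_row_mx add_row_mx; congr row_mx.
  by apply/rowP => a; rewrite mxBE !mxE pderiv_L // !mxE.
apply: (can_inj vec_mxK); rewrite mxvecK linearB /= mxvecK; apply/matrixP => i a.
by rewrite mxBE !mxE pderiv_L // !mxE.
Qed.

(** In adapted charts pi1 is the projection on the x^i, and eta = d^m x. *)
Lemma pullback_eta z V : chart_dom cJ z ->
  pullback (@pi1 R m n M eta E pi) eta z V =
  \det (V *m dchart cJ z *m Xsel R m n).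
Proof.
move=> cz; have [aM aE uM H] := ad.
have cz1 : chart_dom cE z.1 by case: cz.
have [cpi _] := H _ cz1.
pose C : 'M[R]_(d1, m.+1) := col_mx (col_mx 1%:M 0) 0.
have [sp JE] : smooth_at (X := J1pi eta pi) (@pi1 R m n M eta E pi) cJ cM z /\
    'J (rep (@pi1 R m n M eta E pi) cJ cM) (chart_map cJ z) = C.
  apply: smooth_at_linear; [exact: is_chartE|exact: cz|].
  move=> z' [_ cz']; have [h1 h2] := H _ cz'; split=> //.
  rewrite -[chart_map cM _]h2 jet_chart_mapE /C -[RHS]/(row_mx _ _ *m col_mx _ _).
  by rewrite mul_row_col mulmx0 addr0 -lsubmx_mul.
have := Tmap_chart wf_J1pi wM atlas_chartE aM sp; rewrite JE => TE.
rewrite /pullback uM // coord_volume_id -mulmxA TE !mulmxA; congr (\det (_ *m _)).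
apply/matrixP => i j; rewrite !mxE /C /ix /jbase.
case: (split_ordP i) => [i' ->|k ->].
  case: (split_ordP i') => l ->.
    by rewrite [LHS]col_mxEu mxE eq_lshift eq_lshift.
  by rewrite [LHS]col_mxEd mxE eq_lshift eq_rlshift.
by rewrite mxE eq_rlshift.
Qed.

Lemma coord_volume_ix z V :
  coord_volume cJ (fun i => jbase (lshift n i)) z V =
  \det (V *m dchart cJ z *m Xsel R m n).
Proof.
rewrite mul_Xsel; congr (\det _); apply/matrixP => i j.
by rewrite mxE /dcoord -row_mul mxE [RHS]mxE.
Qed.

(** Like the value of A in [tulczyjew_chart], a wedge product with d^m x given
    by its vector of coefficients, so [wedge_coeff] compares them. *)
Lemma dLagrangian_chart z : chart_dom cJ z -> dLagrangian L z =
  (z, fun V => \det (V *m dchart cJ z *m row_mx (grad Lc (chart_map cJ z))^T (Xsel R m n)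
     : 'M[R]_(1 + m.+1))).
Proof.
move=> cz; congr (_, _); apply: wedge_chart => [v|W]; last exact: pullback_eta.
rewrite (dfun_chart wf_J1pi _ atlas_chartE cz) ?mxE; last exact: HL atlas_chartE.
apply: eq_bigr => j _; rewrite /dcoord !mxE; congr (_ * _).
Qed.

Definition jet_point w : pt (J1pi eta pi) := chart_inv cJ (jet_part (chart_map cW w)).

Lemma tulczyjew_chart w : chart_dom cW w ->
  A w = (jet_point w, fun V => \det (V *m dchart cJ (jet_point w) *m
    row_mx (mom_part (chart_map cW w))^T (Xsel R m n) : 'M[R]_(1 + m.+1))).
Proof.
move=> cw; apply: (etrans (HA ad cw)); cbv zeta; congr (_, _).
apply: wedge_chart => [v|W]; last by rewrite coord_volume_ix.
rewrite mxE sum_jet_index [X in X + _ + _]big1 ?add0r => [|i _].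
  congr (_ + _).
    by apply: eq_bigr => a _; rewrite [_^T _ _]mxE mom_part_u mulrC.
  apply: eq_bigr => i _; apply: eq_bigr => a _.
  by rewrite [_^T _ _]mxE mom_part_ui mulrC.
by rewrite [_^T _ _]mxE mom_part_x mulr0.
Qed.

Lemma jet_point_map w : chart_dom cW w ->
  chart_dom cJ (jet_point w) /\
  chart_map cJ (jet_point w) = jet_part (chart_map cW w).
Proof.
move=> cw; apply: (chart_image_inv is_chartE); apply/chartM_image.
exact: chart_map_image.
Qed.

Lemma tulczyjew_eq w : chart_dom cW w ->
  A w = dLagrangian L (jet_point w) <-> graph_eq Lc (chart_map cW w) = 0.
Proof.
move=> cw; have [cz zE] := jet_point_map cw.
have uD := dchart_unit wf_J1pi atlas_chartE cz.
rewrite tulczyjew_chart // (dLagrangian_chart cz) zE.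
move: (jet_point w) (chart_map cW w) cz zE uD => z y cz zE uD.
rewrite /graph_eq linearB; split=> [H|/eqP].
  have {H} := congr1 snd H => H.
  apply/eqP; rewrite subr_eq0; apply/eqP/wedge_coeff => V.
  have := congr1 (fun f => f (V *m invmx (dchart cJ z))) H => /=.
  by rewrite mulmxKV.
rewrite subr_eq0 => /eqP/wedge_coeff H; congr (_, _).
by apply/funext => V; exact: H.
Qed.

(** A w determines the point z of J^1 pi, so the only candidate is the jet
    component of w. *)
Lemma SL_chart w : chart_dom cW w -> SL L A w <-> graph_eq Lc (chart_map cW w) = 0.
Proof.
move=> cw; have [cz _] := jet_point_map cw.
split=> [[_ [z _ Az]]|/(tulczyjew_eq cw) Aw].
  apply/(tulczyjew_eq cw); rewrite Az; congr dLagrangian.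
  have := congr1 fst (tulczyjew_chart cw).
  by rewrite Az.
split; first exact: chart_dom_carrier is_chartM cw.
by exists (jet_point w) => //; exact: chart_dom_carrier is_chartE cz.
Qed.

Lemma graph_domE : graph_dom (chart_image cJ) = chart_image cW.
Proof. by apply/seteqP; split=> y /chartM_image. Qed.

Lemma open_imageE : open (chart_image cJ).
Proof. by have [] := is_chartE. Qed.

Lemma open_imageM : open (chart_image cW).
Proof. by have [] := is_chartM. Qed.

Lemma local_equations_SL :
  local_equations (SL L A) cW (chart_image cW) (SL_equations L cM cE).
Proof.
have oI := open_imageM; have cF := Cinf_graph_eq open_imageE Cinf_Lc.
rewrite graph_domE in cF.
have FE y : chart_image cW y -> graph_eq Lc y = SL_equations L cM cE y.
  by move=> Iy; rewrite SL_equationsE.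
split.
- by split.
- exact: (Cinf_ext oI FE cF).
- move=> y Iy; rewrite -FE //.
  have [cw yE] := chart_image_inv is_chartM Iy.
  by rewrite -[in X in _ <-> X]yE; exact: SL_chart.
move=> y Iy _.
rewrite -(@near_eq_jacobian _ _ _ (graph_eq Lc)).
- by rewrite (rank_graph_eq open_imageE Cinf_Lc) // graph_domE.
- exact: near_open oI Iy FE.
- exact: Cinf_diff cF Iy.
Qed.

End InCharts.
End Equations.

(** * S_L is Lagrangian *)

Section EuclideanCurves.
Variables (R : realType) (d e : nat).

Definition id_chart : chart R (pt (euclidean R d)) d := Chart (@setT 'rV[R]_d) id id.

Lemma id_chart_image : chart_image id_chart = setT.
Proof. by apply/seteqP; split=> // y _; exists y. Qed.

Lemma wf_euclidean : wf_mfd (euclidean R d).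
Proof.
split.
- move=> c ->; split=> //; last by rewrite -[chart_image _]/(chart_image id_chart) id_chart_image; exact: openT.
- by move=> x _; exists id_chart.
- move=> c c' -> ->; split; last exact: Cinf_id.
  rewrite setIT -[_ @` _]/(chart_image id_chart) id_chart_image; exact: openT.
Qed.

Variable (Y : mfd R e).
Hypothesis wY : wf_mfd Y.

Lemma Tmap_euclidean (g : 'rV[R]_d -> pt Y) cY x :
  atlas (m := Y) cY ->
  smooth_at (X := euclidean R d) (Y := Y) g id_chart cY x ->
  Tmap (X := euclidean R d) (Y := Y) g x *m dchart cY (g x) = 'J (chart_map cY \o g) x.
Proof.
move=> aY sg; have aX : atlas (m := euclidean R d) id_chart by [].
have := Tmap_chart wf_euclidean wY aX aY sg => ->.
have [p1 p2] := @pref_chartP _ _ _ wf_euclidean x I.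
rewrite /dchart (_ : pref_chart (X := euclidean R d) x = id_chart) //.
by rewrite jacobian_id mul1mx.
Qed.

End EuclideanCurves.

Section LagrangianSubmanifold.
Variables (R : realType) (m n : nat).
Notation d1 := (m.+1 + n + m.+1 * n)%N.
Notation d2 := (m.+1 + dimMf m n + m.+1 * dimMf m n)%N.
Variables (M : mfd R m.+1) (E : mfd R (m.+1 + n)) (pi : pt E -> pt M).
Variable eta : pt M -> altform R m.+1 m.+1.
Variable L : pt (J1pi eta pi) -> R.
Variable A : pt (J1pinu eta pi) -> pt (J1pi eta pi) * altform R m.+2 d1.
Variable Om : pt (J1pinu eta pi) -> altform R m.+3 d2.
Hypotheses (wM : wf_mfd M) (wE : wf_mfd E).
Hypothesis cover : forall e, carrier (m := E) e ->
  exists cM cE, adapted eta pi cM cE /\ chart_dom cE e.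
Hypothesis HL : smooth_function L.
Hypothesis HA : is_tulczyjew A.
Hypothesis HOm : is_premultisymplectic Om.
Let wW := wf_J1pinu wM wE cover.

Lemma wedge_wedge_chart (D : 'M[R]_d2) (p q : 'rV[R]_d2 -> R) (w : altform R m.+1 d2) B :
  (forall v, p v = mom_part (v *m D) 0 B) -> (forall v, q v = jet_part (v *m D) 0 B) ->
  (forall W, w W = \det (W *m D *m Xcols (Xi R m n))) ->
  wedge1 p (wedge1 q w) = fun V => \det (V *m D *m frame R B).
Proof.
move=> pE qE wE'.
have -> : w = fun W => \det (W *m (D *m Xcols (Xi R m n))).
  by apply/funext => W; rewrite wE' mulmxA.
have -> : q = fun v => (v *m (D *m col B (Xi R m n))) 0 0.
  by apply/funext => v; rewrite qE mulmxA -col_mul mul_Xi [RHS]mxE.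
have -> : p = fun v => (v *m (D *m col B (Pi R m n))) 0 0.
  by apply/funext => v; rewrite pE mulmxA -col_mul mul_Pi [RHS]mxE.
rewrite (_ : wedge1 _ (fun W => \det _) = fun W => \det (W *m (D *m
    row_mx (col B (Xi R m n)) (Xcols (Xi R m n))))); last first.
  by apply/funext => W; rewrite wedge_det -mul_mx_row.
by apply/funext => V; rewrite wedge_det -mul_mx_row mulmxA.
Qed.

Section InChart.
Variables (cM : chart R (pt M) m.+1) (cE : chart R (pt E) (m.+1 + n)).
Hypothesis ad : adapted eta pi cM cE.
Notation cJ := (chartE eta pi cM cE).
Notation cW := (chartM eta pi cM cE).
Let F := graph_eq (Lc L cM cE).
Let oJ := open_imageE wM wE cover ad.
Let sL := Cinf_Lc HL ad.

(** The terms of omega indexed by the x^i vanish, because the momenta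
    conjugate to them are 0. *)
Lemma Om_chart w V : chart_dom cW w -> Om w V = omega (V *m dchart cW w).
Proof.
move=> cw; rewrite (HOm ad cw); cbv zeta.
have dE W : coord_volume cW (@wx m n) w W = \det (W *m dchart cW w *m Xcols (Xi R m n)).
  rewrite Xcols_mul; congr (\det _); apply/matrixP => i j.
  rewrite mxE /dcoord -row_mul mxE [RHS]mxE.
  have := mul_Xi (row i (W *m dchart cW w)); rewrite -row_mul => /rowP/(_ (ix n j)).
  by rewrite jet_part_x !mxE => ->.
rewrite /omega sum_jet_index [X in X + _ + _]big1 ?add0r; last first.
  move=> i _; apply: (@det_col0 _ _ _ (lshift _ 0)) => j.
  by rewrite mul_mx_row [LHS]row_mxEl col_Pi_ix mulmx0 mxE.
rewrite opprD; congr (_ + _).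
  congr (- _); apply: eq_bigr => a _.
  rewrite (wedge_wedge_chart (D := dchart cW w) (B := iu m a)) // => v.
    by rewrite mom_part_u.
  by rewrite jet_part_u.
congr (- _); apply: eq_bigr => i _; apply: eq_bigr => a _.
rewrite (wedge_wedge_chart (D := dchart cW w) (B := iui i a)) // => v.
  by rewrite mom_part_ui.
by rewrite jet_part_ui.
Qed.

(** One inclusion differentiates the equations along a curve drawn on S_L; the
    other one uses [graph_curve]. *)
Lemma tangent_SL w v : chart_dom cW w -> SL L A w ->
  tangent_set (P := J1pinu eta pi) (SL L A) w v <->
  v *m dchart cW w *m 'J F (chart_map cW w) = 0.
Proof.
move=> cw Sw; have aW := atlas_chartM ad; have iW := is_chartM wM wE cover ad.
have Fw := (SL_chart wM wE cover HL HA ad cw).1 Sw.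
have cF : Cinf (chart_image cW) F.
  by rewrite -(graph_domE wM wE cover ad); exact: Cinf_graph_eq.
have Iw := chart_map_image cw.
have uD := dchart_unit wW aW cw.
split.
  move=> [U [g [[oU U0] sg Sg g0 ->]]].
  have sg0 : smooth_at (X := euclidean R 1) (Y := J1pinu eta pi) g (id_chart R 1) cW 0.
    apply: (smooth_map_at _ _ aW sg) => //; last by rewrite g0.
    exact: (wf_chart (wf_euclidean R 1)).
  have JE := Tmap_euclidean wW aW sg0; rewrite g0 in JE.
  rewrite [_ *m dchart _ _]JE.
  apply: etrans (jacobian_cst (0 : 'rV[R]_(n + m.+1 * n)) (0 : 'rV[R]_1)).
  have [_ [Q [oQ Q0 HQ cQ]]] := sg0.
  apply/esym/(jacobian_comp_near (openI oU oQ) (conj U0 Q0)) => [t [Ut Qt]|||].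
  - have [_ ct] := HQ t Qt.
    by apply/esym/(SL_chart wM wE cover HL HA ad ct).1; exact: Sg.
  - by rewrite /= g0.
  - exact: Cinf_diff cQ Q0.
  - exact: Cinf_diff cF Iw.
move=> vF; set y := chart_map cW w in Iw Fw vF *; set u := v *m dchart cW w in vF.
pose K : 'M[R]_(_, d2) := - lin1_mx (@corr R m n).
(* G is the retraction x |-> x - corr (F x) onto the solutions *)
pose G x := x + F x *m K.
pose a (t : 'rV[R]_1) := y + t *m u.
have curveE t : graph_curve (Lc L cM cE) y u t = G (a t).
  by rewrite /G mulmxN mul_rV_lin1.
have oI := open_imageM wM wE cover ad.
have cK : Cinf (chart_image cW) (fun x => F x *m K).
  by apply: Cinf_mulmx => //; exact: Cinf_cst.
have cG : Cinf (chart_image cW) G by apply: CinfD => //; exact: Cinf_id.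
have ca : Cinf setT a.
  by apply: CinfD; [exact: openT|exact: Cinf_cst|exact/Cinf_linmx/openT].
pose U := setT `&` a @^-1` chart_image cW.
have oU : open U := open_Cinf_preimage openT oI ca.
have a0 : a 0 = y by rewrite /a mul0mx addr0.
have U0 : U 0 by split=> //=; rewrite a0.
have JG : 'J G y = 1%:M + 'J F y *m K.
  rewrite /G jacobianD; last exact: Cinf_diff cK Iw.
    rewrite jacobian_id; congr (_ + _).
    rewrite -[in RHS](jacobian_linmx K (F y)).
    by apply: (jacobian_comp_near oI Iw) => //;
       [exact: Cinf_diff cF Iw|exact: Cinf_diff (Cinf_linmx K openT) I].
  exact: (@Cinf_diff R _ _ setT id y (@Cinf_id R _ setT) I).
have Ja : 'J a 0 = u.
  rewrite /a jacobianD.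
  - by rewrite jacobian_cst add0r jacobian_linmx.
  - exact: Cinf_diff (Cinf_cst setT y) I.
  - exact: Cinf_diff (Cinf_linmx u openT) I.
pose g t : pt (J1pinu eta pi) := chart_inv cW (G (a t)).
have IG t : U t -> chart_image cW (G (a t)).
  move=> [_ It]; rewrite -curveE; apply/(chartM_image wM wE cover ad).
  by rewrite jet_part_curve; apply/(chartM_image wM wE cover ad).
have gE t : U t -> chart_dom cW (g t) /\ chart_map cW (g t) = G (a t).
  by move=> /IG; exact: chart_image_inv.
have cGa : Cinf U (G \o a).
  apply: (Cinf_comp_mx (U' := chart_image cW)) => //; first by move=> t [].
  by apply: Cinf_sub ca.
have Gy : G y = y by rewrite /G (_ : F y = 0) // mul0mx addr0.
have sgt t : U t -> smooth_at (X := euclidean R 1) (Y := J1pinu eta pi) g (id_chart R 1) cW t.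
  move=> Ut; split=> //; exists U; split=> //.
    by move=> t' /gE[? _]; rewrite id_chart_image.
  by apply: (Cinf_ext oU _ cGa) => t' /gE[_ h]; exact: (esym h).
exists U, g; split=> //.
- apply: (smooth_at_map (wf_euclidean R 1) wW).
    split=> // c ->; rewrite setIT.
    by rewrite (_ : _ @` U = U) //; apply/seteqP; split=> [_ [t Ut <-]|t Ut] //; exists t.
  by move=> t Ut; exists (id_chart R 1), cW; split=> //; exact: sgt.
- move=> t Ut; have [h1 h2] := gE t Ut.
  by apply/(SL_chart wM wE cover HL HA ad h1); rewrite h2 -curveE graph_eq_curve.
- by rewrite /g a0 Gy chart_invK.
have JE := Tmap_euclidean wW aW (sgt 0 U0).
have g0 : g 0 = w by rewrite /g a0 Gy chart_invK.
rewrite g0 in JE.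
apply: (can_inj (mulmxK uD)); rewrite [RHS]JE -/u.
apply/esym/(@etrans _ _ ('J a 0 *m 'J G y)); last first.
  by rewrite Ja JG mulmxDr mulmx1 mulmxA vF mul0mx addr0.
have gE' t : U t -> (chart_map cW \o g) t = G (a t) by move=> /gE[].
exact: (jacobian_comp_near oU U0 gE' a0 (Cinf_diff ca I) (Cinf_diff cG Iw)).
Qed.

Let H w := hess (Lc L cM cE) (jet_part (chart_map cW w)).

Lemma image_jet_part w : chart_dom cW w -> graph_dom (chart_image cJ) (chart_map cW w).
Proof. by move=> cw; rewrite (graph_domE wM wE cover ad); exact: chart_map_image. Qed.

Lemma tangent_SL_hess w v : chart_dom cW w -> SL L A w ->
  tangent_set (P := J1pinu eta pi) (SL L A) w v <->
  vpart (v *m dchart cW w *m Pi R m n - v *m dchart cW w *m Xi R m n *m H w) = 0.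
Proof.
move=> cw Sw; rewrite tangent_SL // /F.
by rewrite (kernel_graph_eq oJ sL) //; exact: image_jet_part.
Qed.

Lemma hess_symH w : chart_dom cW w -> (H w)^T = H w.
Proof. by move=> /image_jet_part Iw; exact: (hess_sym oJ sL Iw). Qed.

(** If v is tangent up to the kernel, multilinearity and isotropy make Omega
    vanish. Conversely, tau is the tangent vector with the same jet components
    as v; the difference has only momentum components, and these vanish by
    [omega_test]. *)
Lemma lagrangian_point w v : chart_dom cW w -> SL L A w ->
  (exists2 t, tangent_set (P := J1pinu eta pi) (SL L A) w t & flat_kernel (Om w) (v - t)) <->
  (forall V : 'M[R]_(m.+3, d2), row ord0 V = v ->
    (forall i : 'I_m.+3, (1 <= i <= m.+2)%N ->
      tangent_set (P := J1pinu eta pi) (SL L A) w (row i V)) -> Om w V = 0).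
Proof.
move=> cw Sw; have uD := dchart_unit wW (atlas_chartM ad) cw.
have Hs := hess_symH cw; set D := dchart cW w in uD.
have tP u : tangent_set (P := J1pinu eta pi) (SL L A) w (u *m invmx D) <->
    vpart (u *m Pi R m n - u *m Xi R m n *m H w) = 0.
  by rewrite (tangent_SL_hess _ cw Sw) -/D mulmxKV.
have split0 (u t : 'rV[R]_d2) W : omega (col_mx u W : 'M[R]_(1 + (1 + m.+1), d2)) =
    omega (col_mx t W : 'M[R]_(1 + (1 + m.+1), d2)) +
    omega (col_mx (u - t) W : 'M[R]_(1 + (1 + m.+1), d2)).
  have [aw _] := @omega_alt R m n.
  have r0 (x : 'rV[R]_d2) : row ord0 (col_mx x W : 'M[R]_(1 + (1 + m.+1), d2)) = x.
    have -> : ord0 = lshift (1 + m.+1) (0 : 'I_1) by exact: val_inj.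
    by apply/rowP => j; rewrite mxE [LHS]col_mxEu.
  have r' (x : 'rV[R]_d2) : row' ord0 (col_mx x W : 'M[R]_(1 + (1 + m.+1), d2)) = W.
    apply/matrixP => i j; rewrite mxE.
    have -> : lift ord0 i = rshift 1 i :> 'I_(1 + (1 + m.+1)) by exact: val_inj.
    exact: col_mxEd.
  rewrite -[RHS]/(_ + _) -[X in X + _]mul1r -[X in _ + X]mul1r.
  by apply: (aw ord0); rewrite ?r' // !r0 !scale1r addrC subrK.
have iso (u : 'rV[R]_d2) W : vpart (u *m Pi R m n - u *m Xi R m n *m H w) = 0 ->
    tangent_rows (H w) W -> omega (col_mx u W : 'M[R]_(1 + (1 + m.+1), d2)) = 0.
  move=> tu tW; apply: (omega_isotropic Hs) => i.
  case: (split_ordP i) => k ->; first by rewrite rowKu ord1 row_id.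
  by rewrite rowKd; exact: tW.
have OmE (x : 'rV[R]_d2) (W : 'M[R]_(1 + m.+1, d2)) :
    Om w (col_mx x W : 'M[R]_(1 + m.+2, d2)) =
    omega (col_mx (x *m D) (W *m D) : 'M[R]_(1 + (1 + m.+1), d2)).
  by rewrite (Om_chart _ cw); congr omega; exact: mul_col_mx.
split=> [[t Tt kt] V V0 VS|HV].
  have VE : V = col_mx v (dsubmx (V : 'M[R]_(1 + m.+2, d2))).
    apply: (etrans (esym (@vsubmxK R 1 m.+2 d2 V))); congr (col_mx _ _).
    apply/rowP => j; rewrite -V0 !mxE; congr (V _ j); exact: val_inj.
  pose W := dsubmx (V : 'M[R]_(1 + m.+2, d2)) *m D.
  have tW : tangent_rows (H w) W.
    move=> i; rewrite -tP -row_mul mulmxK //.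
    have -> : row i (dsubmx (V : 'M[R]_(1 + m.+2, d2))) = row (rshift 1 i) V.
      by apply/rowP => j; rewrite !mxE.
    by apply: VS; apply/andP; split=> //; exact: (ltn_ord i).
  rewrite (Om_chart _ cw) -/D VE -[_ *m D]/(col_mx v (dsubmx _) *m D).
  rewrite mul_col_mx (split0 _ (t *m D)) iso ?add0r //; last first.
    by rewrite -tP mulmxK.
  rewrite -mulmxBl -mul_col_mx -(Om_chart _ cw).
  exact: (congr1 (fun f => f (dsubmx (V : 'M[R]_(1 + m.+2, d2)))) kt).
(* the tangent vector of S_L with jet components xi *)
pose lift xi := emb xi + corr (vpart (xi *m H w - mom_part (emb xi))) : 'rV[R]_d2.
have liftX xi : lift xi *m Xi R m n = xi.
  by rewrite mul_Xi linearD /= jet_part_emb jet_part_corr addr0.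
have liftT xi : vpart (lift xi *m Pi R m n - lift xi *m Xi R m n *m H w) = 0.
  rewrite liftX linearB /= mul_Pi linearD [vpart (_ + _)]linearD /= mom_part_corr.
  by rewrite linearB /= [X in X - _]addrC subrK subrr.
pose u := v *m D; pose tau := lift (u *m Xi R m n).
have uX : (u - tau) *m Xi R m n = 0 by rewrite mulmxBl liftX subrr.
exists (tau *m invmx D); first exact/tP/liftT.
have uP : (u - tau) *m Pi R m n = 0.
  have zero B (T : 'M[R]_(1 + m.+1, d2)) : (forall i, B != ix n i) ->
      tangent_rows (H w) T ->
      (forall C, (T *m Xi R m n) (lshift _ 0) C = (C == B)%:R) ->
      (forall i C, (T *m Xi R m n) (rshift _ i) C = (C == ix n i)%:R) ->
      ((u - tau) *m Pi R m n) 0 B = 0.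
    move=> nB tT T0 TS; apply/eqP; rewrite -oppr_eq0 -(omega_test nB uX T0 TS).
    have := HV (col_mx v (T *m invmx D) : 'M[R]_(1 + m.+2, d2)).
    rewrite OmE mulmxKV // (split0 _ tau) (iso tau T (liftT _) tT) add0r => -> //.
      have -> : ord0 = lshift m.+2 (0 : 'I_1) by exact: val_inj.
      by apply/rowP => j; rewrite mxE [LHS]col_mxEu.
    move=> i; case: (split_ordP (i : 'I_(1 + m.+2))) => k -> ki; first by rewrite ord1 in ki.
    have -> : row (rshift 1 k) (col_mx v (T *m invmx D) : 'M[R]_(1 + m.+2, d2)) =
        row k T *m invmx D.
      by apply/rowP => j; rewrite -row_mul mxE [RHS]mxE; exact: col_mxEd.
    by rewrite tP; exact: tT.
  have zero' B : (forall i, B != ix n i) -> ((u - tau) *m Pi R m n) 0 B = 0.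
    move=> nB.
    pose T : 'M[R]_(1 + m.+1, d2) := col_mx (lift (delta_mx 0 B))
      (\matrix_i lift (delta_mx 0 (ix n i))).
    apply: (zero B T) => // [i|C|i C].
    - case: (split_ordP i) => k ->; first by rewrite rowKu ord1 row_id.
      by rewrite rowKd rowK.
    - rewrite mul_col_mx col_mxEu liftX mxE eqxx eq_sym //.
    - rewrite mul_col_mx col_mxEd.
      have -> : (\matrix_i lift (delta_mx 0 (ix n i)) *m Xi R m n) i C =
          (row i (\matrix_i lift (delta_mx 0 (ix n i))) *m Xi R m n) 0 C.
        by rewrite -row_mul [RHS]mxE.
      by rewrite rowK liftX mxE eqxx eq_sym.
  apply/rowP => B; rewrite [RHS]mxE; case: (jet_indexP B) => [i|a|i a].
  - by rewrite mul_Pi mom_part_x.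
  - by apply: zero' => i; rewrite eq_sym ix_iu.
  - by apply: zero' => j; rewrite eq_sym ix_iui.
apply/funext => W.
rewrite /Defs.contract OmE mulmxBl mulmxKV //.
exact: omega_kernel.
Qed.

End InChart.

Lemma lagrangian_SL : is_lagrangian (P := J1pinu eta pi) (n + m.+1 * n) m.+2 Om (SL L A).
Proof.
have charts w : SL L A w -> exists cM cE, adapted eta pi cM cE /\
    chart_dom (chartM eta pi cM cE) w.
  move=> [/(wf_cover wW)[_ [cM [cP [ad ->]]] cw] _].
  by have [cE cPE ad'] := adapted_pinu wM wE ad; exists cM, cE; rewrite /chartM -cPE.
split; first by rewrite leqnn.
- split=> [w []//|w Sw]; have [cM [cE [ad cw]]] := charts w Sw.
  exists (chartM eta pi cM cE), (chart_image (chartM eta pi cM cE)), (SL_equations L cM cE).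
  split=> //; [exact: atlas_chartM|exact: chart_map_image|].
  exact: local_equations_SL.
- move=> w Sw v; have [cM [cE [ad cw]]] := charts w Sw.
  exact: lagrangian_point ad _ _ cw Sw.
Qed.

End LagrangianSubmanifold.

(** * Sections and the Legendre transform *)

Section SectionDerivatives.
Variables (R : realType) (m k : nat) (M : mfd R m) (P : mfd R (m + k)).
Variables (eta : pt M -> altform R m m) (rho : pt P -> pt M).
Hypothesis wM : wf_mfd M.

Lemma section_pderiv_near U s cM cP i f g x :
  local_section rho U s -> adapted eta rho cM cP -> U x -> chart_dom cP (s x) ->
  (forall x', U x' -> chart_dom cP (s x') -> f x' = g x') ->
  pderiv cM i f x = pderiv cM i g x.
Proof.
move=> ls ad Ux cx fg; have [Q [oQ Qx _ HQ]] := section_rep wM ls ad Ux cx.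
apply: near_eq_derive; apply: (near_open oQ Qx) => y /HQ[x' [Ux' cx' _ E]].
by rewrite /= E; exact: fg.
Qed.

End SectionDerivatives.

Section Solutions.
Variables (R : realType) (m n : nat).
Notation d1 := (m.+1 + n + m.+1 * n)%N.
Notation d2 := (m.+1 + dimMf m n + m.+1 * dimMf m n)%N.
Variables (M : mfd R m.+1) (E : mfd R (m.+1 + n)) (pi : pt E -> pt M).
Variable eta : pt M -> altform R m.+1 m.+1.
Variable L : pt (J1pi eta pi) -> R.
Variable A : pt (J1pinu eta pi) -> pt (J1pi eta pi) * altform R m.+2 d1.
Variable Leg : pt (J1pi eta pi) -> pt (Mpi eta pi).
Hypotheses (wM : wf_mfd M) (wE : wf_mfd E).
Hypothesis cover : forall e, carrier (m := E) e ->
  exists cM cE, adapted eta pi cM cE /\ chart_dom cE e.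
Hypothesis HL : smooth_function L.
Hypothesis HA : is_tulczyjew A.
Hypothesis HLeg : is_legendre L Leg.
Let wMpi := wf_Mpi wM wE cover.
Let wJ := wf_J1pi wM wE cover.

Lemma mm_base_linear : linear (@mm_base R m n).
Proof. by move=> c u v; rewrite /mm_base !linearP /= scale_row_mx add_row_mx. Qed.
HB.instance Definition _ := GRing.isLinear.Build R 'rV[R]_(m.+1 + dimMf m n)
  'rV[R]_(m.+1 + n) _ (@mm_base R m n) mm_base_linear.

Lemma nu_smooth_at cM cE z : adapted eta pi cM cE -> chart_dom (mm_chart pi cE) z ->
  smooth_at (X := Mpi eta pi) (Y := E) (fun z => z.1) (mm_chart pi cE) cE z.
Proof.
move=> ad cz; have [_ aP _ _] := adapted_mm ad.
apply: (smooth_at_linear (C := lin1_mx (@mm_base R m n)) (wf_chart wMpi aP) cz _).1.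
by move=> z' [Lz cz']; split=> //; rewrite [RHS]mul_rV_lin1; exact/esym/mm_base_map.
Qed.

Lemma nu_section U t : local_section (pinu eta pi) U t ->
  local_section pi U (fun x => (t x).1).
Proof.
move=> lt; have [mU st rt] := lt; split=> //.
apply: smooth_at_map => // x Ux.
have [cM [cP [ad cx]]] := cover_Mpi cover (st.1 x Ux).
have [cE cPE adE] := adapted_pinu wM wE ad; rewrite {cP}cPE in ad cx.
have [aM aP _ _] := ad; have [_ aE _ _] := adE.
exists cM, cE; split=> //.
have := smooth_at_comp (wf_chart wM aM) (wf_chart wMpi aP)
  (section_smooth_at wM lt ad Ux cx) (nu_smooth_at adE cx).
by case.
Qed.

Section OverSection.
Variables (U : set (pt M)) (s : pt M -> pt E) (t : pt M -> pt (Mpi eta pi)).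
Hypotheses (ls : local_section pi U s) (lt : local_section (pinu eta pi) U t).
Hypothesis ts : forall x, U x -> (t x).1 = s x.

Definition legendre_momenta := forall cM cE, adapted eta pi cM cE ->
  forall x, U x -> chart_dom (mm_chart pi cE) (t x) ->
  forall i a, chart_map (mm_chart pi cE) (t x) 0 (rshift m.+1 (fpi i a)) =
    pderiv (chartE eta pi cM cE) (iui i a) L (j1 s x).

Section InChart.
Variables (cM : chart R (pt M) m.+1) (cE : chart R (pt E) (m.+1 + n)).
Hypothesis ad : adapted eta pi cM cE.
Notation cJ := (chartE eta pi cM cE).
Notation cW := (chartM eta pi cM cE).
Variable x : pt M.
Hypotheses (Ux : U x) (cx : chart_dom cE (s x)).

Lemma section_dom_mm x' : U x' -> chart_dom cE (s x') <-> chart_dom (mm_chart pi cE) (t x').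
Proof.
move=> Ux'; split=> [c'|[_]]; last by rewrite ts.
by have [_ [Ct _] _] := lt; split; [exact: Ct|rewrite ts].
Qed.

Lemma section_dom_jetM : chart_dom cW (j1pinu eta pi t x).
Proof. by apply: (jet_section wM wMpi lt (adapted_mm ad) Ux); apply/section_dom_mm. Qed.

Lemma section_dom_jetE : chart_dom cJ (j1 s x).
Proof. exact: (jet_section wM wE ls ad Ux). Qed.

Lemma jet_part_section : jet_part (chart_map cW (j1pinu eta pi t x)) = chart_map cJ (j1 s x).
Proof.
have ct := (section_dom_mm Ux).1 cx; have adm := adapted_mm ad.
have lE : lsubmx (jet_part (chart_map cW (j1pinu eta pi t x))) =
    lsubmx (chart_map cJ (j1 s x)).
  by rewrite lsubmx_jet_part !jet_chart_mapE !row_mxKl [LHS]mm_base_map ts.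
apply: jet_row_eq => [i|a|i a].
- by have /rowP/(_ (lshift n i)) := lE; rewrite !mxE.
- by have /rowP/(_ (rshift m.+1 a)) := lE; rewrite !mxE.
rewrite jet_part_ui (jet_section_der wM wMpi lt adm _ _ Ux ct).
rewrite [RHS](jet_section_der wM wE ls ad _ _ Ux cx).
apply: (section_pderiv_near wM _ ls ad Ux cx) => x' Ux' cx'.
rewrite mm_mapE row_mxEr /fu row_mxEl mxE -ts //.
Qed.

Lemma jet_point_section : jet_point cM cE (j1pinu eta pi t x) = j1 s x.
Proof.
rewrite /jet_point jet_part_section.
exact: (chart_invK (is_chartE wM wE cover ad) section_dom_jetE).
Qed.

(** The equations of S_L at the jet of a section, at one point: the derivative
    coordinates of the jet have become derivatives of the momenta of the
    section. *)
Lemma SL_section : SL L A (j1pinu eta pi t x) <->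
  (forall a, \sum_i pderiv cM i
      (fun y => chart_map (mm_chart pi cE) (t y) 0 (rshift m.+1 (fpi i a))) x =
    pderiv cJ (iu m a) L (j1 s x)) /\
  (forall i a, chart_map (mm_chart pi cE) (t x) 0 (rshift m.+1 (fpi i a)) =
    pderiv cJ (iui i a) L (j1 s x)).
Proof.
have ct := (section_dom_mm Ux).1 cx; have adm := adapted_mm ad.
have cw := section_dom_jetM.
have gE j : grad (Lc L cM cE) (chart_map cJ (j1 s x)) 0 j = pderiv cJ j L (j1 s x).
  by rewrite mxE.
rewrite (SL_chart wM wE cover HL HA ad cw) /graph_eq vpart_eq0 jet_part_section.
have uE a : (mom_part (chart_map cW (j1pinu eta pi t x)) -
    grad (Lc L cM cE) (chart_map cJ (j1 s x))) 0 (iu m a) =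
    \sum_i pderiv cM i
      (fun y => chart_map (mm_chart pi cE) (t y) 0 (rshift m.+1 (fpi i a))) x -
    pderiv cJ (iu m a) L (j1 s x).
  rewrite mxBE gE mom_part_u; congr (_ - _); apply: eq_bigr => i _.
  exact: (jet_section_der wM wMpi lt adm).
have uiE i a : (mom_part (chart_map cW (j1pinu eta pi t x)) -
    grad (Lc L cM cE) (chart_map cJ (j1 s x))) 0 (iui i a) =
    chart_map (mm_chart pi cE) (t x) 0 (rshift m.+1 (fpi i a)) -
    pderiv cJ (iui i a) L (j1 s x).
  rewrite mxBE gE mom_part_ui; congr (_ - _).
  by rewrite jet_chart_mapE /wp /jbase row_mxEl.
split=> -[h1 h2]; split=> [a|i a].
- by apply/eqP; rewrite -subr_eq0 -uE h1.
- by apply/eqP; rewrite -subr_eq0 -uiE h2.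
- by rewrite uE h1 subrr.
- by rewrite uiE h2 subrr.
Qed.

Lemma SL_sectionA : SL L A (j1pinu eta pi t x) <->
  A (j1pinu eta pi t x) = dLagrangian L (j1 s x).
Proof.
have cw := section_dom_jetM.
rewrite (SL_chart wM wE cover HL HA ad cw) -(tulczyjew_eq wM wE cover HL HA ad cw).
by rewrite jet_point_section.
Qed.

End InChart.

Lemma section_chart x : U x -> exists cM cE, adapted eta pi cM cE /\ chart_dom cE (s x).
Proof. by move=> Ux; have [_ [Cs _] _] := ls; exact: cover (Cs x Ux). Qed.

(** The equations for p^i_a hold at all points of the section, so their
    right-hand sides may be differentiated in place of p^i_a in the other
    family. *)
Lemma SL_euler_lagrange : (forall x, U x -> SL L A (j1pinu eta pi t x)) <->
  euler_lagrange L U s /\ legendre_momenta.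
Proof.
split=> [HS|[EL LM] x Ux].
  have LM : legendre_momenta.
    move=> cM cE ad x Ux ct i a; have cx := (section_dom_mm cE Ux).2 ct.
    by have [_ ->] := (SL_section ad Ux cx).1 (HS x Ux).
  split=> // cM cE ad x Ux cx a; cbv zeta.
  have [<- _] := (SL_section ad Ux cx).1 (HS x Ux).
  apply/eqP; rewrite subr_eq0; apply/eqP/eq_bigr => i _.
  apply: (section_pderiv_near wM _ ls ad Ux cx) => x' Ux' cx'.
  by apply: LM => //; exact/section_dom_mm.
have [cM [cE [ad cx]]] := section_chart Ux.
apply/(SL_section ad Ux cx); split=> [a|i a]; last first.
  by apply: LM => //; exact/section_dom_mm.
have /eqP := EL cM cE ad x Ux cx a; rewrite subr_eq0 => /eqP ->.
apply: eq_bigr => i _; apply: (section_pderiv_near wM _ ls ad Ux cx) => x' Ux' cx'.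
by apply: LM => //; exact/section_dom_mm.
Qed.

Lemma SL_tulczyjew : (forall x, U x -> SL L A (j1pinu eta pi t x)) <->
  (forall x, U x -> dLagrangian L (j1 s x) = A (j1pinu eta pi t x)).
Proof.
split=> H x Ux; have [cM [cE [ad cx]]] := section_chart Ux.
  by apply/esym/(SL_sectionA ad Ux cx); exact: H.
by apply/(SL_sectionA ad Ux cx)/esym/H.
Qed.

End OverSection.

Lemma legendre_base cM cE z : adapted eta pi cM cE ->
  chart_dom (chartE eta pi cM cE) z -> (Leg z).1 = z.1.
Proof.
move=> ad cz; have [[_ cL] LE] := HLeg ad cz; have [_ cz1] := cz.
have [_ aE _ _] := ad; have iE := wf_chart wE aE.
rewrite -(chart_invK iE cL) -(chart_invK iE cz1); congr chart_inv.
by rewrite -(mm_base_map pi) LE /mm_base row_mxKl row_mxKr row_mxKl hsubmxK.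
Qed.

Lemma legendre_smooth_at cM cE z : adapted eta pi cM cE ->
  chart_dom (chartE eta pi cM cE) z ->
  smooth_at (X := J1pi eta pi) (Y := Mpi eta pi) Leg (chartE eta pi cM cE)
    (mm_chart pi cE) z.
Proof.
move=> ad cz; set cJ := chartE eta pi cM cE in cz *.
have iJ : is_chart (X := J1pi eta pi) cJ := is_chartE wM wE cover ad.
have oI := open_imageE wM wE cover ad.
split=> //; exists (chart_image cJ); split=> //; first exact: chart_map_image.
  by move=> y Iy; split=> //; have [cy _] := chart_image_inv iJ Iy; have [] := HLeg ad cy.
pose q y : 'M[R]_(m.+1, n) := \matrix_(i, a) grad (Lc L cM cE) y 0 (iui i a).
pose p y : R := Lc L cM cE y - \sum_i \sum_a q y i a * y 0 (iui i a).
have cL := Cinf_Lc HL ad; have cg := Cinf_grad oI cL.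
have ce i a : Cinf (chart_image cJ) (fun y => grad (Lc L cM cE) y 0 (iui i a)).
  exact: Cinf_entry.
have cq : Cinf (chart_image cJ) q.
  by apply: Cinf_mx => // i a; apply: Cinf_ext (ce i a) => // y _; rewrite [RHS]mxE.
have cp : Cinf (chart_image cJ) p.
  apply: CinfB => //; apply: Cinf_sum => // i _; apply: Cinf_sum => // a _.
  by apply: CinfM => //; apply: Cinf_entry => //; exact: Cinf_id.
apply: (Cinf_ext (f := fun y => row_mx (lsubmx (lsubmx y))
    (row_mx (rsubmx (lsubmx y)) (row_mx (\matrix_(i, j) p y : 'M[R]_1) (mxvec (q y)))))) => //.
  move=> y Iy; have [cy yE] := chart_image_inv iJ Iy; have [_ LE] := HLeg ad cy.
  apply/esym/(etrans LE).
  have bE : chart_map cE (chart_inv cJ y).1 = lsubmx y.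
    by rewrite -[in RHS]yE jet_chart_mapE row_mxKl.
  have qE : \matrix_(i, a) pderiv cJ (iui i a) L (chart_inv cJ y) = q y.
    apply/matrixP => i a; rewrite [LHS]mxE [RHS]mxE.
    exact: pderiv_L.
  rewrite -/cJ bE qE yE; do 3 congr row_mx.
  by apply/matrixP => i j; rewrite !ord1 [LHS]mxE [RHS]mxE.
have cl : Cinf (chart_image cJ) (fun y : 'rV[R]_d1 => lsubmx y).
  by apply: Cinf_lsubmx => //; exact: Cinf_id.
apply: Cinf_row_mx => //; first exact: Cinf_lsubmx.
apply: Cinf_row_mx => //; first exact: Cinf_rsubmx.
apply: Cinf_row_mx => //; last exact: Cinf_mxvec.
by apply: Cinf_mx => // i j; apply: Cinf_ext cp => // y _; rewrite mxE.
Qed.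

Section LegendreSection.
Variables (U : set (pt M)) (s : pt M -> pt E).
Hypothesis ls : local_section pi U s.
Let t x : pt (Mpi eta pi) := Leg (j1 s x).

Lemma legendre_section_base x : U x -> (t x).1 = s x.
Proof.
move=> Ux; have [cM [cE [ad cx]]] := section_chart ls Ux.
by rewrite (legendre_base ad) //; exact: (section_dom_jetE ls ad Ux cx).
Qed.

Lemma legendre_section : local_section (pinu eta pi) U t.
Proof.
have [mU _ rs] := ls; split=> // [|x Ux]; last first.
  by rewrite -[LHS]/(pi (t x).1) legendre_section_base // rs.
apply: smooth_at_map => // x Ux; have [cM [cE [ad cx]]] := section_chart ls Ux.
have [aM _ _ _] := ad; have [_ aP _ _] := adapted_mm ad.
have cz := section_dom_jetE ls ad Ux cx.
have sj : smooth_at (Y := J1pi eta pi) (j1 s) cM (chartE eta pi cM cE) x.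
  exact: (jet_section_smooth wM wE ls ad Ux cx).
exists cM, (mm_chart pi cE); split=> //.
exact: (smooth_at_comp (wf_chart wM aM) (is_chartE wM wE cover ad) sj
  (legendre_smooth_at ad cz)).1.
Qed.

Lemma legendre_section_momenta : legendre_momenta U s t.
Proof.
move=> cM cE ad x Ux [_ ct] i a; rewrite legendre_section_base // in ct.
have [_ ->] := HLeg ad (section_dom_jetE ls ad Ux ct).
by rewrite row_mxEr /fpi row_mxEr row_mxEr mxvecE mxE.
Qed.

(** The section obtained by the Legendre transform satisfies the equations for
    p^i_a by construction. *)
Lemma euler_lagrange_legendre :
  euler_lagrange L U s <-> (forall x, U x -> SL L A (j1pinu eta pi t x)).
Proof.
rewrite (SL_euler_lagrange ls legendre_section legendre_section_base).
by split=> [EL|[]] //; split=> //; exact: legendre_section_momenta.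
Qed.

End LegendreSection.
End Solutions.

Theorem theorem4p6 (R : realType) (m n : nat)
    (M : mfd R m.+1) (E : mfd R (m.+1 + n)) (pi : pt E -> pt M)
    (eta : pt M -> altform R m.+1 m.+1)
    (L : pt (J1pi eta pi) -> R)
    (A : pt (J1pinu eta pi) ->
         pt (J1pi eta pi) * altform R m.+2 (m.+1 + n + m.+1 * n))
    (Leg : pt (J1pi eta pi) -> pt (Mpi eta pi))
    (Om : pt (J1pinu eta pi) ->
          altform R m.+3 (m.+1 + dimMf m n + m.+1 * dimMf m n))
    (HM : is_manifold M) (HE : is_manifold E)
    (Hpi : is_fiber_bundle pi)
    (Heta : is_volume_form eta)
    (HL : smooth_function L)
    (HA : is_tulczyjew A)
    (HLeg : is_legendre L Leg)
    (HOm : is_premultisymplectic Om) :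
  (* 1. *)
  (forall (U : set (pt M)) (s : pt M -> pt E), local_section pi U s ->
     (euler_lagrange L U s <->
      forall x, U x ->
        dLagrangian L (j1 s x) =
        A (j1pinu eta pi (fun y => Leg (j1 s y)) x)))
  /\
  (* 2. *)
  [/\ is_lagrangian (n + m.+1 * n) m.+2 Om (SL L A),
      (forall cM cE, adapted eta pi cM cE ->
         local_equations (SL L A) (chartM eta pi cM cE)
           (chart_image (chartM eta pi cM cE)) (SL_equations L cM cE)),
      (forall (U : set (pt M)) (t : pt M -> pt (Mpi eta pi)),
         local_section (pinu eta pi) U t ->
         ((forall x, U x -> SL L A (j1pinu eta pi t x)) <->
          (euler_lagrange L U (fun x => nu (t x)) /\
           forall cM cE, adapted eta pi cM cE ->
           forall x, U x -> chart_dom (mm_chart pi cE) (t x) ->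
           forall i a, chart_map (mm_chart pi cE) (t x) 0 (rshift m.+1 (fpi i a))
             = pderiv (chartE eta pi cM cE) (iui i a) L
                 (j1 (fun y => nu (t y)) x))))
    & (forall (U : set (pt M)) (s : pt M -> pt E), local_section pi U s ->
         (euler_lagrange L U s <->
          exists t : pt M -> pt (Mpi eta pi),
            [/\ local_section (pinu eta pi) U t,
                forall x, U x -> nu (t x) = s x
              & forall x, U x -> SL L A (j1pinu eta pi t x)]))].
Proof.
have wM := manifold_wf HM; have wE := manifold_wf HE.
have cover := adapted_chart HM HE Hpi Heta.
split=> [U s ls|].
  rewrite (euler_lagrange_legendre wM wE cover HL HA HLeg ls).
  have lt := legendre_section wM wE cover HL HLeg ls.
  have ts := legendre_section_base wM wE cover HLeg ls.
  exact: (SL_tulczyjew wM wE cover HL HA ls lt ts).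
split.
- exact: lagrangian_SL.
- by move=> cM cE ad; exact: local_equations_SL.
- move=> U t lt; have ls := nu_section wM wE cover lt.
  exact: (SL_euler_lagrange wM wE cover HL HA ls lt (fun _ _ => erefl)).
move=> U s ls; split=> [|[t [lt ts]]].
  rewrite (euler_lagrange_legendre wM wE cover HL HA HLeg ls) => HS.
  exists (fun x => Leg (j1 s x)); split=> //.
    exact: (legendre_section wM wE cover HL HLeg ls).
  exact: (legendre_section_base wM wE cover HLeg ls).
by move=> /(SL_euler_lagrange wM wE cover HL HA ls lt ts)[].
Qed.
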